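(* Let $f=h+\overline{g}$ be a harmonic mapping of the unit disk $\mathbb{D}$ (with $h,g$ analytic in $\mathbb{D}$), with $e^{\sigma(z)}=|h'(z)|+|g'(z)|\ne0$ for all $z\in\mathbb{D}$ and dilatation $g'/h'=q^2$ for some meromorphic function $q$ in $\mathbb{D}$. Let $\widetilde f$ denote the Weierstrass--Enneper lift of $f$ to a minimal surface with Gauss curvature $K=K(\widetilde f(z))$ at the point $\widetilde f(z)$. Suppose that $$|\mathcal{S}f(z)|+e^{2\sigma(z)}\,|K(\widetilde f(z))|\le C\,p(|z|),\qquad z\in\mathbb{D},$$ for some Nehari function $p$ and some constant $C=2(1+\delta^2)$, where $\delta>0$. Let $\mu=\lim_{x\to1-}(1-x^2)^2p(x)$. Then: (i) $\widetilde f$ is uniformly locally univalent. (ii) If $\mu=1$, so that $p(x)=(1-x^2)^{-2}$, then $d(\alpha,\beta)\ge\pi/\delta$ for any pair of distinct points $\alpha,\beta\in\mathbb{D}$ where $\widetilde f(\alpha)=\widetilde f(\beta)$. (iii) If $C\mu<2$, then $\widetilde f$ has finite valence that is bounded independently of $f$ (that is, there is a finite number $N$ depending only on $C$ and $p$ such that every such $\widetilde f$ has valence at most $N$).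
   Context: $\mathbb{D}=\{z\in\mathbb{C}:|z|<1\}$. A planar harmonic mapping is a complex-valued harmonic function; on $\mathbb{D}$ it is written $f=h+\overline g$ with $h,g$ analytic. The mapping $f$ is not assumed to be locally univalent. Weierstrass--Enneper lift: $\widetilde f(z)=(U(z),V(z),W(z))\in\mathbb{R}^3$, where $$U=\mathrm{Re}\,f,\qquad V=\mathrm{Im}\,f,\qquad W(z)=2\,\mathrm{Im}\int_{z_0}^z\sqrt{h'(\zeta)g'(\zeta)}\,d\zeta,$$ with $\sqrt{h'g'}=h'q$ and $z_0\in\mathbb{D}$ a fixed base point. This is a conformal parametrization of a minimal surface with first fundamental form $ds^2=e^{2\sigma}|dz|^2$, $\sigma=\log(|h'|+|g'|)$. The Gauss curvature of the surface at $\widetilde f(z)$ is $K(\widetilde f(z))=-e^{-2\sigma(z)}\Delta\sigma(z)$, where $\Delta$ is the Laplacian; at points where $h'(z)\neq0$ this equals $-\dfrac{4|q'|^2}{|h'|^2(1+|q|^2)^4}$. The Schwarzian derivative of such a harmonic mapping is $\mathcal{S}f=2(\sigma_{zz}-\sigma_z^2)$, where $\sigma_z=\frac12\left(\frac{\partial\sigma}{\partial x}-i\frac{\partial\sigma}{\partial y}\right)$, $z=x+iy$. A Nehari function is a positive continuous even function $p$ on $(-1,1)$ such that $(1-x^2)^2p(x)$ is nonincreasing on $[0,1)$ and no nontrivial solution $u$ of $u''+pu=0$ has more than one zero in $(-1,1)$. The limit $\mu$ exists by monotonicity. The hyperbolic metric on $\mathbb{D}$ is $d(\alpha,\beta)=\frac12\log\frac{1+\rho(\alpha,\beta)}{1-\rho(\alpha,\beta)}$,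 where $\rho(\alpha,\beta)=\left|\frac{\alpha-\beta}{1-\overline{\alpha}\beta}\right|$. The map $\widetilde f$ is uniformly locally univalent if there is a constant $\varepsilon>0$ such that $d(\alpha,\beta)\ge\varepsilon$ for every pair of distinct points $\alpha,\beta\in\mathbb{D}$ with $\widetilde f(\alpha)=\widetilde f(\beta)$. The valence of $\widetilde f$ is the supremum over points $P\in\mathbb{R}^3$ of the number of $z\in\mathbb{D}$ with $\widetilde f(z)=P$. *)

(* Defs.v *)
From Stdlib Require Import Reals List.
From Coquelicot Require Import Coquelicot.
Open Scope R_scope.

Definition in_disk (z : C) : Prop := Cmod z < 1.

(* Functions are total on [C]; every condition below only concerns their values
   on the disk, since the radius [r] may be taken as small as one likes. *)
Definition analytic_at (f : C -> C) (a : C) : Prop :=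
  exists (c : nat -> C) (r : R), 0 < r /\
    forall z : C, Cmod (z - a)%C < r ->
      @is_pseries C_AbsRing C_NormedModule c (z - a)%C (f z).

Definition analytic_in_disk (f : C -> C) : Prop :=
  forall a : C, in_disk a -> analytic_at f a.

(* Pole of order [m >= 1].  The value of [f] at [a] itself is unconstrained. *)
Definition pole_at (f : C -> C) (a : C) : Prop :=
  exists (m : nat) (k : C -> C) (r : R),
    (1 <= m)%nat /\ analytic_at k a /\ k a <> 0%C /\ 0 < r /\
    forall z : C, z <> a -> Cmod (z - a)%C < r ->
      f z = (k z / (z - a) ^ m)%C.

Definition meromorphic_in_disk (f : C -> C) : Prop :=
  forall a : C, in_disk a -> analytic_at f a \/ pole_at f a.

Definition partial_x (s : C -> R) (z : C) : R :=
  Derive (fun t : R => s (t, Im z)) (Re z).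

Definition partial_y (s : C -> R) (z : C) : R :=
  Derive (fun t : R => s (Re z, t)) (Im z).

Definition laplacian (s : C -> R) (z : C) : R :=
  partial_x (partial_x s) z + partial_y (partial_y s) z.

Definition wirtinger (F : C -> C) (z : C) : C :=
  let Fx : C := (partial_x (fun w => Re (F w)) z, partial_x (fun w => Im (F w)) z) in
  let Fy : C := (partial_y (fun w => Re (F w)) z, partial_y (fun w => Im (F w)) z) in
  ((Fx - Ci * Fy) / 2)%C.

Definition harmonic_map (h g : C -> C) (z : C) : C := (h z + Cconj (g z))%C.

Definition exp_sigma (h g : C -> C) (z : C) : R :=
  Cmod (C_derive h z) + Cmod (C_derive g z).

Definition sigma (h g : C -> C) (z : C) : R := ln (exp_sigma h g z).

Definition schwarzian (h g : C -> C) (z : C) : C :=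
  let s := fun w : C => RtoC (sigma h g w) in
  (2 * (wirtinger (wirtinger s) z - wirtinger s z ^ 2))%C.

Definition gauss_curvature (h g : C -> C) (z : C) : R :=
  - exp (- (2 * sigma h g z)) * laplacian (sigma h g) z.

(* Equality [g'/h' = q^2] of meromorphic functions: [h'] is not identically zero,
   and the two sides agree off the zeros of [h']. *)
Definition has_dilatation (h g q : C -> C) : Prop :=
  (exists z : C, in_disk z /\ C_derive h z <> 0%C) /\
  (forall z : C, in_disk z -> C_derive h z <> 0%C ->
     (C_derive g z / C_derive h z)%C = (q z ^ 2)%C).

Definition segment_integral (F : C -> C) (a b : C) : C :=
  @RInt C_R_CompleteNormedModule
    (fun t : R => (F (a + t * (b - a)) * (b - a))%C) 0 1.

(* When [exp_sigma] has no zero, a pole of [q] of order [m] is a zero of [h'] of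
   order [2 * m], where the continuous branch of [sqrt (h' * g')] vanishes; the
   product [C_derive h w * q w] is then [0] as well, whatever the value of [q] at
   its pole.  The integrand is thus analytic in the disk, and the integral along
   the segment is the integral along any path from [z0] to [z]. *)
Definition lift (h g q : C -> C) (z0 z : C) : R * R * R :=
  (Re (harmonic_map h g z),
   Im (harmonic_map h g z),
   2 * Im (segment_integral (fun w => (C_derive h w * q w)%C) z0 z)).

Definition liftable_harmonic_map (h g q : C -> C) : Prop :=
  analytic_in_disk h /\ analytic_in_disk g /\
  (forall z : C, in_disk z -> exp_sigma h g z <> 0) /\
  meromorphic_in_disk q /\ has_dilatation h g q.

Definition schwarzian_bound (h g : C -> C) (c : R) (p : R -> R) : Prop :=
  forall z : C, in_disk z ->
    Cmod (schwarzian h g z) +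
      exp (2 * sigma h g z) * Rabs (gauss_curvature h g z) <= c * p (Cmod z).

Definition solves_ode (p u : R -> R) : Prop :=
  forall x : R, -1 < x < 1 ->
    ex_derive u x /\ ex_derive (Derive u) x /\
    Derive (Derive u) x + p x * u x = 0.

Definition nehari_function (p : R -> R) : Prop :=
  (forall x : R, -1 < x < 1 -> 0 < p x) /\
  (forall x : R, -1 < x < 1 -> continuous p x) /\
  (forall x : R, -1 < x < 1 -> p (- x) = p x) /\
  (forall x y : R, 0 <= x -> x <= y -> y < 1 ->
     (1 - y ^ 2) ^ 2 * p y <= (1 - x ^ 2) ^ 2 * p x) /\
  (forall u : R -> R, solves_ode p u ->
     (exists x : R, -1 < x < 1 /\ u x <> 0) ->
     forall x y : R, -1 < x < 1 -> -1 < y < 1 -> u x = 0 -> u y = 0 -> x = y).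

Definition pseudo_hyperbolic (a b : C) : R :=
  Cmod ((a - b) / (1 - Cconj a * b))%C.

Definition hyperbolic_dist (a b : C) : R :=
  / 2 * ln ((1 + pseudo_hyperbolic a b) / (1 - pseudo_hyperbolic a b)).

Definition uniformly_locally_univalent (F : C -> R * R * R) : Prop :=
  exists eps : R, 0 < eps /\
    forall a b : C, in_disk a -> in_disk b -> a <> b -> F a = F b ->
      eps <= hyperbolic_dist a b.

(* The number of preimages of [P] is the supremum of the lengths of the lists of
   distinct preimages, so it is [p_infty] when there are infinitely many. *)
Definition valence (F : C -> R * R * R) : Rbar :=
  Lub_Rbar (fun x : R =>
    exists (P : R * R * R) (l : list C),
      NoDup l /\ (forall z : C, In z l -> in_disk z /\ F z = P) /\
      x = INR (length l)).

(* Main.v *)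
(* Let [F] be the lift and [phi] a hyperbolic geodesic of the disk, parametrized by hyperbolic
   arc length.  On the curve [F o phi], with speed [v], the function [u = |F o phi - P| / sqrt v]
   satisfies [u'' + (S/2) u >= 0] for every point [P], where [S] is the Ahlfors Schwarzian of the
   curve.  For a minimal surface [S <= (|Sf| + e^(2 sigma) |K|) (1 - |phi|^2)^2 - 2], the curvature
   of the curve splitting into a tangential part, given by the gradient of [sigma], and a normal
   part, at most [sqrt |K|].  If the weighted bound is [2 (1 + delta^2)] along a geodesic arc, Sturm
   comparison with [u'' + delta^2 u = 0] shows that [F] cannot take the same value at two of its
   points at distance less than [pi / delta].

   Since [(1 - r^2)^2 p r <= p 0], this gives (i).  For (ii), if [mu = 1] and
   [(1 - x^2)^2 p x > 1] somewhere, then the solution of [u'' + p u = 0] with [u 0 = 1] and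
   [u' 0 = 0] vanishes on both sides of [0], against the Nehari property.  For (iii), if
   [c mu < 2] then the bound holds with [delta = 0] near the unit circle, so [F] is injective on
   every hyperbolic half-plane lying there; together with (i) this separates the preimages of a
   point by a fixed Euclidean distance. *)
Require Import Defs.
From Stdlib Require Import Reals Lra Lia List Classical IndefiniteDescription.
From Coquelicot Require Import Coquelicot.
Open Scope R_scope.

(** The inequality for [u] and the Sturm comparison are fused into one maximum principle. Let [y] be
    a positive solution of [y'' + d'^2 y = 0] on the arc. If the curve returned to its starting
    point, [psi = 2 ln (u / y)] would have an interior maximum; but wherever [psi' = 0] the
    curvature estimate gives [psi'' >= 2 (d'^2 - delta^2)], positive as soon as [d' > delta]. The
    zeros of [u] at the two ends are never differentiated through.

    The obstacle is that [q] may have poles, which are zeros of [h']. All local computations use a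
    pair [(eta, k)] of holomorphic functions with [eta] free of zeros; at a pole of [q] the roles of
    [h] and [g] are exchanged, which only reflects the surface.

    The [1] in [1 + delta^2] is absorbed by the geodesic, whose Schwarzian is [- 2] in the arc
    length parameter. In (iii) the value [delta = 0] turns [PI <= delta * d] into a contradiction at
    once.

    The Nehari property speaks of zeros of solutions, so the extremal case needs an actual solution
    of the equation; it is built by Picard iteration for a [p] that is merely continuous. *)

(** * Complex derivatives *)

(* Complex derivative of a [C]-valued function of a parameter embedded in [C] by [i]:
   [i = RtoC] gives curves and [i = id] holomorphic functions. *)
Definition gderiv {X : Type} (i : X -> C) (f : X -> C) (x : X) (l : C) : Prop :=
  forall eps : R, 0 < eps -> exists d : R, 0 < d /\
    forall y : X, Cmod (i y - i x) < d ->
      Cmod (f y - f x - l * (i y - i x)) <= eps * Cmod (i y - i x).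

Notation cderiv := (gderiv RtoC).
Notation hderiv := (gderiv (fun z : C => z)).

Lemma C_ext (x y : C) : Re x = Re y -> Im x = Im y -> x = y.
Proof. destruct x, y; simpl; intros -> ->; reflexivity. Qed.

Lemma im_le_Cmod (z : C) : Rabs (Im z) <= Cmod z.
Proof.
apply Rle_trans with (Rmax (Rabs (fst z)) (Rabs (snd z))); [apply Rmax_r | apply Rmax_Cmod].
Qed.

Lemma Cmod_le_re_im (z : C) : Cmod z <= Rabs (Re z) + Rabs (Im z).
Proof.
replace z with (RtoC (Re z) + Ci * RtoC (Im z))%C at 1
  by (apply C_ext; simpl; ring).
eapply Rle_trans; [apply Cmod_triangle |].
rewrite Cmod_mult, Cmod_Ci, !Cmod_R; lra.
Qed.

Lemma Cmod_sym (x y : C) : Cmod (x - y) = Cmod (y - x).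
Proof. rewrite <- Cmod_opp; f_equal; ring. Qed.

Section GDeriv.
Context {X : Type} (i : X -> C).

Lemma gderiv_ext_loc (f g : X -> C) (x : X) (l : C) :
  (exists d, 0 < d /\ forall y, Cmod (i y - i x) < d -> f y = g y) ->
  f x = g x -> gderiv i f x l -> gderiv i g x l.
Proof.
intros [d [Hd E]] Ex H eps Heps.
destruct (H eps Heps) as [d' [Hd' H']].
exists (Rmin d d'); split; [now apply Rmin_pos|].
intros y Hy.
assert (Cmod (i y - i x) < d) by (eapply Rlt_le_trans; [apply Hy | apply Rmin_l]).
assert (Cmod (i y - i x) < d') by (eapply Rlt_le_trans; [apply Hy | apply Rmin_r]).
rewrite <- E, <- Ex by assumption; auto.
Qed.

Lemma gderiv_eq (f : X -> C) x l l' : l = l' -> gderiv i f x l -> gderiv i f x l'.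
Proof. now intros ->. Qed.

Lemma gderiv_ext (f g : X -> C) (x : X) (l : C) :
  (forall y, f y = g y) -> gderiv i f x l -> gderiv i g x l.
Proof.
intros E; apply gderiv_ext_loc; [|apply E].
exists 1; split; [lra | intros; apply E].
Qed.

Lemma gderiv_const (c : C) x : gderiv i (fun _ => c) x 0.
Proof.
intros eps Heps; exists 1; split; [lra|]; intros y _.
replace (c - c - 0 * (i y - i x))%C with (RtoC 0) by ring.
rewrite Cmod_0; apply Rmult_le_pos; [lra | apply Cmod_ge_0].
Qed.

Lemma gderiv_id x : gderiv i i x 1.
Proof.
intros eps Heps; exists 1; split; [lra|]; intros y _.
replace (i y - i x - 1 * (i y - i x))%C with (RtoC 0) by ring.
rewrite Cmod_0; apply Rmult_le_pos; [lra | apply Cmod_ge_0].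
Qed.

Lemma gderiv_plus (f g : X -> C) (x : X) (l m : C) :
  gderiv i f x l -> gderiv i g x m -> gderiv i (fun y => f y + g y)%C x (l + m).
Proof.
intros Hf Hg eps Heps.
destruct (Hf (eps / 2)) as [d [Hd H]]; [lra|].
destruct (Hg (eps / 2)) as [d' [Hd' H']]; [lra|].
exists (Rmin d d'); split; [now apply Rmin_pos|].
intros y Hy.
specialize (H y (Rlt_le_trans _ _ _ Hy (Rmin_l _ _))).
specialize (H' y (Rlt_le_trans _ _ _ Hy (Rmin_r _ _))).
replace (f y + g y - (f x + g x) - (l + m) * (i y - i x))%C
  with ((f y - f x - l * (i y - i x)) + (g y - g x - m * (i y - i x)))%C by ring.
eapply Rle_trans; [apply Cmod_triangle | lra].
Qed.

Lemma gderiv_lipschitz (f : X -> C) (x : X) (l : C) :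
  gderiv i f x l -> exists d K, 0 < d /\ 0 < K /\
    forall y, Cmod (i y - i x) < d -> Cmod (f y - f x) <= K * Cmod (i y - i x).
Proof.
intros H; destruct (H 1 Rlt_0_1) as [d [Hd H']].
exists d, (1 + Cmod l); split; [assumption|]; split.
{ generalize (Cmod_ge_0 l); lra. }
intros y Hy; specialize (H' y Hy).
replace (f y - f x)%C with ((f y - f x - l * (i y - i x)) + l * (i y - i x))%C by ring.
eapply Rle_trans; [apply Cmod_triangle |]; rewrite Cmod_mult; lra.
Qed.

Lemma gderiv_cont (f : X -> C) (x : X) (l : C) :
  gderiv i f x l -> forall eps, 0 < eps -> exists d, 0 < d /\
    forall y, Cmod (i y - i x) < d -> Cmod (f y - f x) < eps.
Proof.
intros H eps Heps; destruct (gderiv_lipschitz _ _ _ H) as (d & K & Hd & HK & H').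
exists (Rmin d (eps / K)); split.
{ apply Rmin_pos; [assumption | apply Rdiv_lt_0_compat; assumption]. }
intros y Hy.
specialize (H' y (Rlt_le_trans _ _ _ Hy (Rmin_l _ _))).
apply Rle_lt_trans with (1 := H').
apply Rlt_le_trans with (K * (eps / K)); [|right; field; lra].
apply Rmult_lt_compat_l; [assumption|].
eapply Rlt_le_trans; [apply Hy | apply Rmin_r].
Qed.

Lemma small_product (a b K K' eps : R) :
  0 < K -> 0 < K' -> 0 < eps -> 0 <= a -> 0 <= b ->
  forall t, 0 <= t -> t < eps / (K * K') -> a <= K * t -> b <= K' * t -> a * b <= eps * t.
Proof.
intros HK HK' He Ha Hb t Ht Ht' H1 H2.
apply Rle_trans with ((K * t) * (K' * t)); [apply Rmult_le_compat; assumption|].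
replace (K * t * (K' * t)) with ((K * K' * t) * t) by ring.
apply Rmult_le_compat_r; [assumption|].
apply Rlt_le; replace eps with (K * K' * (eps / (K * K'))) by (field; lra).
apply Rmult_lt_compat_l; [now apply Rmult_lt_0_compat | assumption].
Qed.

Lemma gderiv_mult (f g : X -> C) (x : X) (l m : C) :
  gderiv i f x l -> gderiv i g x m ->
  gderiv i (fun y => f y * g y)%C x (l * g x + f x * m).
Proof.
intros Hf Hg eps Heps.
set (M := 1 + Cmod (f x) + Cmod (g x)).
assert (Hfx := Cmod_ge_0 (f x)); assert (Hgx := Cmod_ge_0 (g x)).
assert (HM : 0 < M) by (unfold M; lra).
destruct (Hf (eps / 3 / M)) as [d [Hd H]]; [apply Rdiv_lt_0_compat; lra|].
destruct (Hg (eps / 3 / M)) as [d' [Hd' H']]; [apply Rdiv_lt_0_compat; lra|].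
destruct (gderiv_lipschitz _ _ _ Hf) as (e & K & He & HK & L).
destruct (gderiv_lipschitz _ _ _ Hg) as (e' & K' & He' & HK' & L').
assert (Hz : 0 < eps / 3 / (K * K'))
  by (apply Rdiv_lt_0_compat; [lra | now apply Rmult_lt_0_compat]).
exists (Rmin (Rmin d d') (Rmin (Rmin e e') (eps / 3 / (K * K')))); split.
{ repeat apply Rmin_pos; assumption. }
intros y Hy.
assert (Hy1 := Rlt_le_trans _ _ _ Hy (Rmin_l _ _)).
assert (Hy2 := Rlt_le_trans _ _ _ Hy (Rmin_r _ _)).
specialize (H y (Rlt_le_trans _ _ _ Hy1 (Rmin_l _ _))).
specialize (H' y (Rlt_le_trans _ _ _ Hy1 (Rmin_r _ _))).
assert (Hy3 := Rlt_le_trans _ _ _ Hy2 (Rmin_l _ _)).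
assert (Hy4 := Rlt_le_trans _ _ _ Hy2 (Rmin_r _ _)).
specialize (L y (Rlt_le_trans _ _ _ Hy3 (Rmin_l _ _))).
specialize (L' y (Rlt_le_trans _ _ _ Hy3 (Rmin_r _ _))).
set (t := Cmod (i y - i x)) in *.
assert (Ht : 0 <= t) by apply Cmod_ge_0.
replace (f y * g y - f x * g x - (l * g x + f x * m) * (i y - i x))%C
  with ((f y - f x - l * (i y - i x)) * g x + f x * (g y - g x - m * (i y - i x))
        + (f y - f x) * (g y - g x))%C by ring.
eapply Rle_trans; [apply Cmod_triangle |].
eapply Rle_trans; [apply Rplus_le_compat_r, Cmod_triangle |].
rewrite !Cmod_mult.
assert (B1 : Cmod (f y - f x - l * (i y - i x)) * Cmod (g x) <= eps / 3 * t).
{ apply Rle_trans with (eps / 3 / M * t * M).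
  - apply Rmult_le_compat; try assumption; try apply Cmod_ge_0; unfold M; lra.
  - right; field; lra. }
assert (B2 : Cmod (f x) * Cmod (g y - g x - m * (i y - i x)) <= eps / 3 * t).
{ rewrite Rmult_comm; apply Rle_trans with (eps / 3 / M * t * M).
  - apply Rmult_le_compat; try assumption; try apply Cmod_ge_0; unfold M; lra.
  - right; field; lra. }
assert (B3 : Cmod (f y - f x) * Cmod (g y - g x) <= eps / 3 * t)
  by (apply (small_product _ _ K K'); try assumption; try apply Cmod_ge_0; lra).
lra.
Qed.

Lemma gderiv_comp (F : C -> C) (f : X -> C) (x : X) (l m : C) :
  hderiv F (f x) m -> gderiv i f x l -> gderiv i (fun y => F (f y)) x (m * l).
Proof.
intros HF Hf eps Heps.
destruct (gderiv_lipschitz _ _ _ Hf) as (e & K & He & HK & L).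
destruct (HF (eps / 2 / K)) as [d [Hd H]]; [repeat apply Rdiv_lt_0_compat; lra|].
assert (Hm := Cmod_ge_0 m).
destruct (Hf (eps / 2 / (1 + Cmod m))) as [d' [Hd' H']].
{ apply Rdiv_lt_0_compat; lra. }
destruct (gderiv_cont _ _ _ Hf d Hd) as [d2 [Hd2 H2]].
exists (Rmin (Rmin d' d2) e); split; [repeat apply Rmin_pos; assumption|].
intros y Hy.
assert (Hy1 := Rlt_le_trans _ _ _ Hy (Rmin_l _ _)).
specialize (L y (Rlt_le_trans _ _ _ Hy (Rmin_r _ _))).
specialize (H' y (Rlt_le_trans _ _ _ Hy1 (Rmin_l _ _))).
specialize (H2 y (Rlt_le_trans _ _ _ Hy1 (Rmin_r _ _))).
specialize (H (f y) H2).
set (t := Cmod (i y - i x)) in *.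
assert (Ht : 0 <= t) by apply Cmod_ge_0.
replace (F (f y) - F (f x) - m * l * (i y - i x))%C
  with ((F (f y) - F (f x) - m * (f y - f x)) + m * (f y - f x - l * (i y - i x)))%C by ring.
eapply Rle_trans; [apply Cmod_triangle |]; rewrite Cmod_mult.
assert (B1 : Cmod (F (f y) - F (f x) - m * (f y - f x)) <= eps / 2 * t).
{ apply Rle_trans with (1 := H).
  apply Rle_trans with (eps / 2 / K * (K * t)); [|right; field; lra].
  apply Rmult_le_compat_l; [|assumption].
  apply Rlt_le; repeat apply Rdiv_lt_0_compat; lra. }
assert (B2 : Cmod m * Cmod (f y - f x - l * (i y - i x)) <= eps / 2 * t).
{ apply Rle_trans with ((1 + Cmod m) * (eps / 2 / (1 + Cmod m) * t)).
  - apply Rmult_le_compat; try assumption; try apply Cmod_ge_0; lra.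
  - right; field; lra. }
lra.
Qed.
End GDeriv.

Lemma hderiv_inv (z : C) : z <> 0%C -> hderiv Cinv z (- / (z * z)).
Proof.
intros Hz eps Heps.
assert (Hp : 0 < Cmod z) by now apply Cmod_gt_0.
set (r := Cmod z) in *.
exists (Rmin (r / 2) (eps * (r * r * r / 2))); split.
{ apply Rmin_pos; [lra|]; apply Rmult_lt_0_compat; [assumption|].
  unfold Rdiv; repeat apply Rmult_lt_0_compat; lra. }
intros y Hy.
assert (Hy1 := Rlt_le_trans _ _ _ Hy (Rmin_l _ _)).
assert (Hy2 := Rlt_le_trans _ _ _ Hy (Rmin_r _ _)).
assert (Hr : r / 2 <= Cmod y).
{ assert (T := Cmod_triangle y (z - y)).
  replace (y + (z - y))%C with z in T by ring.
  rewrite (Cmod_sym z y) in T; fold r in T; lra. }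
assert (Hy0 : y <> 0%C) by (apply Cmod_gt_0; lra).
replace (/ y - / z - - / (z * z) * (y - z))%C
  with ((y - z) * (y - z) * / (z * z * y))%C by (field; split; assumption).
assert (Hzy : (z * z * y)%C <> 0%C) by (repeat apply Cmult_neq_0; assumption).
rewrite !Cmod_mult, Cmod_inv, !Cmod_mult by assumption.
fold r.
set (t := Cmod (y - z)) in *.
assert (Ht : 0 <= t) by apply Cmod_ge_0.
assert (P : 0 < r * r * Cmod y) by (repeat apply Rmult_lt_0_compat; lra).
apply Rle_trans with (t * (t / (r * r * (r / 2)))).
- rewrite Rmult_assoc; apply Rmult_le_compat_l; [assumption|].
  apply Rmult_le_compat_l; [assumption|].
  apply Rinv_le_contravar; [repeat apply Rmult_lt_0_compat; lra|].
  apply Rmult_le_compat_l; [apply Rlt_le, Rmult_lt_0_compat; lra | assumption].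
- rewrite Rmult_comm; apply Rmult_le_compat_r; [assumption|].
  apply Rmult_le_reg_r with (r * r * (r / 2)); [repeat apply Rmult_lt_0_compat; lra|].
  replace (t / (r * r * (r / 2)) * (r * r * (r / 2))) with t by (field; lra).
  nra.
Qed.

Section GDeriv2.
Context {X : Type} (i : X -> C).

Lemma gderiv_scal (c : C) (f : X -> C) (x : X) (l : C) :
  gderiv i f x l -> gderiv i (fun y => c * f y)%C x (c * l).
Proof.
intros H; eapply gderiv_eq; [|apply gderiv_mult; [apply gderiv_const | apply H]].
cbv beta; ring.
Qed.

Lemma gderiv_opp (f : X -> C) (x : X) (l : C) : gderiv i f x l -> gderiv i (fun y => - f y)%C x (- l).
Proof.
intros H; apply gderiv_ext with (fun y => (-1)%R * f y)%C; [intros; ring|].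
eapply gderiv_eq; [|apply gderiv_scal, H]; ring.
Qed.

Lemma gderiv_minus (f g : X -> C) (x : X) (l m : C) :
  gderiv i f x l -> gderiv i g x m -> gderiv i (fun y => f y - g y)%C x (l - m).
Proof. intros Hf Hg; apply gderiv_plus; [assumption | now apply gderiv_opp]. Qed.

Lemma gderiv_inv (f : X -> C) (x : X) (l : C) :
  f x <> 0%C -> gderiv i f x l -> gderiv i (fun y => / f y)%C x (- l / (f x * f x)).
Proof.
intros H0 H; eapply gderiv_eq; [|apply (gderiv_comp i Cinv f x l _ (hderiv_inv _ H0) H)].
field; assumption.
Qed.

Lemma gderiv_div (f g : X -> C) (x : X) (l m : C) :
  g x <> 0%C -> gderiv i f x l -> gderiv i g x m ->
  gderiv i (fun y => f y / g y)%C x ((l * g x - f x * m) / (g x * g x)).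
Proof.
intros H0 Hf Hg; eapply gderiv_eq; [|apply gderiv_mult; [apply Hf | apply gderiv_inv; eassumption]].
cbv beta; field; assumption.
Qed.

Lemma gderiv_pow (f : X -> C) (x : X) (l : C) n :
  gderiv i f x l -> gderiv i (fun y => f y ^ n)%C x (INR n * f x ^ (pred n) * l).
Proof.
intros H; induction n as [|n IH].
- apply gderiv_ext with (fun _ => 1%C); [reflexivity|].
  eapply gderiv_eq; [|apply gderiv_const]; simpl; ring.
- apply gderiv_ext with (fun y => f y * f y ^ n)%C; [reflexivity|].
  eapply gderiv_eq; [|apply gderiv_mult; [apply H | apply IH]].
  cbv beta; rewrite S_INR, RtoC_plus; destruct n as [|n]; [simpl; ring|].
  change (pred (S (S n))) with (S n); change (pred (S n)) with n; rewrite Cpow_S; ring.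
Qed.
End GDeriv2.

Lemma is_derive_eps (f : R -> R) (t l : R) :
  is_derive f t l <->
  forall eps, 0 < eps -> exists d, 0 < d /\
    forall s, Rabs (s - t) < d -> Rabs (f s - f t - l * (s - t)) <= eps * Rabs (s - t).
Proof.
split.
- intros H eps Heps; apply is_derive_Reals in H.
  destruct (H eps Heps) as [d Hd].
  exists d; split; [apply cond_pos|]; intros s Hs.
  destruct (Req_dec s t) as [->|Hn].
  { replace (f t - f t - l * (t - t)) with 0 by ring.
    replace (t - t) with 0 by ring; rewrite Rabs_R0; lra. }
  assert (Hst : s - t <> 0) by lra.
  specialize (Hd (s - t) Hst Hs); replace (t + (s - t)) with s in Hd by ring.
  replace (f s - f t - l * (s - t)) with (((f s - f t) / (s - t) - l) * (s - t)) by (field; lra).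
  rewrite Rabs_mult; apply Rmult_le_compat_r; [apply Rabs_pos | lra].
- intros H; apply is_derive_Reals; intros eps Heps.
  destruct (H (eps / 2)) as [d [Hd H']]; [lra|].
  exists (mkposreal d Hd); intros k Hk Hkd; simpl in Hkd.
  specialize (H' (t + k)); replace (t + k - t) with k in H' by ring.
  specialize (H' Hkd).
  assert (Hka : 0 < Rabs k) by now apply Rabs_pos_lt.
  replace ((f (t + k) - f t) / k - l) with ((f (t + k) - f t - l * k) / k) by (field; lra).
  unfold Rdiv at 1; rewrite Rabs_mult, Rabs_inv.
  apply Rmult_lt_reg_r with (Rabs k); [assumption|].
  rewrite Rmult_assoc, Rinv_l, Rmult_1_r by lra; nra.
Qed.

Lemma cderiv_components (f : R -> C) (t : R) (l : C) :
  cderiv f t l <->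
  is_derive (fun s => Re (f s)) t (Re l) /\ is_derive (fun s => Im (f s)) t (Im l).
Proof.
assert (E : forall s t : R, Cmod (s - t) = Rabs (s - t))
  by (intros; rewrite <- RtoC_minus; apply Cmod_R).
split.
- intros H; split; apply is_derive_eps; intros eps Heps;
    destruct (H eps Heps) as [d [Hd H']]; exists d; (split; [assumption|]);
    intros s Hs; specialize (H' s); rewrite E in H'; specialize (H' Hs).
  + eapply Rle_trans, H'.
    replace (Re (f s) - Re (f t) - Re l * (s - t))
      with (Re (f s - f t - l * (s - t))) by (unfold Re; simpl; ring).
    apply re_le_Cmod.
  + eapply Rle_trans, H'.
    replace (Im (f s) - Im (f t) - Im l * (s - t))
      with (Im (f s - f t - l * (s - t))) by (unfold Im; simpl; ring).
    apply im_le_Cmod.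
- intros [H1 H2] eps Heps.
  destruct (proj1 (is_derive_eps _ _ _) H1 (eps / 2)) as [d [Hd H1']]; [lra|].
  destruct (proj1 (is_derive_eps _ _ _) H2 (eps / 2)) as [d' [Hd' H2']]; [lra|].
  exists (Rmin d d'); split; [now apply Rmin_pos|].
  intros s; rewrite E; intros Hs.
  specialize (H1' s (Rlt_le_trans _ _ _ Hs (Rmin_l _ _))).
  specialize (H2' s (Rlt_le_trans _ _ _ Hs (Rmin_r _ _))).
  eapply Rle_trans; [apply Cmod_le_re_im|].
  replace (Re (f s - f t - l * (s - t))) with (Re (f s) - Re (f t) - Re l * (s - t))
    by (unfold Re; simpl; ring).
  replace (Im (f s - f t - l * (s - t))) with (Im (f s) - Im (f t) - Im l * (s - t))
    by (unfold Im; simpl; ring).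
  lra.
Qed.

Lemma cderiv_re f t l : cderiv f t l -> is_derive (fun s => Re (f s)) t (Re l).
Proof. intros H; apply cderiv_components, H. Qed.

Lemma cderiv_im f t l : cderiv f t l -> is_derive (fun s => Im (f s)) t (Im l).
Proof. intros H; apply cderiv_components, H. Qed.

Lemma cderiv_conj f t l : cderiv f t l -> cderiv (fun s => Cconj (f s)) t (Cconj l).
Proof.
intros H; apply cderiv_components; split; simpl.
- now apply cderiv_re.
- apply (is_derive_opp (fun s => Im (f s))); now apply cderiv_im.
Qed.

Lemma cderiv_RtoC (f : R -> R) (t l : R) :
  is_derive f t l -> cderiv (fun s => RtoC (f s)) t (RtoC l).
Proof.
intros H; apply cderiv_components; split; simpl; [assumption|].
apply (is_derive_const (K := R_AbsRing) (V := R_NormedModule) 0).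
Qed.

Lemma hderiv_C_derive (f : C -> C) (z l : C) : hderiv f z l -> C_derive f z = l.
Proof.
intros H; apply is_C_derive_unique.
split; [apply is_linear_scal_l|].
intros x Hx.
assert (x = z) as -> .
{ symmetry; apply is_filter_lim_locally_unique with (1 := Hx). }
intros eps; destruct (H eps (cond_pos eps)) as [d [Hd H']].
exists (mkposreal d Hd).
intros y Hy.
assert (Hy' : Cmod (y - z) < d) by exact Hy.
specialize (H' y Hy').
eapply Rle_trans; [|apply H']; right.
change (Cmod (minus (minus (f y) (f z)) (scal (minus y z) l)) = Cmod (f y - f z - l * (y - z))).
f_equal; unfold minus, plus, opp, scal; simpl; unfold mult; simpl; ring.
Qed.

(** * Complex power series *)

(** Splitting into two real series makes the real comparison and ratio tests applicable. *)
Definition cseries (u : nat -> C) (l : C) : Prop :=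
  is_series (fun n => Re (u n)) (Re l) /\ is_series (fun n => Im (u n)) (Im l).

Lemma is_series_components (u : nat -> C) (l : C) :
  @is_series C_AbsRing C_NormedModule u l -> cseries u l.
Proof.
intros H.
assert (E : forall n, @sum_n C_AbelianMonoid u n
                      = (sum_n (fun k => Re (u k)) n, sum_n (fun k => Im (u k)) n)).
{ induction n as [|n IH].
  - rewrite !sum_O; now destruct (u O).
  - rewrite !sum_Sn, IH; reflexivity. }
split.
- apply (filterlim_ext (fun n => fst (@sum_n C_AbelianMonoid u n))).
  { intros n; rewrite E; reflexivity. }
  apply (filterlim_comp _ _ _ _ (@fst R R) _ _ _ H).
  intros P [e He]; exists e; intros y Hy; apply He, Hy.
- apply (filterlim_ext (fun n => snd (@sum_n C_AbelianMonoid u n))).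
  { intros n; rewrite E; reflexivity. }
  apply (filterlim_comp _ _ _ _ (@snd R R) _ _ _ H).
  intros P [e He]; exists e; intros y Hy; apply He, Hy.
Qed.

Lemma cseries_ext (u v : nat -> C) (l : C) :
  (forall n, u n = v n) -> cseries u l -> cseries v l.
Proof.
intros E [H1 H2]; split.
- eapply is_series_ext, H1; intros n; simpl; now rewrite E.
- eapply is_series_ext, H2; intros n; simpl; now rewrite E.
Qed.

Lemma cseries_plus (u v : nat -> C) (l m : C) :
  cseries u l -> cseries v m -> cseries (fun n => u n + v n)%C (l + m)%C.
Proof.
intros [H1 H2] [H3 H4]; split.
- exact (is_series_plus _ _ _ _ H1 H3).
- exact (is_series_plus _ _ _ _ H2 H4).
Qed.

Lemma is_series_scal_R (k : R) (a : nat -> R) (l : R) :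
  is_series a l -> is_series (fun n => k * a n) (k * l).
Proof. exact (is_series_scal k a l). Qed.

Lemma ex_series_scal_R (k : R) (a : nat -> R) :
  ex_series a -> ex_series (fun n => k * a n).
Proof. intros [l Hl]; exists (k * l); exact (is_series_scal k a l Hl). Qed.

Lemma cseries_scal (k : C) (u : nat -> C) (l : C) :
  cseries u l -> cseries (fun n => k * u n)%C (k * l)%C.
Proof.
intros [H1 H2]; split.
- exact (is_series_minus _ _ _ _ (is_series_scal_R (Re k) _ _ H1) (is_series_scal_R (Im k) _ _ H2)).
- exact (is_series_plus _ _ _ _ (is_series_scal_R (Re k) _ _ H2) (is_series_scal_R (Im k) _ _ H1)).
Qed.

Lemma is_series_0 : is_series (fun _ : nat => 0) 0.
Proof.
apply filterlim_ext with (fun _ => 0); [|apply filterlim_const].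
intros n; rewrite sum_n_const; simpl; ring.
Qed.

Lemma cseries_0 (u : nat -> C) : (forall n, u n = 0%C) -> cseries u 0.
Proof.
intros H; apply cseries_ext with (fun _ => RtoC 0); [now intros|].
split; exact is_series_0.
Qed.

Lemma cseries_unique (u : nat -> C) (l m : C) : cseries u l -> cseries u m -> l = m.
Proof.
intros [H1 H2] [H3 H4]; apply C_ext.
- now rewrite <- (is_series_unique _ _ H1), <- (is_series_unique _ _ H3).
- now rewrite <- (is_series_unique _ _ H2), <- (is_series_unique _ _ H4).
Qed.

Lemma is_series_abs_le (a b : nat -> R) (l m : R) :
  (forall n, Rabs (a n) <= b n) -> is_series a l -> is_series b m -> Rabs l <= m.
Proof.
intros Hab Ha Hb.
assert (Hx : ex_series (fun n => Rabs (a n))).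
{ apply (ex_series_le (fun n => Rabs (a n)) b); [|now exists m].
  intros n; change (Rabs (Rabs (a n)) <= b n); now rewrite Rabs_Rabsolu. }
rewrite <- (is_series_unique _ _ Ha), <- (is_series_unique _ _ Hb).
eapply Rle_trans; [apply Series_Rabs, Hx|].
apply Series_le; [|now exists m].
intros n; split; [apply Rabs_pos | apply Hab].
Qed.

(** The factor 2 comes from bounding real and imaginary parts separately; only the order of
    magnitude matters for the remainder estimate of a power series. *)
Lemma cseries_bound (u : nat -> C) (b : nat -> R) (l : C) (B : R) :
  (forall n, Cmod (u n) <= b n) -> cseries u l -> is_series b B -> Cmod l <= 2 * B.
Proof.
intros Hb [H1 H2] HB.
assert (Rabs (Re l) <= B).
{ eapply is_series_abs_le, HB; [|apply H1].
  intros n; eapply Rle_trans, Hb; apply re_le_Cmod. }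
assert (Rabs (Im l) <= B).
{ eapply is_series_abs_le, HB; [|apply H2].
  intros n; eapply Rle_trans, Hb; apply im_le_Cmod. }
eapply Rle_trans; [apply Cmod_le_re_im | lra].
Qed.

Lemma cseries_ex (u : nat -> C) (b : nat -> R) :
  (forall n, Cmod (u n) <= b n) -> ex_series b -> exists l, cseries u l.
Proof.
intros Hb Hex.
assert (H1 : ex_series (fun n => Re (u n))).
{ apply (ex_series_le (fun n => Re (u n)) b); [|assumption].
  intros n; eapply Rle_trans, Hb; apply (re_le_Cmod (u n)). }
assert (H2 : ex_series (fun n => Im (u n))).
{ apply (ex_series_le (fun n => Im (u n)) b); [|assumption].
  intros n; eapply Rle_trans, Hb; apply (im_le_Cmod (u n)). }
destruct H1 as [l1 H1], H2 as [l2 H2]; exists (l1, l2); split; assumption.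
Qed.

Lemma ex_series_bounded (a : nat -> R) :
  ex_series a -> exists M, forall n, Rabs (a n) <= M.
Proof.
intros H.
assert (L := ex_series_lim_0 _ H).
apply is_lim_seq_Reals in L.
destruct (maj_by_pos a) as [M [HM H']]; [now exists 0|].
exists M; intros n; apply H'.
Qed.

Lemma cseries_terms_bounded (u : nat -> C) (l : C) :
  cseries u l -> exists M, 0 <= M /\ forall n, Cmod (u n) <= M.
Proof.
intros [H1 H2].
destruct (ex_series_bounded _ (ex_intro _ _ H1)) as [M1 B1].
destruct (ex_series_bounded _ (ex_intro _ _ H2)) as [M2 B2].
exists (M1 + M2); split.
{ specialize (B1 O); specialize (B2 O).
  assert (T1 := Rabs_pos (Re (u O))); assert (T2 := Rabs_pos (Im (u O))); lra. }
intros n; eapply Rle_trans; [apply Cmod_le_re_im|].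
specialize (B1 n); specialize (B2 n); simpl in *; lra.
Qed.

Lemma cseries_shift (u : nat -> C) (l : C) :
  cseries u l <-> cseries (fun n => u (S n)) (l - u O)%C.
Proof.
split; intros [H1 H2]; split.
- apply (is_series_incr_1 (fun n => Re (u n))); simpl.
  match goal with |- is_series _ ?x => replace x with (Re l) end; [assumption|].
  unfold plus, Re, Im; simpl; unfold Re, Im; ring.
- apply (is_series_incr_1 (fun n => Im (u n))); simpl.
  match goal with |- is_series _ ?x => replace x with (Im l) end; [assumption|].
  unfold plus, Re, Im; simpl; unfold Re, Im; ring.
- apply (is_series_decr_1 (fun n => Re (u n))); simpl.
  match goal with |- is_series _ ?x => replace x with (Re (l - u O)) end; [assumption|].
  unfold plus, opp; simpl; reflexivity.
- apply (is_series_decr_1 (fun n => Im (u n))); simpl.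
  match goal with |- is_series _ ?x => replace x with (Im (l - u O)) end; [assumption|].
  unfold plus, opp; simpl; reflexivity.
Qed.

Definition ps_coef (c : nat -> C) (a : C) (r : R) (f : C -> C) : Prop :=
  forall z, Cmod (z - a) < r -> cseries (fun n => c n * (z - a) ^ n)%C (f z).

Definition ps_on (a : C) (r : R) (f : C -> C) : Prop := exists c, ps_coef c a r f.

Lemma analytic_ps_on (f : C -> C) (a : C) :
  analytic_at f a -> exists r, 0 < r /\ ps_on a r f.
Proof.
intros (c & r & Hr & H); exists r; split; [assumption|]; exists c.
intros z Hz; eapply cseries_ext, is_series_components, H, Hz.
intros n; cbv beta.
assert (E : forall w : C, @pow_n C_Ring w n = (w ^ n)%C).
{ intros w; induction n as [|n IH]; simpl; [reflexivity|].
  now rewrite IH. }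
change (@pow_n C_Ring (z - a)%C n * c n = c n * (z - a) ^ n)%C.
rewrite E; ring.
Qed.

Lemma ex_series_square_geom (q : R) :
  0 < q < 1 -> ex_series (fun n => INR (S n) ^ 2 * q ^ n).
Proof.
intros Hq.
assert (P : forall n, 0 < INR (S n) ^ 2 * q ^ n).
{ intros n; apply Rmult_lt_0_compat; apply pow_lt; [apply lt_0_INR; lia | lra]. }
apply (ex_series_ext (fun n => Rabs (INR (S n) ^ 2 * q ^ n))).
{ intros n; apply Rabs_pos_eq, Rlt_le, P. }
apply ex_series_DAlembert with q; [lra | intros n; apply Rgt_not_eq, P |].
apply (is_lim_seq_ext (fun n => (1 + / INR (S n)) * (1 + / INR (S n)) * q)).
{ intros n; rewrite Rabs_pos_eq.
  2: { apply Rlt_le, Rdiv_lt_0_compat; apply P. }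
  rewrite (S_INR (S n)); change (q ^ S n) with (q * q ^ n).
  assert (INR (S n) <> 0) by (apply not_0_INR; lia).
  assert (q ^ n <> 0) by (apply pow_nonzero; lra).
  field; repeat split; try assumption; lra. }
assert (L : is_lim_seq (fun n => 1 + / INR (S n)) 1).
{ replace (Finite 1) with (Rbar_plus 1 0) by (simpl; f_equal; ring).
  apply is_lim_seq_plus'; [apply is_lim_seq_const|].
  apply (is_lim_seq_incr_1 (fun n => / INR n)).
  replace (Finite 0) with (Rbar_inv p_infty) by reflexivity.
  apply is_lim_seq_inv; [apply is_lim_seq_INR | discriminate]. }
replace (Finite q) with (Finite (1 * 1 * q)) by (f_equal; ring).
apply is_lim_seq_mult'; [apply is_lim_seq_mult'; assumption | apply is_lim_seq_const].
Qed.

(** The remainders [D n] satisfy [D (n+1) = w * D n + n * z^(n-1) * (w - z)^2], so the constants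
    grow like a sum of the first integers, at most [n^2]. The factor [rho ^ 2] on the left avoids
    the exponent [n - 2]. *)
Lemma pow_second_difference (z w : C) (rho : R) (n : nat) :
  0 < rho -> Cmod z <= rho -> Cmod w <= rho ->
  Cmod (w ^ n - z ^ n - INR n * z ^ pred n * (w - z)) * rho ^ 2
  <= INR n ^ 2 * rho ^ n * Cmod (w - z) ^ 2.
Proof.
intros Hr Hz Hw.
assert (Hd := Cmod_ge_0 (w - z)).
induction n as [|n IH].
{ simpl; replace (1 - 1 - 0 * 1 * (w - z))%C with (RtoC 0) by ring.
  rewrite Cmod_0; lra. }
assert (E : (w ^ S n - z ^ S n - INR (S n) * z ^ pred (S n) * (w - z)
  = w * (w ^ n - z ^ n - INR n * z ^ pred n * (w - z)) + INR n * z ^ pred n * (w - z) ^ 2)%C).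
{ rewrite S_INR, RtoC_plus; destruct n as [|n]; simpl pred.
  - simpl; ring.
  - rewrite !Cpow_S; ring. }
rewrite E; clear E.
set (D := (w ^ n - z ^ n - INR n * z ^ pred n * (w - z))%C) in *.
assert (T := Cmod_triangle (w * D) (INR n * z ^ pred n * (w - z) ^ 2)).
rewrite !Cmod_mult, Cmod_R, !Cmod_pow, (Rabs_pos_eq (INR n)) in T by apply pos_INR.
assert (Hn := pos_INR n).
set (d := Cmod (w - z)) in *.
assert (A1 : Cmod w * Cmod D * rho ^ 2 <= rho * (INR n ^ 2 * rho ^ n * d ^ 2)).
{ rewrite Rmult_assoc; apply Rmult_le_compat; try assumption; try apply Cmod_ge_0.
  apply Rmult_le_pos; [apply Cmod_ge_0 | apply pow2_ge_0]. }
assert (A2 : INR n * Cmod z ^ pred n * d ^ 2 * rho ^ 2 <= INR n * rho ^ S n * d ^ 2).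
{ destruct n as [|n]; [simpl; lra|]; simpl pred.
  replace (rho ^ S (S n)) with (rho ^ n * rho ^ 2) by (simpl; ring).
  replace (INR (S n) * Cmod z ^ n * d ^ 2 * rho ^ 2)
    with (INR (S n) * d ^ 2 * rho ^ 2 * Cmod z ^ n) by ring.
  replace (INR (S n) * (rho ^ n * rho ^ 2) * d ^ 2)
    with (INR (S n) * d ^ 2 * rho ^ 2 * rho ^ n) by ring.
  apply Rmult_le_compat_l.
  - repeat apply Rmult_le_pos; try assumption; try lra; apply pow2_ge_0.
  - apply pow_incr; split; [apply Cmod_ge_0 | assumption]. }
assert (P : 0 <= rho ^ n) by (apply pow_le; lra).
assert (P2 : 0 <= rho ^ n * d ^ 2) by (apply Rmult_le_pos; [assumption | apply pow2_ge_0]).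
rewrite S_INR; simpl (rho ^ S n) in *.
apply Rle_trans with ((Cmod w * Cmod D + INR n * Cmod z ^ pred n * d ^ 2) * rho ^ 2).
{ apply Rmult_le_compat_r; [apply pow2_ge_0 | assumption]. }
rewrite Rmult_plus_distr_r.
assert (0 <= (INR n + 1) * rho * (rho ^ n * d ^ 2))
  by (repeat apply Rmult_le_pos; try assumption; lra).
nra.
Qed.

(** The difference quotient is compared with the termwise differentiated series; the second
    differences of the powers are summable with a factor [|w - z|^2], which makes the remainder
    quadratic. *)
Lemma ps_coef_deriv (c : nat -> C) (r : R) (f : C -> C) :
  ps_coef c 0 r f ->
  exists g, ps_coef (fun n => INR (S n) * c (S n))%C 0 r g /\
    forall z, Cmod z < r -> hderiv f z (g z).
Proof.
intros H.
assert (H0 : forall z, Cmod z < r -> cseries (fun n => c n * z ^ n)%C (f z)).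
{ intros z Hz; eapply cseries_ext, (H z); [|now replace (z - 0)%C with z by ring].
  intros n; simpl; now replace (z - 0)%C with z by ring. }
(* At a radius [s] strictly between [rho] and [r] the terms are bounded by some [M], so the
   coefficients are at most [M / s^n], and [n^2 (rho / s)^n] is summable. *)
assert (B : forall rho, 0 < rho -> rho < r ->
          ex_series (fun n => Cmod (c n) * (INR (S n) ^ 2 * rho ^ n))).
{ intros rho Hrho Hr; set (s := (rho + r) / 2).
  assert (Hs : rho < s < r) by (unfold s; lra).
  destruct (cseries_terms_bounded _ _ (H0 s ltac:(rewrite Cmod_R, Rabs_pos_eq; lra)))
    as (M & HM & Hb).
  apply (ex_series_le (fun n => Cmod (c n) * (INR (S n) ^ 2 * rho ^ n))
           (fun n => M * (INR (S n) ^ 2 * (rho / s) ^ n))).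
  2: { apply (ex_series_scal_R M); apply ex_series_square_geom; split.
       - apply Rdiv_lt_0_compat; lra.
       - apply Rlt_div_l; lra. }
  intros n; change (Rabs (Cmod (c n) * (INR (S n) ^ 2 * rho ^ n))
                    <= M * (INR (S n) ^ 2 * (rho / s) ^ n)).
  assert (P1 : 0 <= rho ^ n) by (apply pow_le; lra).
  assert (P2 := pow2_ge_0 (INR (S n))).
  rewrite Rabs_pos_eq by (apply Rmult_le_pos; [apply Cmod_ge_0 | now apply Rmult_le_pos]).
  specialize (Hb n); rewrite Cmod_mult, Cmod_pow, Cmod_R, (Rabs_pos_eq s) in Hb by lra.
  assert (P3 : 0 < s ^ n) by (apply pow_lt; lra).
  replace ((rho / s) ^ n) with (rho ^ n / s ^ n).
  2: { unfold Rdiv; rewrite Rpow_mult_distr, pow_inv by lra; reflexivity. }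
  replace (M * (INR (S n) ^ 2 * (rho ^ n / s ^ n)))
    with (M / s ^ n * (INR (S n) ^ 2 * rho ^ n)) by (field; lra).
  apply Rmult_le_compat_r; [now apply Rmult_le_pos|].
  apply Rmult_le_reg_r with (s ^ n); [assumption|].
  unfold Rdiv; rewrite Rmult_assoc, Rinv_l, Rmult_1_r by lra; assumption. }
assert (G : forall z, Cmod z < r -> exists l, cseries (fun n => INR n * c n * z ^ pred n)%C l).
{ intros z Hz; set (rho := (Cmod z + r) / 2); assert (Hz0 := Cmod_ge_0 z).
  assert (Hrho : Cmod z < rho < r) by (unfold rho; lra).
  apply cseries_ex with (fun n => / rho * (Cmod (c n) * (INR (S n) ^ 2 * rho ^ n))).
  2: { apply (ex_series_scal_R (/ rho)), B; lra. }
  intros n; rewrite !Cmod_mult, Cmod_R, (Rabs_pos_eq _ (pos_INR n)), Cmod_pow.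
  apply Rmult_le_reg_l with rho; [lra|].
  rewrite <- (Rmult_assoc rho (/ rho)), Rinv_r, Rmult_1_l by lra.
  destruct n as [|n].
  { simpl; rewrite !Rmult_0_l, Rmult_0_r, !Rmult_1_r; apply Cmod_ge_0. }
  simpl pred.
  replace (rho * (INR (S n) * Cmod (c (S n)) * Cmod z ^ n))
    with (Cmod (c (S n)) * (INR (S n) * (rho * Cmod z ^ n))) by ring.
  apply Rmult_le_compat_l; [apply Cmod_ge_0|].
  assert (N1 := pos_INR (S n)).
  apply Rmult_le_compat; try assumption.
  - apply Rmult_le_pos; [lra|]; apply pow_le; assumption.
  - rewrite (S_INR (S n)); nra.
  - simpl; apply Rmult_le_compat_l; [lra|]; apply pow_incr; lra. }
(* The sum is chosen pointwise, with the dummy value 0 outside the disk of convergence. *)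
assert (Hch : forall z, exists l, Cmod z < r -> cseries (fun n => INR n * c n * z ^ pred n)%C l).
{ intros z; destruct (Rlt_dec (Cmod z) r) as [Hz|Hz].
  - destruct (G z Hz) as [l Hl]; now exists l.
  - exists 0%C; tauto. }
destruct (functional_choice _ Hch) as [g Hg]; exists g; split.
{ intros z Hz; replace (z - 0)%C with z in * by ring.
  assert (K := proj1 (cseries_shift _ _) (Hg z Hz)).
  replace (g z) with (g z - INR 0 * c O * z ^ pred 0)%C by (simpl; ring).
  eapply cseries_ext, K; intros n; simpl pred; reflexivity. }
intros z Hz; set (rho := (Cmod z + r) / 2); assert (Hz0 := Cmod_ge_0 z).
assert (Hrho : Cmod z < rho < r) by (unfold rho; lra).
destruct (B rho) as [S HS]; [lra | lra |].
assert (HS0 : 0 <= S).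
{ apply Rle_trans with (Rabs 0); [rewrite Rabs_R0; lra|].
  eapply (is_series_abs_le (fun _ => 0)), HS.
  - intros n; rewrite Rabs_R0; apply Rmult_le_pos; [apply Cmod_ge_0|].
    apply Rmult_le_pos; [apply pow2_ge_0 | apply pow_le; lra].
  - exact is_series_0. }
set (K := 2 * (/ rho ^ 2 * S) + 1).
assert (HK : 0 < K).
{ unfold K; assert (0 <= / rho ^ 2 * S); [|lra].
  apply Rmult_le_pos; [|assumption]; apply Rlt_le, Rinv_0_lt_compat, pow_lt; lra. }
intros eps Heps; exists (Rmin (rho - Cmod z) (eps / K)); split.
{ apply Rmin_pos; [lra | apply Rdiv_lt_0_compat; assumption]. }
intros w Hw.
assert (Hw1 := Rlt_le_trans _ _ _ Hw (Rmin_l _ _)).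
assert (Hw2 := Rlt_le_trans _ _ _ Hw (Rmin_r _ _)).
assert (Hwr : Cmod w < rho).
{ replace w with (z + (w - z))%C by ring; eapply Rle_lt_trans; [apply Cmod_triangle | lra]. }
set (d := Cmod (w - z)) in *.
assert (Hd : 0 <= d) by apply Cmod_ge_0.
apply Rle_trans with (2 * (/ rho ^ 2 * d ^ 2 * S)).
(* The remainder [f w - f z - g z * (w - z)] is itself the sum of the series of [c n] times the
   second differences. *)
- apply (cseries_bound
    (fun n => c n * (w ^ n - z ^ n - INR n * z ^ pred n * (w - z)))%C
    (fun n => / rho ^ 2 * d ^ 2 * (Cmod (c n) * (INR (Datatypes.S n) ^ 2 * rho ^ n)))).
  + intros n; rewrite Cmod_mult.
    assert (Q := pow_second_difference z w rho n ltac:(lra) ltac:(lra) ltac:(lra)).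
    fold d in Q.
    replace (/ rho ^ 2 * d ^ 2 * (Cmod (c n) * (INR (Datatypes.S n) ^ 2 * rho ^ n)))
      with (Cmod (c n) * (INR (Datatypes.S n) ^ 2 * rho ^ n * d ^ 2 / rho ^ 2)) by (field; lra).
    apply Rmult_le_compat_l; [apply Cmod_ge_0|].
    assert (R2 : 0 < rho ^ 2) by (apply pow_lt; lra).
    apply Rle_div_r; [assumption|].
    eapply Rle_trans; [apply Q|].
    rewrite !Rmult_assoc; apply Rmult_le_compat_r.
    * apply Rmult_le_pos; [apply pow_le; lra | apply pow2_ge_0].
    * apply pow_incr; split; [apply pos_INR | rewrite S_INR; lra].
  + assert (T := cseries_plus _ _ _ _
      (cseries_plus _ _ _ _ (H0 w ltac:(lra)) (cseries_scal (-1)%R _ _ (H0 z Hz)))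
      (cseries_scal (- (w - z))%C _ _ (Hg z Hz))).
    replace (f w - f z - g z * (w - z))%C
      with (f w + (-1)%R * f z + - (w - z) * g z)%C by ring.
    eapply cseries_ext, T; intros n; cbv beta; ring.
  + replace (/ rho ^ 2 * d ^ 2 * S) with ((/ rho ^ 2 * d ^ 2) * S) by ring.
    apply (is_series_scal_R (/ rho ^ 2 * d ^ 2)), HS.
- replace (2 * (/ rho ^ 2 * d ^ 2 * S)) with ((2 * (/ rho ^ 2 * S)) * d * d) by ring.
  apply Rmult_le_compat_r; [assumption|].
  apply Rle_trans with (K * d); [apply Rmult_le_compat_r; [assumption | unfold K; lra]|].
  apply Rle_trans with (K * (eps / K)); [apply Rmult_le_compat_l; lra | right; field; lra].
Qed.

Lemma ps_on_deriv (a : C) (r : R) (f : C -> C) :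
  ps_on a r f -> exists g, ps_on a r g /\ forall z, Cmod (z - a) < r -> hderiv f z (g z).
Proof.
intros [c Hc].
destruct (ps_coef_deriv c r (fun z => f (z + a)%C)) as (g & Hg & Hd).
{ intros z Hz; replace (z - 0)%C with z in * by ring.
  assert (K := Hc (z + a)%C); replace (z + a - a)%C with z in K by ring; now apply K. }
exists (fun z => g (z - a)%C); split.
- exists (fun n => INR (S n) * c (S n))%C; intros z Hz.
  assert (K := Hg (z - a)%C); replace (z - a - 0)%C with (z - a)%C in K by ring; now apply K.
- intros z Hz.
  assert (S1 : hderiv (fun w => w - a)%C z 1).
  { eapply gderiv_eq; [|apply gderiv_minus; [apply gderiv_id | apply gderiv_const]]; ring. }
  assert (K := gderiv_comp (fun w => w) (fun w => f (w + a)%C) (fun w => w - a)%C z 1 _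
                 (Hd _ Hz) S1).
  eapply gderiv_eq; [|eapply gderiv_ext, K]; [ring|].
  intros y; cbv beta; f_equal; ring.
Qed.

(** * Isolated zeros of power series *)

Lemma ps_coef_center (c : nat -> C) (a : C) (r : R) (f : C -> C) :
  0 < r -> ps_coef c a r f -> f a = c O.
Proof.
intros Hr H.
assert (K := H a); replace (a - a)%C with (RtoC 0) in K by ring; rewrite Cmod_0 in K.
specialize (K Hr).
apply cseries_unique with (1 := K).
apply (proj2 (cseries_shift _ _)).
replace (c O - c O * 0 ^ 0)%C with (RtoC 0) by (simpl; ring).
apply cseries_0; intros n; rewrite Cpow_S; ring.
Qed.

Lemma ps_coef_nonzero_near (c : nat -> C) (a : C) (r : R) (f : C -> C) :
  0 < r -> ps_coef c a r f -> c O <> 0%C ->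
  exists d, 0 < d /\ forall z, Cmod (z - a) < d -> f z <> 0%C.
Proof.
intros Hr H Hn; destruct (ps_on_deriv a r f) as (g & _ & Hg); [now exists c|].
assert (Haa : Cmod (a - a) < r).
{ replace (a - a)%C with (RtoC 0) by ring; now rewrite Cmod_0. }
destruct (gderiv_cont _ _ _ _ (Hg a Haa) (Cmod (c O))) as (d & Hd & Hc).
{ now apply Cmod_gt_0. }
exists d; split; [assumption|]; intros z Hz E.
specialize (Hc z Hz); rewrite E, (ps_coef_center c a r f Hr H) in Hc.
replace (0 - c O)%C with (- c O)%C in Hc by ring; rewrite Cmod_opp in Hc; lra.
Qed.

(** If the constant coefficient vanishes, a factor [z - a] splits off; the quotient has the shifted
    coefficients, so the known nonzero one moves one index closer to the constant term. *)
Lemma ps_coef_isolated (n : nat) :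
  forall (c : nat -> C) (a : C) (r : R) (f : C -> C), 0 < r -> ps_coef c a r f ->
  c n <> 0%C -> exists d, 0 < d /\ forall z, z <> a -> Cmod (z - a) < d -> f z <> 0%C.
Proof.
induction n as [|n IH]; intros c a r f Hr H Hn.
- destruct (ps_coef_nonzero_near c a r f Hr H Hn) as (d & Hd & Hnz).
  exists d; split; [assumption | auto].
- destruct (classic (c O = 0%C)) as [E0|E0].
  2: { destruct (ps_coef_nonzero_near c a r f Hr H E0) as (d & Hd & Hnz).
       exists d; split; [assumption | auto]. }
  (* The quotient [f z / (z - a)] must be completed at the centre by [c 1]; its value outside the
     disk is arbitrary. *)
  destruct (functional_choice (fun z l => Cmod (z - a) < r ->
              cseries (fun k => c (S k) * (z - a) ^ k)%C l /\ f z = ((z - a) * l)%C))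
    as [f1 Hf1].
  { intros z; destruct (Rlt_dec (Cmod (z - a)) r) as [Hz|Hz].
    2: { exists 0%C; tauto. }
    destruct (classic (z = a)) as [->|Hza].
    - exists (c 1%nat); intros _; split.
      + apply (proj2 (cseries_shift _ _)).
        replace (c 1%nat - c 1%nat * (a - a) ^ 0)%C with (RtoC 0) by (simpl; ring).
        apply cseries_0; intros k; rewrite Cpow_S; ring.
      + rewrite (ps_coef_center c a r f Hr H), E0; ring.
    - assert (Hz0 : (z - a)%C <> 0%C).
      { intros E; apply Hza; replace z with (z - a + a)%C by ring; rewrite E; ring. }
      exists (f z / (z - a))%C; intros _; split; [|field; assumption].
      assert (K := proj1 (cseries_shift _ _) (H z Hz)).
      apply (cseries_scal (/ (z - a))%C) in K.
      replace (f z / (z - a))%C with (/ (z - a) * (f z - c O * (z - a) ^ 0))%C.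
      2: { rewrite E0; simpl; field; assumption. }
      eapply cseries_ext, K; intros k; cbv beta; rewrite Cpow_S; field; assumption. }
  destruct (IH (fun k => c (S k)) a r f1 Hr) as (d & Hd & Hnz).
  { intros z Hz; apply Hf1, Hz. }
  { exact Hn. }
  exists (Rmin d r); split; [now apply Rmin_pos|]; intros z Hza Hz E.
  assert (Hz1 := Rlt_le_trans _ _ _ Hz (Rmin_l _ _)).
  assert (Hz2 := Rlt_le_trans _ _ _ Hz (Rmin_r _ _)).
  apply (Hnz z Hza Hz1).
  destruct (Hf1 z Hz2) as [_ Ef]; rewrite E in Ef.
  destruct (classic (f1 z = 0%C)) as [|N]; [assumption|exfalso].
  apply (Cmult_neq_0 (z - a) (f1 z)); auto.
  intros E'; apply Hza; replace z with (z - a + a)%C by ring; rewrite E'; ring.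
Qed.

Lemma ps_on_isolated (a : C) (r : R) (f : C -> C) :
  0 < r -> ps_on a r f ->
  (forall z, Cmod (z - a) < r -> f z = 0%C) \/
  exists d, 0 < d /\ forall z, z <> a -> Cmod (z - a) < d -> f z <> 0%C.
Proof.
intros Hr [c Hc].
destruct (classic (exists n, c n <> 0%C)) as [[n Hn]|N].
- right; now apply (ps_coef_isolated n c a r f).
- left; intros z Hz; apply cseries_unique with (1 := Hc z Hz).
  apply cseries_0; intros n.
  destruct (classic (c n = 0%C)) as [->|M]; [ring | exfalso; eauto].
Qed.

(** * Local structure of the dilatation *)

(** Two holomorphic derivatives of [eta] and [k] are all that the Schwarzian of the lift asks for.
    Functions with such data are stable under products and reciprocals by the differentiation rules
    alone, without multiplying or inverting power series. *)
Definition C2_on (z : C) (r : R) (f f1 f2 : C -> C) : Prop :=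
  forall w, Cmod (w - z) < r -> hderiv f w (f1 w) /\ hderiv f1 w (f2 w).

Definition C2_near (f : C -> C) (z : C) : Prop :=
  exists r f1 f2, 0 < r /\ C2_on z r f f1 f2.

Lemma Cmod_self (z : C) : Cmod (z - z) = 0.
Proof. replace (z - z)%C with (RtoC 0) by ring; apply Cmod_0. Qed.

Lemma Cminus_neq_0 (z w : C) : z <> w -> (z - w)%C <> 0%C.
Proof. intros H E; apply H; replace z with (z - w + w)%C by ring; rewrite E; ring. Qed.

Lemma ps_on_C2_near (f : C -> C) (z : C) (r : R) : 0 < r -> ps_on z r f -> C2_near f z.
Proof.
intros Hr H.
destruct (ps_on_deriv z r f H) as (f1 & H1 & D1).
destruct (ps_on_deriv z r f1 H1) as (f2 & H2 & D2).
exists r, f1, f2; split; [assumption|]; intros w Hw; split; auto.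
Qed.

Lemma analytic_C2_near (f : C -> C) (z : C) : analytic_at f z -> C2_near f z.
Proof.
intros H; destruct (analytic_ps_on f z H) as (r & Hr & Hps); now apply ps_on_C2_near with r.
Qed.

Lemma C2_near_mult (f g : C -> C) (z : C) :
  C2_near f z -> C2_near g z -> C2_near (fun w => f w * g w)%C z.
Proof.
intros (r & f1 & f2 & Hr & Hf) (s & g1 & g2 & Hs & Hg).
exists (Rmin r s), (fun w => f1 w * g w + f w * g1 w)%C,
  (fun w => (f2 w * g w + f1 w * g1 w) + (f1 w * g1 w + f w * g2 w))%C.
split; [now apply Rmin_pos|]; intros w Hw.
destruct (Hf w (Rlt_le_trans _ _ _ Hw (Rmin_l _ _))) as [F1 F2].
destruct (Hg w (Rlt_le_trans _ _ _ Hw (Rmin_r _ _))) as [G1 G2].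
split; [now apply gderiv_mult|].
apply gderiv_plus; now apply gderiv_mult.
Qed.

Lemma C2_near_pow (z : C) (n : nat) : C2_near (fun w => (w - z) ^ n)%C z.
Proof.
assert (D : forall w, hderiv (fun w => w - z)%C w 1).
{ intros w; eapply gderiv_eq; [|apply gderiv_minus; [apply gderiv_id | apply gderiv_const]]; ring. }
exists 1, (fun w => INR n * (w - z) ^ pred n * 1)%C,
  (fun w => INR n * (INR (pred n) * (w - z) ^ pred (pred n) * 1) * 1)%C.
split; [lra|]; intros w _; split.
- apply (gderiv_pow (fun w => w) (fun w => w - z)%C), D.
- eapply gderiv_ext with (fun w => (INR n * 1) * (w - z) ^ pred n)%C; [intros; ring|].
  eapply gderiv_eq; [|apply gderiv_scal, (gderiv_pow (fun w => w) (fun w => w - z)%C), D].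
  ring.
Qed.

Lemma C2_near_cont (f : C -> C) (z : C) : C2_near f z ->
  forall eps, 0 < eps -> exists d, 0 < d /\ forall w, Cmod (w - z) < d -> Cmod (f w - f z) < eps.
Proof.
intros (r & f1 & f2 & Hr & Hf).
apply (gderiv_cont (fun w => w) f z (f1 z)), Hf; now rewrite Cmod_self.
Qed.

Lemma C2_near_nonzero (f : C -> C) (z : C) : C2_near f z -> f z <> 0%C ->
  exists d, 0 < d /\ forall w, Cmod (w - z) < d -> f w <> 0%C.
Proof.
intros H Hz.
destruct (C2_near_cont f z H (Cmod (f z))) as (d & Hd & H'); [now apply Cmod_gt_0|].
exists d; split; [assumption|]; intros w Hw E; specialize (H' w Hw).
rewrite E in H'; replace (0 - f z)%C with (- f z)%C in H' by ring.
rewrite Cmod_opp in H'; lra.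
Qed.

Lemma C2_near_inv (f : C -> C) (z : C) :
  C2_near f z -> f z <> 0%C -> C2_near (fun w => / f w)%C z.
Proof.
intros H Hz; destruct (C2_near_nonzero f z H Hz) as (d & Hd & Hnz).
destruct H as (r & f1 & f2 & Hr & Hf).
exists (Rmin r d), (fun w => - f1 w / (f w * f w))%C,
  (fun w => (- f2 w * (f w * f w) - - f1 w * (f1 w * f w + f w * f1 w))
            / ((f w * f w) * (f w * f w)))%C.
split; [now apply Rmin_pos|]; intros w Hw.
destruct (Hf w (Rlt_le_trans _ _ _ Hw (Rmin_l _ _))) as [F1 F2].
assert (N := Hnz w (Rlt_le_trans _ _ _ Hw (Rmin_r _ _))).
split; [now apply gderiv_inv|].
apply (gderiv_div (fun w => w) (fun w => - f1 w)%C (fun w => f w * f w)%C).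
- now apply Cmult_neq_0.
- now apply gderiv_opp.
- now apply gderiv_mult.
Qed.

Lemma C2_near_minus (f g : C -> C) (z : C) :
  C2_near f z -> C2_near g z -> C2_near (fun w => f w - g w)%C z.
Proof.
intros (r & f1 & f2 & Hr & Hf) (s & g1 & g2 & Hs & Hg).
exists (Rmin r s), (fun w => f1 w - g1 w)%C, (fun w => f2 w - g2 w)%C.
split; [now apply Rmin_pos|]; intros w Hw.
destruct (Hf w (Rlt_le_trans _ _ _ Hw (Rmin_l _ _))) as [F1 F2].
destruct (Hg w (Rlt_le_trans _ _ _ Hw (Rmin_r _ _))) as [G1 G2].
split; now apply gderiv_minus.
Qed.

Lemma exists_close (z : C) (d : R) : 0 < d -> exists w, w <> z /\ Cmod (w - z) < d.
Proof.
intros Hd; exists (z + RtoC (d / 2))%C.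
assert (E : (z + RtoC (d / 2) - z)%C = RtoC (d / 2)) by ring.
split.
- intros E'; rewrite E' in E; replace (z - z)%C with (RtoC 0) in E by ring.
  apply RtoC_inj in E; lra.
- rewrite E, Cmod_R, Rabs_pos_eq; lra.
Qed.

(* The derivative is given by the termwise differentiated series on a whole disk, hence
   has a power series at its centre. *)
Lemma analytic_derive (f : C -> C) (z : C) : analytic_at f z ->
  exists r, 0 < r /\ ps_on z r (C_derive f) /\
    forall w, Cmod (w - z) < r -> hderiv f w (C_derive f w).
Proof.
intros H; destruct (analytic_ps_on f z H) as (r & Hr & Hps).
destruct (ps_on_deriv z r f Hps) as (f1 & [c Hc] & D1).
exists r; split; [assumption|].
assert (E : forall w, Cmod (w - z) < r -> C_derive f w = f1 w)
  by (intros w Hw; apply hderiv_C_derive, D1, Hw).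
split.
- exists c; intros w Hw; rewrite E by assumption; now apply Hc.
- intros w Hw; rewrite E by assumption; now apply D1.
Qed.

Lemma in_disk_segment (a b : C) (t : R) :
  in_disk a -> in_disk b -> 0 <= t <= 1 -> in_disk (a + t * (b - a)).
Proof.
unfold in_disk; intros Ha Hb Ht.
replace (a + t * (b - a))%C with (RtoC (1 - t) * a + t * b)%C by (rewrite RtoC_minus; ring).
eapply Rle_lt_trans; [apply Cmod_triangle|].
rewrite !Cmod_mult, !Cmod_R, !Rabs_pos_eq by lra.
destruct (Req_dec t 0) as [->|Ht0]; [lra|].
assert (t * Cmod b < t * 1) by (apply Rmult_lt_compat_l; lra).
assert ((1 - t) * Cmod a <= (1 - t) * 1) by (apply Rmult_le_compat_l; lra).
lra.
Qed.

(** Connectedness of the segment from [z] to [z1]: vanishing identically near [z] would propagate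
    along it to [z1]. *)
Lemma identity_theorem (f : C -> C) (z z1 : C) :
  (forall w, in_disk w -> exists r, 0 < r /\ ps_on w r f) ->
  in_disk z -> in_disk z1 -> f z1 <> 0%C ->
  exists d, 0 < d /\ forall w, w <> z -> Cmod (w - z) < d -> f w <> 0%C.
Proof.
intros Hf Hz Hz1 Hnz.
destruct (Hf z Hz) as (r & Hr & Hps).
destruct (ps_on_isolated z r f Hr Hps) as [H0|]; [exfalso | assumption].
assert (Hne : z1 <> z) by (intros ->; apply Hnz, H0; rewrite Cmod_self; assumption).
set (l := Cmod (z1 - z)).
assert (Hl : 0 < l) by (apply Cmod_gt_0; now apply Cminus_neq_0).
set (zeta := fun t : R => (z + t * (z1 - z))%C).
assert (Ez : forall s t, Cmod (zeta s - zeta t) = Rabs (s - t) * l).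
{ intros s t; unfold l; rewrite <- Cmod_R, <- Cmod_mult; f_equal; unfold zeta.
  rewrite RtoC_minus; ring. }
set (P := fun t => exists d, 0 < d /\ forall w, Cmod (w - zeta t) < d -> f w = 0%C).
(* Near a point of the segment [f] either vanishes on a whole disk or has no zero except perhaps the
   point itself. In both cases membership in [P] is locally constant. *)
assert (Loc : forall t, 0 <= t <= 1 ->
          exists d, 0 < d /\ forall s, Rabs (s - t) < d -> (P s <-> P t)).
{ intros t Ht.
  destruct (Hf (zeta t) (in_disk_segment z z1 t Hz Hz1 Ht)) as (rt & Hrt & Hpt).
  destruct (ps_on_isolated _ _ _ Hrt Hpt) as [K|[d [Hd K]]].
  - exists (rt / 2 / l); split; [repeat apply Rdiv_lt_0_compat; lra|]; intros s Hs.
    split; intros _; [now exists rt|].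
    exists (rt / 2); split; [lra|]; intros w Hw; apply K.
    replace (w - zeta t)%C with ((w - zeta s) + (zeta s - zeta t))%C by ring.
    eapply Rle_lt_trans; [apply Cmod_triangle|]; rewrite Ez.
    assert (Rabs (s - t) * l < rt / 2 / l * l) by (apply Rmult_lt_compat_r; assumption).
    replace (rt / 2 / l * l) with (rt / 2) in * by (field; lra); lra.
  - exists (d / l); split; [apply Rdiv_lt_0_compat; lra|]; intros s Hs.
    destruct (Req_dec s t) as [->|Hst]; [tauto|].
    split; intros [e [He K']]; exfalso.
    + apply (K (zeta s)).
      * intros E; assert (E' := Ez s t); rewrite E, Cmod_self in E'.
        assert (0 < Rabs (s - t)) by (apply Rabs_pos_lt; lra).
        assert (0 < Rabs (s - t) * l) by (now apply Rmult_lt_0_compat); lra.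
      * rewrite Ez; apply Rlt_le_trans with (d / l * l); [|right; field; lra].
        apply Rmult_lt_compat_r; assumption.
      * apply K'; now rewrite Cmod_self.
    + destruct (exists_close (zeta t) (Rmin d e)) as (w & Hw & Hwd); [now apply Rmin_pos|].
      apply (K w Hw (Rlt_le_trans _ _ _ Hwd (Rmin_l _ _))).
      apply K', (Rlt_le_trans _ _ _ Hwd (Rmin_r _ _)). }
(* The indicator function of [P] is locally constant, so it has derivative 0 and takes the same
   value at both ends; this replaces a supremum argument. *)
destruct (functional_choice (fun t c => (P t -> c = 1) /\ (~ P t -> c = 0))) as [chi Hchi].
{ intros t; destruct (classic (P t)); [exists 1 | exists 0]; tauto. }
assert (Ec : chi 0 = chi 1).
{ apply (eq_is_derive chi 0 1); [|lra]; intros t Ht.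
  destruct (Loc t Ht) as (d & Hd & HP).
  apply (is_derive_ext_loc (fun _ => chi t)); [|apply @is_derive_const].
  exists (mkposreal d Hd); intros s Hs; specialize (HP s Hs).
  destruct (Hchi s) as [S1 S2], (Hchi t) as [T1 T2].
  destruct (classic (P t)) as [Pt|Pt].
  - rewrite S1, T1; tauto.
  - rewrite S2, T2; tauto. }
assert (P0 : P 0).
{ exists r; split; [assumption|]; intros w Hw; apply H0.
  replace (zeta 0) with z in Hw by (unfold zeta; ring); assumption. }
assert (P1 : ~ P 1).
{ intros (d & Hd & K); apply Hnz, K.
  replace (zeta 1) with z1 by (unfold zeta; ring); now rewrite Cmod_self. }
destruct (Hchi 0) as [A _], (Hchi 1) as [_ B]; specialize (A P0); specialize (B P1); lra.
Qed.

Lemma in_disk_open (z : C) : in_disk z ->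
  exists d, 0 < d /\ forall w, Cmod (w - z) < d -> in_disk w.
Proof.
unfold in_disk; intros Hz; exists (1 - Cmod z); split; [lra|]; intros w Hw.
replace w with (z + (w - z))%C by ring; eapply Rle_lt_trans; [apply Cmod_triangle | lra].
Qed.

(* [eta] is whichever of [h'], [g'] does not vanish at the centre ([swap] tells which),
   and [k ^ 2] is the quotient of the other one by it: [k] is [q] or [1 / q]. *)
Definition local_rep (h g q : C -> C) (z : C) (r : R) (swap : bool)
    (eta eta1 eta2 k k1 k2 : C -> C) : Prop :=
  C2_on z r eta eta1 eta2 /\ C2_on z r k k1 k2 /\
  forall w, Cmod (w - z) < r ->
    in_disk w /\ eta w <> 0%C /\
    C_derive (if swap then g else h) w = eta w /\
    C_derive (if swap then h else g) w = (eta w * k w ^ 2)%C /\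
    (C_derive h w * q w)%C = (eta w * k w)%C.

Lemma local_rep_intro (h g q : C -> C) (z : C) (swap : bool) (eta k : C -> C) :
  in_disk z -> C2_near eta z -> C2_near k z -> eta z <> 0%C ->
  (exists d, 0 < d /\ forall w, Cmod (w - z) < d -> eta w <> 0%C ->
    C_derive (if swap then g else h) w = eta w /\
    C_derive (if swap then h else g) w = (eta w * k w ^ 2)%C /\
    (C_derive h w * q w)%C = (eta w * k w)%C) ->
  exists r swap eta eta1 eta2 k k1 k2, 0 < r /\ local_rep h g q z r swap eta eta1 eta2 k k1 k2.
Proof.
intros Hz He Hk Hnz (d & Hd & H).
destruct (C2_near_nonzero eta z He Hnz) as (d' & Hd' & Hnz').
destruct (in_disk_open z Hz) as (e & He0 & Hin).
destruct He as (r1 & eta1 & eta2 & Hr1 & He), Hk as (r2 & k1 & k2 & Hr2 & Hk).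
exists (Rmin (Rmin d (Rmin d' e)) (Rmin r1 r2)), swap, eta, eta1, eta2, k, k1, k2.
split; [repeat apply Rmin_pos; assumption|].
assert (S : forall w, Cmod (w - z) < Rmin (Rmin d (Rmin d' e)) (Rmin r1 r2) ->
   Cmod (w - z) < d /\ Cmod (w - z) < d' /\ Cmod (w - z) < e /\
   Cmod (w - z) < r1 /\ Cmod (w - z) < r2).
{ intros w Hw.
  assert (A := Rmin_l (Rmin d (Rmin d' e)) (Rmin r1 r2)).
  assert (B := Rmin_r (Rmin d (Rmin d' e)) (Rmin r1 r2)).
  assert (A1 := Rmin_l d (Rmin d' e)); assert (A2 := Rmin_r d (Rmin d' e)).
  assert (A3 := Rmin_l d' e); assert (A4 := Rmin_r d' e).
  assert (B1 := Rmin_l r1 r2); assert (B2 := Rmin_r r1 r2).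
  repeat split; lra. }
split; [|split].
- intros w Hw; apply He, S, Hw.
- intros w Hw; apply Hk, S, Hw.
- intros w Hw; destruct (S w Hw) as (S1 & S2 & S3 & _).
  split; [now apply Hin|]; split; [now apply Hnz'|]; now apply H; [|apply Hnz'].
Qed.

(** If [q] is analytic at [z], then [h'] cannot vanish there, since [g' = h' q^2] would vanish too.
    At a pole [q = k / (w - z)^m], letting [w] tend to [z] in [g' (w - z)^(2m) = h' k^2] forces
    [h' z = 0]; hence [g' z] is nonzero and [1 / q = (w - z)^m / k] is the holomorphic root to
    use. *)
Lemma local_rep_exists (h g q : C -> C) (z : C) :
  liftable_harmonic_map h g q -> in_disk z ->
  exists r swap eta eta1 eta2 k k1 k2, 0 < r /\ local_rep h g q z r swap eta eta1 eta2 k k1 k2.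
Proof.
intros (Hh & Hg & Hs & Hq & (z1 & Hz1 & Hz1n) & Hdil) Hz.
destruct (analytic_derive h z (Hh z Hz)) as (rh & Hrh & Ph & Dh).
destruct (analytic_derive g z (Hg z Hz)) as (rg & Hrg & Pg & Dg).
assert (Ch := ps_on_C2_near _ _ _ Hrh Ph).
assert (Cg := ps_on_C2_near _ _ _ Hrg Pg).
destruct (in_disk_open z Hz) as (e & He & Hin).
assert (Iso : exists d, 0 < d /\ forall w, w <> z -> Cmod (w - z) < d -> C_derive h w <> 0%C).
{ apply (identity_theorem (C_derive h) z z1); try assumption.
  intros w Hw; destruct (analytic_derive h w (Hh w Hw)) as (r & Hr & P & _); now exists r. }
destruct Iso as (d & Hd & Iso).
assert (Dil : forall w, w <> z -> Cmod (w - z) < Rmin d e ->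
          C_derive g w = (C_derive h w * q w ^ 2)%C).
{ intros w Hwz Hw.
  assert (N := Iso w Hwz (Rlt_le_trans _ _ _ Hw (Rmin_l _ _))).
  rewrite <- (Hdil w (Hin w (Rlt_le_trans _ _ _ Hw (Rmin_r _ _))) N).
  field; assumption. }
assert (Hde : 0 < Rmin d e) by now apply Rmin_pos.
(* The dilatation equation is only given off the zeros of [h']. These are isolated, so identities
   extend to [z] by continuity. *)
assert (Lim : forall F, C2_near F z ->
   (exists d', 0 < d' /\ forall w, w <> z -> Cmod (w - z) < d' -> F w = 0%C) -> F z = 0%C).
{ intros F HF (d' & Hd' & H); destruct (classic (F z = 0%C)) as [|N]; [assumption|exfalso].
  destruct (C2_near_nonzero F z HF N) as (d2 & Hd2 & H2).
  destruct (exists_close z (Rmin d' d2)) as (w & Hw & Hwd); [now apply Rmin_pos|].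
  apply (H2 w (Rlt_le_trans _ _ _ Hwd (Rmin_r _ _))), H; [assumption|].
  exact (Rlt_le_trans _ _ _ Hwd (Rmin_l _ _)). }
destruct (Hq z Hz) as [Aq|(m & k & rk & Hm & Ak & Hkz & Hrk & Ek)].
- assert (Cq := analytic_C2_near q z Aq).
  assert (E0 : C_derive g z = (C_derive h z * q z ^ 2)%C).
  { assert (L := Lim (fun w => C_derive g w - C_derive h w * (q w * q w))%C).
    cbv beta in L.
    replace (C_derive g z) with (C_derive g z - C_derive h z * (q z * q z)
              + C_derive h z * (q z * q z))%C by ring.
    rewrite L; [ring | | ].
    - apply C2_near_minus; [assumption|]; apply C2_near_mult; [assumption|].
      now apply C2_near_mult.
    - exists (Rmin d e); split; [assumption|]; intros w Hw Hwd; rewrite (Dil w Hw Hwd); ring. }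
  assert (N : C_derive h z <> 0%C).
  { intros E; apply (Hs z Hz); unfold exp_sigma; rewrite E0, E.
    replace (0 * q z ^ 2)%C with (RtoC 0) by ring; rewrite Cmod_0; ring. }
  apply (local_rep_intro h g q z false (C_derive h) q); try assumption.
  exists (Rmin d e); split; [assumption|]; intros w Hw Hnz; repeat split.
  destruct (classic (w = z)) as [->|]; auto.
- assert (Ck := analytic_C2_near k z Ak).
  assert (Eg : forall w, w <> z -> Cmod (w - z) < Rmin (Rmin d e) rk ->
     (C_derive g w * ((w - z) ^ m * (w - z) ^ m) = C_derive h w * (k w * k w))%C).
  { intros w Hw Hwd; rewrite (Dil w Hw (Rlt_le_trans _ _ _ Hwd (Rmin_l _ _))).
    rewrite (Ek w Hw (Rlt_le_trans _ _ _ Hwd (Rmin_r _ _))).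
    field; now apply Cpow_nz, Cminus_neq_0. }
  assert (Hder : 0 < Rmin (Rmin d e) rk) by now apply Rmin_pos.
  assert (Z0 : ((z - z) ^ m)%C = 0%C).
  { destruct m as [|m]; [lia|]; rewrite Cpow_S; ring. }
  assert (Hz0 : C_derive h z = 0%C).
  { assert (L := Lim (fun w => C_derive g w * ((w - z) ^ m * (w - z) ^ m)
                               - C_derive h w * (k w * k w))%C).
    cbv beta in L; rewrite Z0 in L.
    destruct (classic (C_derive h z = 0%C)) as [|N]; [assumption|exfalso].
    apply (Cmult_neq_0 (C_derive h z) (k z * k z)); [assumption | now apply Cmult_neq_0|].
    assert (E : (C_derive g z * (0 * 0) - C_derive h z * (k z * k z))%C = 0%C).
    { apply L.
      - apply C2_near_minus; apply C2_near_mult; try assumption;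
          apply C2_near_mult; try assumption; apply C2_near_pow.
      - exists (Rmin (Rmin d e) rk); split; [assumption|]; intros w Hw Hwd.
        rewrite (Eg w Hw Hwd); ring. }
    replace (C_derive h z * (k z * k z))%C
      with (- (C_derive g z * (0 * 0) - C_derive h z * (k z * k z)))%C by ring.
    rewrite E; ring. }
  assert (N : C_derive g z <> 0%C).
  { intros E; apply (Hs z Hz); unfold exp_sigma; rewrite Hz0, E, Cmod_0; ring. }
  destruct (C2_near_nonzero k z Ck Hkz) as (d2 & Hd2 & Hk2).
  apply (local_rep_intro h g q z true (C_derive g) (fun w => (w - z) ^ m * / k w)%C);
    try assumption.
  { apply C2_near_mult; [apply C2_near_pow | now apply C2_near_inv]. }
  exists (Rmin (Rmin (Rmin d e) rk) d2); split; [now apply Rmin_pos|]; intros w Hw Hnz.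
  assert (Hw1 := Rlt_le_trans _ _ _ Hw (Rmin_l _ _)).
  assert (Kw := Hk2 w (Rlt_le_trans _ _ _ Hw (Rmin_r _ _))).
  split; [reflexivity|].
  destruct (classic (w = z)) as [->|Hwz].
  { rewrite Hz0, Z0; split; ring. }
  assert (E1 : C_derive h w = (C_derive g w * ((w - z) ^ m * / k w) ^ 2)%C).
  { replace (C_derive h w) with (C_derive h w * (k w * k w) * / (k w * k w))%C
      by (field; assumption).
    rewrite <- (Eg w Hwz Hw1); field; assumption. }
  split; [exact E1|].
  rewrite E1, (Ek w Hwz (Rlt_le_trans _ _ _ Hw1 (Rmin_r _ _))).
  field; split; [assumption | now apply Cpow_nz, Cminus_neq_0].
Qed.

(** * Derivatives of the conformal factor *)

Lemma Cmod_sqr_C (z : C) : (z * Cconj z)%C = RtoC (Cmod z ^ 2).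
Proof. symmetry; apply Cmod2_conj. Qed.

Lemma one_plus_sqr_neq_0 (z : C) : (1 + z * Cconj z)%C <> 0%C.
Proof.
rewrite Cmod_sqr_C, <- RtoC_plus; intros E; apply RtoC_inj in E.
assert (H := pow2_ge_0 (Cmod z)); lra.
Qed.

Lemma is_derive_Cmod_sqr (f : R -> C) (t : R) (l : C) :
  cderiv f t l -> is_derive (fun s => Cmod (f s) ^ 2) t (2 * Re (l * Cconj (f t))).
Proof.
intros H.
apply is_derive_ext with (fun s => Re (f s * Cconj (f s))%C).
{ intros s; rewrite Cmod_sqr_C; reflexivity. }
replace (2 * Re (l * Cconj (f t))) with (Re (l * Cconj (f t) + f t * Cconj l))
  by (unfold Re; simpl; ring).
apply (cderiv_re (fun s => f s * Cconj (f s))%C).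
apply (gderiv_mult RtoC f (fun s => Cconj (f s))); [assumption | now apply cderiv_conj].
Qed.

Lemma is_derive_ln_comp (f : R -> R) (t l : R) :
  0 < f t -> is_derive f t l -> is_derive (fun s => ln (f s)) t (l / f t).
Proof.
intros Hp H; evar_last; [apply (is_derive_comp ln f); [now apply is_derive_ln | exact H]|].
unfold scal; simpl; unfold mult; simpl; field; lra.
Qed.

Lemma is_derive_ln_Cmod (f : R -> C) (t : R) (l : C) :
  f t <> 0%C -> cderiv f t l -> is_derive (fun s => ln (Cmod (f s) ^ 2)) t (2 * Re (l / f t)).
Proof.
intros H0 H; assert (Hp : 0 < Cmod (f t)) by now apply Cmod_gt_0.
evar_last; [apply (is_derive_ln_comp (fun s => Cmod (f s) ^ 2));
  [now apply pow_lt | apply is_derive_Cmod_sqr, H]|].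
assert (E : (l / f t)%C = (l * Cconj (f t) * RtoC (/ Cmod (f t) ^ 2))%C).
{ rewrite RtoC_inv, <- Cmod_sqr_C by (apply pow_nonzero; lra).
  field; split; [|assumption].
  intros E; apply (Rgt_not_eq _ _ Hp); rewrite <- Cmod_conj, E; apply Cmod_0. }
rewrite E; simpl; field; lra.
Qed.

(* [sigma1], [sigma2] and [sigma11] are the Wirtinger derivatives [sigma_z], [sigma_zz] and
   [sigma_(z zbar)] of [sigma = ln (|eta| (1 + |k|^2))]. *)
Definition sigma1 (eta eta1 k k1 : C -> C) (w : C) : C :=
  (eta1 w / (2 * eta w) + k1 w * Cconj (k w) / (1 + k w * Cconj (k w)))%C.

Definition sigma2 (eta eta1 eta2 k k1 k2 : C -> C) (w : C) : C :=
  (eta2 w / (2 * eta w) - eta1 w ^ 2 / (2 * eta w ^ 2)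
   + k2 w * Cconj (k w) / (1 + k w * Cconj (k w))
   - (k1 w * Cconj (k w)) ^ 2 / (1 + k w * Cconj (k w)) ^ 2)%C.

Definition sigma11 (k k1 : C -> C) (w : C) : R :=
  Cmod (k1 w) ^ 2 / (1 + Cmod (k w) ^ 2) ^ 2.

Lemma sigma11_C (k k1 : C -> C) (w : C) :
  RtoC (sigma11 k k1 w) = (k1 w * Cconj (k1 w) / (1 + k w * Cconj (k w)) ^ 2)%C.
Proof.
unfold sigma11; assert (H := pow2_ge_0 (Cmod (k w))).
rewrite RtoC_div, (RtoC_pow (1 + _)), RtoC_plus, <- !Cmod_sqr_C; [reflexivity|].
apply pow_nonzero; lra.
Qed.

Lemma cderiv_horizontal (z : C) : cderiv (fun t => (t, Im z)) (Re z) 1.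
Proof.
apply cderiv_components; split; simpl; [apply @is_derive_id | apply @is_derive_const].
Qed.

Lemma cderiv_vertical (z : C) : cderiv (fun t => (Re z, t)) (Im z) Ci.
Proof.
apply cderiv_components; split; simpl; [apply @is_derive_const | apply @is_derive_id].
Qed.

Lemma ball_horizontal (z : C) (r : R) : 0 < r ->
  locally (Re z) (fun t => Cmod ((t, Im z) - z) < r).
Proof.
intros Hr; exists (mkposreal r Hr); intros t Ht.
replace ((t, Im z) - z)%C with (RtoC (t - Re z)) by (apply C_ext; unfold Re, Im; simpl; ring).
rewrite Cmod_R; exact Ht.
Qed.

Lemma ball_vertical (z : C) (r : R) : 0 < r ->
  locally (Im z) (fun t => Cmod ((Re z, t) - z) < r).
Proof.
intros Hr; exists (mkposreal r Hr); intros t Ht.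
replace ((Re z, t) - z)%C with (Ci * RtoC (t - Im z))%C by (apply C_ext; unfold Re, Im; simpl; ring).
rewrite Cmod_mult, Cmod_Ci, Cmod_R, Rmult_1_l; exact Ht.
Qed.

Lemma partial_x_eq (s s' : C -> R) (z : C) (r l : R) : 0 < r ->
  (forall w, Cmod (w - z) < r -> s w = s' w) ->
  is_derive (fun t => s' (t, Im z)) (Re z) l -> partial_x s z = l.
Proof.
intros Hr E H; unfold partial_x.
rewrite (Derive_ext_loc _ (fun t => s' (t, Im z))); [now apply is_derive_unique|].
generalize (ball_horizontal z r Hr); apply filter_imp; auto.
Qed.

Lemma partial_y_eq (s s' : C -> R) (z : C) (r l : R) : 0 < r ->
  (forall w, Cmod (w - z) < r -> s w = s' w) ->
  is_derive (fun t => s' (Re z, t)) (Im z) l -> partial_y s z = l.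
Proof.
intros Hr E H; unfold partial_y.
rewrite (Derive_ext_loc _ (fun t => s' (Re z, t))); [now apply is_derive_unique|].
generalize (ball_vertical z r Hr); apply filter_imp; auto.
Qed.

Lemma wirtinger_eq (F G : C -> C) (z a b : C) (r : R) : 0 < r ->
  (forall w, Cmod (w - z) < r -> F w = G w) ->
  cderiv (fun t => G (t, Im z)) (Re z) a -> cderiv (fun t => G (Re z, t)) (Im z) b ->
  wirtinger F z = ((a - Ci * b) / 2)%C.
Proof.
intros Hr E Ha Hb; unfold wirtinger.
rewrite (partial_x_eq _ (fun w => Re (G w)) z r (Re a)); [| assumption | |now apply cderiv_re].
2: { intros w Hw; now rewrite E. }
rewrite (partial_x_eq _ (fun w => Im (G w)) z r (Im a)); [| assumption | |now apply cderiv_im].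
2: { intros w Hw; now rewrite E. }
rewrite (partial_y_eq _ (fun w => Re (G w)) z r (Re b)); [| assumption | |now apply cderiv_re].
2: { intros w Hw; now rewrite E. }
rewrite (partial_y_eq _ (fun w => Im (G w)) z r (Im b)); [| assumption | |now apply cderiv_im].
2: { intros w Hw; now rewrite E. }
now rewrite <- !surjective_pairing || destruct a, b.
Qed.

Section Sigma.
Variables (h g q : C -> C) (z : C) (r : R) (swap : bool) (eta eta1 eta2 k k1 k2 : C -> C).
Hypothesis Hr : 0 < r.
Hypothesis Rep : local_rep h g q z r swap eta eta1 eta2 k k1 k2.

Lemma exp_sigma_local (w : C) : Cmod (w - z) < r ->
  exp_sigma h g w = Cmod (eta w) * (1 + Cmod (k w) ^ 2).
Proof.
intros Hw; destruct Rep as (_ & _ & H); destruct (H w Hw) as (_ & _ & E1 & E2 & _).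
unfold exp_sigma; destruct swap; rewrite E1, E2, Cmod_mult, Cmod_pow; ring.
Qed.

Lemma sigma_local (w : C) : Cmod (w - z) < r ->
  Defs.sigma h g w = / 2 * ln (Cmod (eta w) ^ 2) + ln (1 + Cmod (k w) ^ 2).
Proof.
intros Hw; unfold Defs.sigma; rewrite exp_sigma_local by assumption.
destruct Rep as (_ & _ & H); destruct (H w Hw) as (_ & N & _).
assert (0 < Cmod (eta w)) by now apply Cmod_gt_0.
assert (P := pow2_ge_0 (Cmod (k w))).
rewrite ln_mult, ln_pow by lra; simpl INR; lra.
Qed.

Lemma is_derive_sigma (phi : R -> C) (t : R) (l : C) :
  Cmod (phi t - z) < r -> cderiv phi t l ->
  is_derive (fun s => / 2 * ln (Cmod (eta (phi s)) ^ 2) + ln (1 + Cmod (k (phi s)) ^ 2)) t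
    (2 * Re (sigma1 eta eta1 k k1 (phi t) * l)).
Proof.
intros Ht Hphi.
destruct Rep as (He & Hk & H).
destruct (He _ Ht) as [He1 _], (Hk _ Ht) as [Hk1 _].
destruct (H _ Ht) as (_ & N & _).
assert (P := pow2_ge_0 (Cmod (k (phi t)))).
assert (De := is_derive_ln_Cmod (fun s => eta (phi s)) t _ N
                (gderiv_comp RtoC eta phi t l _ He1 Hphi)).
assert (Dk := is_derive_Cmod_sqr (fun s => k (phi s)) t _
                (gderiv_comp RtoC k phi t l _ Hk1 Hphi)).
assert (D1 : is_derive (fun s => 1 + Cmod (k (phi s)) ^ 2) t
               (2 * Re (k1 (phi t) * l * Cconj (k (phi t))))).
{ evar_last; [apply @is_derive_plus; [apply @is_derive_const | apply Dk]|].
  apply plus_zero_l. }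
apply is_derive_ln_comp in D1; [|lra].
evar_last; [apply @is_derive_plus; [apply is_derive_scal, De | apply D1]|].
unfold plus; simpl plus.
unfold sigma1.
assert (E : ((eta1 (phi t) / (2 * eta (phi t)) + k1 (phi t) * Cconj (k (phi t)) /
     (1 + k (phi t) * Cconj (k (phi t)))) * l
   = RtoC (/ 2) * (eta1 (phi t) * l / eta (phi t))
   + RtoC (/ (1 + Cmod (k (phi t)) ^ 2)) * (k1 (phi t) * l * Cconj (k (phi t))))%C).
{ rewrite !RtoC_inv, RtoC_plus, <- Cmod_sqr_C by lra.
  field; split; [apply one_plus_sqr_neq_0 | assumption]. }
rewrite E, re_plus, !re_scal_l.
change (/ 2 * (2 * Re (eta1 (phi t) * l / eta (phi t))) +
  2 * Re (k1 (phi t) * l * Cconj (k (phi t))) / (1 + Cmod (k (phi t)) ^ 2) =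
  2 * (/ 2 * Re (eta1 (phi t) * l / eta (phi t)) +
  / (1 + Cmod (k (phi t)) ^ 2) * Re (k1 (phi t) * l * Cconj (k (phi t))))).
field; lra.
Qed.

(** Chain rule with both Wirtinger derivatives, as [sigma_z] is not holomorphic. Taking [l = 1] and
    [l = i], the [sigma11] terms cancel in the Wirtinger derivative, which gives the Schwarzian, and
    add up in the Laplacian. *)
Lemma cderiv_sigma1 (phi : R -> C) (t : R) (l : C) :
  Cmod (phi t - z) < r -> cderiv phi t l ->
  cderiv (fun s => sigma1 eta eta1 k k1 (phi s)) t
    (sigma2 eta eta1 eta2 k k1 k2 (phi t) * l + sigma11 k k1 (phi t) * Cconj l).
Proof.
intros Ht Hphi.
destruct Rep as (He & Hk & H).
destruct (He _ Ht) as [He1 He2], (Hk _ Ht) as [Hk1 Hk2].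
destruct (H _ Ht) as (_ & N & _).
assert (Q := one_plus_sqr_neq_0 (k (phi t))).
assert (D0 := gderiv_comp RtoC eta phi t l _ He1 Hphi).
assert (D1 := gderiv_comp RtoC eta1 phi t l _ He2 Hphi).
assert (D2 := gderiv_comp RtoC k phi t l _ Hk1 Hphi).
assert (D3 := gderiv_comp RtoC k1 phi t l _ Hk2 Hphi).
assert (D4 := cderiv_conj _ _ _ D2).
eapply gderiv_eq.
2: { unfold sigma1; apply gderiv_plus; apply gderiv_div.
     3: { apply gderiv_scal, D0. }
     2: { exact D1. }
     1: { apply Cmult_neq_0; [|assumption]; intros E; apply RtoC_inj in E; lra. }
     3: { apply gderiv_plus; [apply gderiv_const | apply gderiv_mult; [exact D2 | exact D4]]. }
     2: { apply gderiv_mult; [exact D3 | exact D4]. }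
     exact Q. }
unfold sigma2; rewrite sigma11_C, !Cmult_conj.
cbv beta.
field; split; assumption.
Qed.

Lemma ball_self : Cmod (z - z) < r.
Proof. now rewrite Cmod_self. Qed.

Lemma ball_nested (w : C) : Cmod (w - z) < r ->
  exists s, 0 < s /\ forall v, Cmod (v - w) < s -> Cmod (v - z) < r.
Proof.
intros Hw; exists (r - Cmod (w - z)); split; [lra|]; intros v Hv.
replace (v - z)%C with ((v - w) + (w - z))%C by ring.
eapply Rle_lt_trans; [apply Cmod_triangle | lra].
Qed.

Lemma partial_x_sigma (w : C) : Cmod (w - z) < r ->
  partial_x (Defs.sigma h g) w = 2 * Re (sigma1 eta eta1 k k1 w).
Proof.
intros Hw; destruct (ball_nested w Hw) as (s & Hs & Hin).
eapply partial_x_eq; [exact Hs | intros v Hv; apply sigma_local, Hin, Hv |].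
assert (D := is_derive_sigma (fun t => (t, Im w)) (Re w) 1).
cbv beta in D; change (Re w, Im w) with (fst w, snd w) in D; rewrite <- surjective_pairing in D.
evar_last; [apply D; [assumption | apply cderiv_horizontal]|].
do 2 f_equal; ring.
Qed.

Lemma partial_y_sigma (w : C) : Cmod (w - z) < r ->
  partial_y (Defs.sigma h g) w = - 2 * Im (sigma1 eta eta1 k k1 w).
Proof.
intros Hw; destruct (ball_nested w Hw) as (s & Hs & Hin).
eapply partial_y_eq; [exact Hs | intros v Hv; apply sigma_local, Hin, Hv |].
assert (D := is_derive_sigma (fun t => (Re w, t)) (Im w) Ci).
cbv beta in D; change (Re w, Im w) with (fst w, snd w) in D; rewrite <- surjective_pairing in D.
evar_last; [apply D; [assumption | apply cderiv_vertical]|].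
unfold Re, Im; simpl; ring.
Qed.

Lemma wirtinger_sigma (w : C) : Cmod (w - z) < r ->
  wirtinger (fun v => RtoC (Defs.sigma h g v)) w = sigma1 eta eta1 k k1 w.
Proof.
intros Hw; unfold wirtinger; simpl Re.
change (partial_x (fun v => Defs.sigma h g v) w) with (partial_x (Defs.sigma h g) w).
change (partial_y (fun v => Defs.sigma h g v) w) with (partial_y (Defs.sigma h g) w).
rewrite partial_x_sigma, partial_y_sigma by assumption.
assert (E1 : partial_x (fun v => Im (RtoC (Defs.sigma h g v))) w = 0).
{ unfold partial_x; simpl; apply Derive_const. }
assert (E2 : partial_y (fun v => Im (RtoC (Defs.sigma h g v))) w = 0).
{ unfold partial_y; simpl; apply Derive_const. }
rewrite E1, E2; set (s := sigma1 eta eta1 k k1 w).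
assert (E : (((2 * Re s)%R, 0) - Ci * ((-2 * Im s)%R, 0) = 2 * s)%C)
  by (apply C_ext; unfold Re, Im; simpl; ring).
rewrite E; field; intros E'; apply RtoC_inj in E'; lra.
Qed.

Lemma cderiv_sigma1_horizontal : cderiv (fun t => sigma1 eta eta1 k k1 (t, Im z)) (Re z)
  (sigma2 eta eta1 eta2 k k1 k2 z + sigma11 k k1 z).
Proof.
assert (D := cderiv_sigma1 (fun t => (t, Im z)) (Re z) 1).
cbv beta in D; change (Re z, Im z) with (fst z, snd z) in D; rewrite <- surjective_pairing in D.
eapply gderiv_eq; [|apply D; [apply ball_self | apply cderiv_horizontal]].
apply C_ext; unfold Re, Im; simpl; ring.
Qed.

Lemma cderiv_sigma1_vertical : cderiv (fun t => sigma1 eta eta1 k k1 (Re z, t)) (Im z)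
  (Ci * (sigma2 eta eta1 eta2 k k1 k2 z - sigma11 k k1 z)).
Proof.
assert (D := cderiv_sigma1 (fun t => (Re z, t)) (Im z) Ci).
cbv beta in D; change (Re z, Im z) with (fst z, snd z) in D; rewrite <- surjective_pairing in D.
eapply gderiv_eq; [|apply D; [apply ball_self | apply cderiv_vertical]].
apply C_ext; unfold Re, Im; simpl; ring.
Qed.

Lemma schwarzian_local :
  schwarzian h g z
  = (2 * (sigma2 eta eta1 eta2 k k1 k2 z - sigma1 eta eta1 k k1 z ^ 2))%C.
Proof.
unfold schwarzian; cbv zeta.
rewrite (wirtinger_eq _ _ z _ _ r Hr wirtinger_sigma
           cderiv_sigma1_horizontal cderiv_sigma1_vertical).
rewrite (wirtinger_sigma z ball_self).
assert (E : (Ci * Ci = -1)%C) by (apply C_ext; unfold Re, Im; simpl; ring).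
transitivity (2 * ((sigma2 eta eta1 eta2 k k1 k2 z + sigma11 k k1 z
   - Ci * Ci * (sigma2 eta eta1 eta2 k k1 k2 z - sigma11 k k1 z)) / 2
   - sigma1 eta eta1 k k1 z ^ 2))%C; [f_equal; f_equal; f_equal; ring|].
rewrite E; field; intros E'; apply RtoC_inj in E'; lra.
Qed.

Lemma laplacian_sigma_local : laplacian (Defs.sigma h g) z = 4 * sigma11 k k1 z.
Proof.
unfold laplacian.
rewrite (partial_x_eq _ _ z r (2 * Re (sigma2 eta eta1 eta2 k k1 k2 z + sigma11 k k1 z))
           Hr partial_x_sigma).
2: { apply is_derive_scal, cderiv_re, cderiv_sigma1_horizontal. }
rewrite (partial_y_eq _ _ z r
           (-2 * Im (Ci * (sigma2 eta eta1 eta2 k k1 k2 z - sigma11 k k1 z)))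
           Hr partial_y_sigma).
2: { apply is_derive_scal, cderiv_im, cderiv_sigma1_vertical. }
unfold Re, Im; simpl; ring.
Qed.

Lemma sigma11_ge_0 (w : C) : 0 <= sigma11 k k1 w.
Proof.
assert (P := pow2_ge_0 (Cmod (k w))).
apply Rdiv_le_0_compat; [apply pow2_ge_0 | apply pow_lt; lra].
Qed.

(** The conformal factor cancels: [e^(2 sigma) |K|] is the Laplacian of [sigma], which is
    nonnegative. *)
Lemma curvature_local :
  exp (2 * Defs.sigma h g z) * Rabs (gauss_curvature h g z) = 4 * sigma11 k k1 z.
Proof.
unfold gauss_curvature; rewrite laplacian_sigma_local, Rabs_mult, Rabs_Ropp.
assert (P := sigma11_ge_0 z).
rewrite (Rabs_pos_eq (4 * _)), Rabs_pos_eq by (try apply Rlt_le, exp_pos; lra).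
rewrite <- Rmult_assoc, <- exp_plus.
replace (2 * Defs.sigma h g z + - (2 * Defs.sigma h g z)) with 0 by ring.
rewrite exp_0; ring.
Qed.
End Sigma.

(** * Derivatives of the lift along a curve *)

Definition ccont (f : C -> C) (z : C) : Prop :=
  forall eps, 0 < eps -> exists d, 0 < d /\ forall w, Cmod (w - z) < d -> Cmod (f w - f z) < eps.

(** Joint continuity of the differentiated integrand is what differentiation under the integral sign
    requires. *)
Definition ccont2 (f : R -> R -> C) (x y : R) : Prop :=
  forall eps, 0 < eps -> exists d, 0 < d /\
    forall u v, Rabs (u - x) < d -> Rabs (v - y) < d -> Cmod (f u v - f x y) < eps.

Lemma ccont2_comp (F : C -> C) (f : R -> R -> C) (x y : R) :
  ccont F (f x y) -> ccont2 f x y -> ccont2 (fun u v => F (f u v)) x y.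
Proof.
intros HF Hf eps He; destruct (HF eps He) as (d & Hd & H).
destruct (Hf d Hd) as (d' & Hd' & H'); exists d'; split; auto.
Qed.

Lemma ccont2_plus (f g : R -> R -> C) (x y : R) :
  ccont2 f x y -> ccont2 g x y -> ccont2 (fun u v => f u v + g u v)%C x y.
Proof.
intros Hf Hg eps He.
destruct (Hf (eps / 2)) as (d & Hd & H); [lra|].
destruct (Hg (eps / 2)) as (d' & Hd' & H'); [lra|].
exists (Rmin d d'); split; [now apply Rmin_pos|]; intros u v Hu Hv.
assert (A := H u v (Rlt_le_trans _ _ _ Hu (Rmin_l _ _)) (Rlt_le_trans _ _ _ Hv (Rmin_l _ _))).
assert (B := H' u v (Rlt_le_trans _ _ _ Hu (Rmin_r _ _)) (Rlt_le_trans _ _ _ Hv (Rmin_r _ _))).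
replace (f u v + g u v - (f x y + g x y))%C with ((f u v - f x y) + (g u v - g x y))%C by ring.
eapply Rle_lt_trans; [apply Cmod_triangle | lra].
Qed.

Lemma ccont2_mult (f g : R -> R -> C) (x y : R) :
  ccont2 f x y -> ccont2 g x y -> ccont2 (fun u v => f u v * g u v)%C x y.
Proof.
intros Hf Hg eps He.
set (M := 1 + Cmod (f x y) + Cmod (g x y)).
assert (Pf := Cmod_ge_0 (f x y)); assert (Pg := Cmod_ge_0 (g x y)).
assert (HM : 1 <= M) by (unfold M; lra).
set (e := Rmin 1 (eps / 2 / M)).
assert (Hee : 0 < e).
{ apply Rmin_pos; [lra|]; repeat apply Rdiv_lt_0_compat; lra. }
assert (He1 : e <= 1) by apply Rmin_l.
assert (He2 : e * M <= eps / 2).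
{ replace (eps / 2) with (eps / 2 / M * M) by (field; lra).
  apply Rmult_le_compat_r; [lra | apply Rmin_r]. }
destruct (Hf e) as (d & Hd & H); [assumption|].
destruct (Hg e) as (d' & Hd' & H'); [assumption|].
exists (Rmin d d'); split; [now apply Rmin_pos|]; intros u v Hu Hv.
assert (A := H u v (Rlt_le_trans _ _ _ Hu (Rmin_l _ _)) (Rlt_le_trans _ _ _ Hv (Rmin_l _ _))).
assert (B := H' u v (Rlt_le_trans _ _ _ Hu (Rmin_r _ _)) (Rlt_le_trans _ _ _ Hv (Rmin_r _ _))).
replace (f u v * g u v - f x y * g x y)%C
  with ((f u v - f x y) * (g u v - g x y) + (f u v - f x y) * g x y
        + f x y * (g u v - g x y))%C by ring.
eapply Rle_lt_trans; [apply Cmod_triangle|].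
eapply Rle_lt_trans; [apply Rplus_le_compat_r, Cmod_triangle|].
rewrite !Cmod_mult.
assert (Pa := Cmod_ge_0 (f u v - f x y)); assert (Pb := Cmod_ge_0 (g u v - g x y)).
set (a := Cmod (f u v - f x y)) in *; set (b := Cmod (g u v - g x y)) in *.
assert (a * b <= e * 1) by (apply Rmult_le_compat; lra).
assert (a * Cmod (g x y) <= e * Cmod (g x y)) by (apply Rmult_le_compat_r; lra).
assert (Cmod (f x y) * b <= Cmod (f x y) * e) by (apply Rmult_le_compat_l; lra).
unfold M in He2; nra.
Qed.

Lemma ccont2_fst (f : R -> C) (x y : R) (l : C) : cderiv f x l -> ccont2 (fun u _ => f u) x y.
Proof.
intros H eps He; destruct (gderiv_cont RtoC f x l H eps He) as (d & Hd & H').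
exists d; split; [assumption|]; intros u v Hu _; apply H'.
now rewrite <- RtoC_minus, Cmod_R.
Qed.

Lemma ccont2_snd (x y : R) : ccont2 (fun _ v => RtoC v) x y.
Proof.
intros eps He; exists eps; split; [assumption|]; intros u v _ Hv.
now rewrite <- RtoC_minus, Cmod_R.
Qed.

Lemma ccont2_im (f : R -> R -> C) (x y : R) :
  ccont2 f x y -> continuity_2d_pt (fun u v => Im (f u v)) x y.
Proof.
intros H eps; destruct (H eps (cond_pos eps)) as (d & Hd & H').
exists (mkposreal d Hd); intros u v Hu Hv; simpl in Hu, Hv.
replace (Im (f u v) - Im (f x y)) with (Im (f u v - f x y)) by (unfold Im; simpl; ring).
eapply Rle_lt_trans; [apply im_le_Cmod | now apply H'].
Qed.

Lemma ccont2_im_continuous (f : R -> R -> C) (x y : R) :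
  ccont2 f x y -> continuous (fun v => Im (f x v)) y.
Proof.
intros H; apply continuity_pt_filterlim; intros eps Heps.
destruct (H eps Heps) as (d & Hd & H'); exists d; split; [assumption|].
intros v [_ Hv]; simpl in *; unfold R_dist in *.
replace (Im (f x v) - Im (f x y)) with (Im (f x v - f x y)) by (unfold Im; simpl; ring).
eapply Rle_lt_trans; [apply im_le_Cmod|]; apply H'; [|assumption].
replace (x - x) with 0 by ring; now rewrite Rabs_R0.
Qed.

Lemma cderiv_im_continuous (f : R -> C) (t : R) (l : C) :
  cderiv f t l -> continuous (fun s => Im (f s)) t.
Proof.
intros H; apply (ex_derive_continuous (fun s => Im (f s))).
exists (Im l); exact (cderiv_im _ _ _ H).
Qed.

Lemma cderiv_re_continuous (f : R -> C) (t : R) (l : C) :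
  cderiv f t l -> continuous (fun s => Re (f s)) t.
Proof.
intros H; apply (ex_derive_continuous (fun s => Re (f s))).
exists (Re l); exact (cderiv_re _ _ _ H).
Qed.

Section Primitive.
Variables (F F1 : C -> C) (z0 : C) (phi phi1 phi2 : R -> C).
Hypothesis HF : forall w, in_disk w -> hderiv F w (F1 w).
Hypothesis HF1 : forall w, in_disk w -> ccont F1 w.
Hypothesis Hz0 : in_disk z0.
Hypothesis Hphi : forall s, in_disk (phi s) /\ cderiv phi s (phi1 s) /\ cderiv phi1 s (phi2 s).

Let zeta (u v : R) : C := (z0 + v * (phi u - z0))%C.
(** The [u]-derivative of the integrand [F (zeta u v) * (phi u - z0)]. *)
Let G (u v : R) : C := ((F1 (zeta u v) * (v * (phi u - z0)) + F (zeta u v)) * phi1 u)%C.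

Lemma zeta_in_disk (u v : R) : 0 <= v <= 1 -> in_disk (zeta u v).
Proof. intros Hv; apply in_disk_segment; [assumption | apply Hphi | assumption]. Qed.

Lemma ccont2_zeta (u v : R) : ccont2 zeta u v.
Proof.
apply ccont2_plus with (f := fun _ _ => z0).
- apply (ccont2_fst (fun _ => z0) u v 0), gderiv_const.
- apply ccont2_mult with (f := fun _ w => RtoC w); [apply ccont2_snd|].
  apply (ccont2_fst (fun s => phi s - z0)%C u v (phi1 u - 0)%C).
  apply gderiv_minus; [apply Hphi | apply gderiv_const].
Qed.

Lemma zeta_near (u v : R) : 0 <= v <= 1 -> exists d, 0 < d /\
  forall s w, Rabs (s - u) < d -> Rabs (w - v) < d -> in_disk (zeta s w).
Proof.
intros Hv; destruct (in_disk_open _ (zeta_in_disk u v Hv)) as (e & He & Hin).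
destruct (ccont2_zeta u v e He) as (d & Hd & H); exists d; split; [assumption|].
intros s w Hs Hw; apply Hin, H; assumption.
Qed.

Lemma cderiv_zeta_u (u v : R) : cderiv (fun s => zeta s v) u (v * phi1 u).
Proof.
unfold zeta; eapply gderiv_eq.
2: { apply gderiv_plus; [apply gderiv_const|].
     apply (gderiv_scal RtoC (RtoC v) (fun s => phi s - z0)%C).
     apply gderiv_minus; [apply Hphi | apply gderiv_const]. }
ring.
Qed.

Lemma cderiv_zeta_v (u v : R) : cderiv (fun w => zeta u w) v (phi u - z0).
Proof.
unfold zeta; eapply gderiv_eq.
2: { apply gderiv_plus; [apply gderiv_const|].
     apply (gderiv_mult RtoC RtoC (fun _ => phi u - z0)%C).
     - apply gderiv_id.
     - apply gderiv_const. }
cbv beta; ring.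
Qed.

Lemma ccont2_integrand_deriv (u v : R) : 0 <= v <= 1 -> ccont2 G u v.
Proof.
intros Hv; assert (Hin := zeta_in_disk u v Hv).
assert (Cphi : ccont2 (fun s _ => phi s - z0)%C u v).
{ apply (ccont2_fst (fun s => phi s - z0)%C u v (phi1 u - 0)%C).
  apply gderiv_minus; [apply Hphi | apply gderiv_const]. }
apply ccont2_mult with (g := fun s _ => phi1 s).
2: { apply (ccont2_fst phi1 u v (phi2 u)), Hphi. }
apply ccont2_plus with (g := fun s w => F (zeta s w)).
- apply ccont2_mult with (f := fun s w => F1 (zeta s w)).
  + apply ccont2_comp; [now apply HF1 | apply ccont2_zeta].
  + apply ccont2_mult with (f := fun _ w => RtoC w); [apply ccont2_snd | assumption].
- apply ccont2_comp; [|apply ccont2_zeta].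
  intros eps He; exact (gderiv_cont (fun w => w) F _ _ (HF _ Hin) eps He).
Qed.

Lemma cderiv_integrand (u v : R) : in_disk (zeta u v) ->
  cderiv (fun s => F (zeta s v) * (phi s - z0))%C u (G u v).
Proof.
intros Hin; eapply gderiv_eq.
2: { apply gderiv_mult.
     - apply (gderiv_comp RtoC F (fun s => zeta s v)); [now apply HF | apply cderiv_zeta_u].
     - apply gderiv_minus; [apply Hphi | apply gderiv_const]. }
unfold G; cbv beta; ring.
Qed.

Lemma integrand_continuous (u v : R) : 0 <= v <= 1 ->
  continuous (fun w => Re (F (zeta u w) * (phi u - z0))%C) v /\
  continuous (fun w => Im (F (zeta u w) * (phi u - z0))%C) v.
Proof.
intros Hv; assert (Hin := zeta_in_disk u v Hv).
assert (D := gderiv_mult RtoC (fun w => F (zeta u w)) (fun _ => phi u - z0)%C v _ _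
  (gderiv_comp RtoC F (fun w => zeta u w) v _ _ (HF _ Hin) (cderiv_zeta_v u v))
  (gderiv_const RtoC (phi u - z0)%C v)).
split; [eapply cderiv_re_continuous, D | eapply cderiv_im_continuous, D].
Qed.

Lemma im_segment_integral (u : R) :
  Im (segment_integral F z0 (phi u))
  = RInt (fun v => Im (F (zeta u v) * (phi u - z0))%C) 0 1.
Proof.
assert (E1 : ex_RInt (fun v => Re (F (zeta u v) * (phi u - z0))%C) 0 1).
{ apply (@ex_RInt_continuous R_CompleteNormedModule); intros v Hv.
  rewrite Rmin_left, Rmax_right in Hv by lra; exact (proj1 (integrand_continuous u v Hv)). }
assert (E2 : ex_RInt (fun v => Im (F (zeta u v) * (phi u - z0))%C) 0 1).
{ apply (@ex_RInt_continuous R_CompleteNormedModule); intros v Hv.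
  rewrite Rmin_left, Rmax_right in Hv by lra; exact (proj2 (integrand_continuous u v Hv)). }
unfold segment_integral.
rewrite (@is_RInt_unique C_R_CompleteNormedModule _ _ _
  (RInt (fun v => Re (F (zeta u v) * (phi u - z0))%C) 0 1,
   RInt (fun v => Im (F (zeta u v) * (phi u - z0))%C) 0 1)); [reflexivity|].
apply (@is_RInt_fct_extend_pair R_NormedModule R_NormedModule);
  apply (@RInt_correct R_CompleteNormedModule); assumption.
Qed.

(* Differentiation under the integral sign: since [F] is holomorphic, the integrand of the
   derivative is itself the derivative of [v |-> v * F (z0 + v * (phi t - z0)) * phi' t]. *)
Lemma is_derive_im_segment_integral (t : R) :
  is_derive (fun s => Im (segment_integral F z0 (phi s))) t (Im (F (phi t) * phi1 t)%C).
Proof.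
apply is_derive_ext with (fun s => RInt (fun v => Im (F (zeta s v) * (phi s - z0))%C) 0 1).
{ intros s; symmetry; apply im_segment_integral. }
assert (D : forall u v, in_disk (zeta u v) ->
   is_derive (fun s => Im (F (zeta s v) * (phi s - z0))%C) u (Im (G u v))).
{ intros u v Hin; now apply cderiv_im, cderiv_integrand. }
evar_last.
{ apply (is_derive_RInt_param (fun s v => Im (F (zeta s v) * (phi s - z0))%C)).
  - apply filter_forall; intros u v Hv; rewrite Rmin_left, Rmax_right in Hv by lra.
    eexists; apply D; now apply zeta_in_disk.
  - intros v Hv; rewrite Rmin_left, Rmax_right in Hv by lra.
    destruct (zeta_near t v Hv) as (d & Hd & Hin).
    eapply continuity_2d_pt_ext_loc, ccont2_im, (ccont2_integrand_deriv t v Hv).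
    exists (mkposreal d Hd); intros u w Hu Hw; symmetry.
    apply is_derive_unique, D, Hin; assumption.
  - apply filter_forall; intros u.
    apply (@ex_RInt_continuous R_CompleteNormedModule); intros v Hv.
  rewrite Rmin_left, Rmax_right in Hv by lra; exact (proj2 (integrand_continuous u v Hv)). }
set (H := fun v : R => (v * F (zeta t v) * phi1 t)%C).
rewrite (RInt_ext _ (fun v => Im (G t v))).
2: { intros v Hv; rewrite Rmin_left, Rmax_right in Hv by lra.
     apply is_derive_unique, D, zeta_in_disk; lra. }
apply (@is_RInt_unique R_CompleteNormedModule).
replace (Im (F (phi t) * phi1 t)) with (minus (Im (H 1)) (Im (H 0))).
2: { unfold H, zeta, minus, plus, opp; simpl.
     replace (z0 + 1 * (phi t - z0))%C with (phi t) by ring.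
     unfold Im; simpl; ring. }
apply (is_RInt_derive (fun v => Im (H v))).
- intros v Hv; rewrite Rmin_left, Rmax_right in Hv by lra.
  apply cderiv_im; unfold H.
  eapply gderiv_eq.
  2: { apply gderiv_mult; [apply gderiv_mult; [apply gderiv_id|] | apply gderiv_const].
       apply (gderiv_comp RtoC F (fun w => zeta t w)); [apply HF, zeta_in_disk, Hv|].
       apply cderiv_zeta_v. }
  unfold G; cbv beta; ring.
- intros v Hv; rewrite Rmin_left, Rmax_right in Hv by lra.
  apply (ccont2_im_continuous G), ccont2_integrand_deriv, Hv.
Qed.
End Primitive.

(** In either local representation [h' q = eta k], so each pole of [q] is cancelled by the zero of
    [h'], even pointwise. *)
Lemma dilatation_product_holomorphic (h g q : C -> C) (z : C) :
  liftable_harmonic_map h g q -> in_disk z ->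
  let F := fun w => (C_derive h w * q w)%C in
  hderiv F z (C_derive F z) /\ ccont (C_derive F) z.
Proof.
intros HL Hz F.
destruct (local_rep_exists h g q z HL Hz)
  as (r & swap & eta & eta1 & eta2 & k & k1 & k2 & Hr & He & Hk & H).
assert (D : forall w, Cmod (w - z) < r -> hderiv F w (eta1 w * k w + eta w * k1 w)).
{ intros w Hw; destruct (ball_nested z r w Hw) as (s & Hs & Hin).
  eapply gderiv_ext_loc with (fun v => eta v * k v)%C.
  - exists s; split; [assumption|]; intros v Hv.
    destruct (H v (Hin v Hv)) as (_ & _ & _ & _ & E); exact (eq_sym E).
  - destruct (H w Hw) as (_ & _ & _ & _ & E); exact (eq_sym E).
  - apply gderiv_mult; [now apply He | now apply Hk]. }
assert (E : forall w, Cmod (w - z) < r -> C_derive F w = (eta1 w * k w + eta w * k1 w)%C).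
{ intros w Hw; now apply hderiv_C_derive, D. }
assert (Hzz : Cmod (z - z) < r) by now rewrite Cmod_self.
split.
{ rewrite E by assumption; now apply D. }
assert (K : hderiv (fun w => eta1 w * k w + eta w * k1 w)%C z
  ((eta2 z * k z + eta1 z * k1 z) + (eta1 z * k1 z + eta z * k2 z))%C).
{ apply gderiv_plus; apply gderiv_mult; first [now apply He | now apply Hk]. }
intros eps Heps.
destruct (gderiv_cont _ _ _ _ K eps Heps) as (d & Hd & Hc).
exists (Rmin d r); split; [now apply Rmin_pos|]; intros w Hw.
rewrite !E by (try assumption; exact (Rlt_le_trans _ _ _ Hw (Rmin_r _ _))).
apply Hc; exact (Rlt_le_trans _ _ _ Hw (Rmin_l _ _)).
Qed.

Section Lift.
Variables (h g q : C -> C) (z0 : C) (phi phi1 phi2 : R -> C).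
Hypothesis HL : liftable_harmonic_map h g q.
Hypothesis Hz0 : in_disk z0.
Hypothesis Hphi : forall s, in_disk (phi s) /\ cderiv phi s (phi1 s) /\ cderiv phi1 s (phi2 s).

Lemma is_derive_lift_1 (t : R) : is_derive (fun s => fst (fst (lift h g q z0 (phi s)))) t
  (Re ((C_derive h (phi t) + C_derive g (phi t)) * phi1 t)%C).
Proof.
destruct (Hphi t) as (Hin & D & _), HL as (Hh & Hg & _).
destruct (analytic_derive h _ (Hh _ Hin)) as (r & Hr & _ & Dh).
destruct (analytic_derive g _ (Hg _ Hin)) as (s & Hs & _ & Dg).
assert (Kh := gderiv_comp RtoC h phi t _ _ (Dh _ ltac:(now rewrite Cmod_self)) D).
assert (Kg := gderiv_comp RtoC g phi t _ _ (Dg _ ltac:(now rewrite Cmod_self)) D).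
assert (K := cderiv_re _ _ _ (gderiv_plus RtoC _ _ _ _ _ Kh (cderiv_conj _ _ _ Kg))).
evar_last; [exact K | unfold Re; simpl; ring].
Qed.

Lemma is_derive_lift_2 (t : R) : is_derive (fun s => snd (fst (lift h g q z0 (phi s)))) t
  (Im ((C_derive h (phi t) - C_derive g (phi t)) * phi1 t)%C).
Proof.
destruct (Hphi t) as (Hin & D & _), HL as (Hh & Hg & _).
destruct (analytic_derive h _ (Hh _ Hin)) as (r & Hr & _ & Dh).
destruct (analytic_derive g _ (Hg _ Hin)) as (s & Hs & _ & Dg).
assert (Kh := gderiv_comp RtoC h phi t _ _ (Dh _ ltac:(now rewrite Cmod_self)) D).
assert (Kg := gderiv_comp RtoC g phi t _ _ (Dg _ ltac:(now rewrite Cmod_self)) D).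
assert (K := cderiv_im _ _ _ (gderiv_plus RtoC _ _ _ _ _ Kh (cderiv_conj _ _ _ Kg))).
evar_last; [exact K | unfold Im; simpl; ring].
Qed.

Lemma is_derive_lift_3 (t : R) : is_derive (fun s => snd (lift h g q z0 (phi s))) t
  (2 * Im (C_derive h (phi t) * q (phi t) * phi1 t)%C).
Proof.
apply is_derive_scal.
set (F := fun w => (C_derive h w * q w)%C).
apply (is_derive_im_segment_integral F (C_derive F) z0 phi phi1 phi2); try assumption;
  intros w Hw; now apply (dilatation_product_holomorphic h g q w HL Hw).
Qed.
End Lift.

(** * The comparison argument *)

(* [x, y, z] are the coordinates of a vector of squared length [n] in an orthonormal frame. *)
Lemma frame_inequality (n v x y z s1 s2 r : R) : 0 < n -> 0 < v -> x ^ 2 + y ^ 2 + z ^ 2 = n ->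
  2 * (v ^ 2 + s1 * v * x - s2 * v * y + r * z) / n - (2 * v * x) ^ 2 / n ^ 2
    + / 2 * (2 * v * x / n - s1) ^ 2
  >= / 2 * s1 ^ 2 - / 2 * s2 ^ 2 - r ^ 2 / (2 * v ^ 2).
Proof.
intros Hn Hv E.
assert (H1 := pow2_ge_0 (v * y / n - s2 / 2)).
assert (H2 := pow2_ge_0 (v * z / n + r / (2 * v))).
assert (K : 2 * (v ^ 2 + s1 * v * x - s2 * v * y + r * z) / n - (2 * v * x) ^ 2 / n ^ 2
    + / 2 * (2 * v * x / n - s1) ^ 2 - (/ 2 * s1 ^ 2 - / 2 * s2 ^ 2 - r ^ 2 / (2 * v ^ 2))
  = 2 * (v * y / n - s2 / 2) ^ 2 + 2 * (v * z / n + r / (2 * v)) ^ 2).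
{ rewrite <- E; field; rewrite E; lra. }
lra.
Qed.

Section Frame.
Variables (theta k : C).

(* The tangent frame of the Weierstrass representation: [frame_re + i frame_im] is the null vector
   [theta (1 + k^2, - i (1 - k^2), - 2 i k)], and [(- 2 Im k, - 2 Re k, 1 - |k|^2)] is normal to it. *)
Definition frame_re1 : R := Re (theta * (1 + k ^ 2)).
Definition frame_re2 : R := Im (theta * (1 - k ^ 2)).
Definition frame_re3 : R := 2 * Im (theta * k).
Definition frame_im1 : R := Im (theta * (1 + k ^ 2)).
Definition frame_im2 : R := - Re (theta * (1 - k ^ 2)).
Definition frame_im3 : R := - (2 * Re (theta * k)).

Lemma frame_norm :
  frame_re1 ^ 2 + frame_re2 ^ 2 + frame_re3 ^ 2 = (Cmod theta * (1 + Cmod k ^ 2)) ^ 2.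
Proof.
rewrite Rpow_mult_distr, !Cmod2_alt.
unfold frame_re1, frame_re2, frame_re3; unfold Re, Im; simpl; ring.
Qed.

(** The two tangent vectors have length [|theta| (1 + |k|^2)] and the normal one has length
    [1 + |k|^2]; together they are orthogonal, and the factor [|theta|^2] makes up for the different
    lengths. *)
Lemma frame_parseval (a1 a2 a3 : R) :
  (Cmod theta * (1 + Cmod k ^ 2)) ^ 2 * (a1 ^ 2 + a2 ^ 2 + a3 ^ 2) =
  (a1 * frame_re1 + a2 * frame_re2 + a3 * frame_re3) ^ 2
  + (a1 * frame_im1 + a2 * frame_im2 + a3 * frame_im3) ^ 2
  + Cmod theta ^ 2 * (a1 * (-2 * Im k) + a2 * (-2 * Re k) + a3 * (1 - Cmod k ^ 2)) ^ 2.
Proof.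
rewrite Rpow_mult_distr, !Cmod2_alt.
unfold frame_re1, frame_re2, frame_re3, frame_im1, frame_im2, frame_im3.
unfold Re, Im; simpl; ring.
Qed.
End Frame.

(* [kappa] and [theta * (s - 2 * kappa * conj k / (1 + |k|^2))] are the derivatives of [k]
   and [theta] along the curve. *)
Lemma second_derivative_inequality (a1 a2 a3 : R) (theta k kappa s theta' : C) :
  theta <> 0%C -> 0 < a1 ^ 2 + a2 ^ 2 + a3 ^ 2 ->
  theta' = (theta * (s - 2 * kappa * Cconj k / (1 + k * Cconj k)))%C ->
  let n := a1 ^ 2 + a2 ^ 2 + a3 ^ 2 in
  let n1 := 2 * (a1 * frame_re1 theta k + a2 * frame_re2 theta k + a3 * frame_re3 theta k) in
  let n2 := 2 * (frame_re1 theta k ^ 2 + frame_re2 theta k ^ 2 + frame_re3 theta k ^ 2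
    + a1 * Re (theta' * (1 + k ^ 2) + theta * (2 * k * kappa))
    + a2 * Im (theta' * (1 - k ^ 2) - theta * (2 * k * kappa))
    + a3 * (2 * Im (theta' * k + theta * kappa))) in
  n2 / n - n1 ^ 2 / n ^ 2 + / 2 * (n1 / n - Re s) ^ 2
  >= / 2 * Re s ^ 2 - / 2 * Im s ^ 2 - 2 * (Cmod kappa ^ 2 / (1 + Cmod k ^ 2) ^ 2).
Proof.
intros Hth Hn Et n n1 n2.
set (e := 1 + Cmod k ^ 2).
assert (He : 0 < e) by (unfold e; assert (P := pow2_ge_0 (Cmod k)); lra).
assert (Ht : 0 < Cmod theta) by now apply Cmod_gt_0.
set (v := Cmod theta * e).
assert (Hv : 0 < v) by now apply Rmult_lt_0_compat.
set (r := 2 * Im (theta * kappa)).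
assert (Ee : (1 + k * Cconj k)%C = RtoC e) by (unfold e; now rewrite Cmod_sqr_C, RtoC_plus).
assert (Ne : RtoC e <> 0%C) by (intros E; apply RtoC_inj in E; lra).
(* [W1], [W2], [W3] are the coordinates of one vector identity: the derivative of the null vector is
   [s] times itself plus [- 2 i theta kappa] times the unit normal. Hence [r = 2 Im (theta kappa)]
   is the normal component of the acceleration. *)
assert (W1 : (theta' * (1 + k ^ 2) + theta * (2 * k * kappa)
   = s * (theta * (1 + k ^ 2)) + (-2) * Ci * theta * kappa * RtoC (-2 * Im k / e))%C).
{ transitivity (s * (theta * (1 + k ^ 2)) + theta * kappa * (2 * (k - Cconj k) / RtoC e))%C.
  - rewrite Et, <- Ee; field; apply one_plus_sqr_neq_0.
  - rewrite im_alt', RtoC_div, RtoC_mult by lra; field; assumption. }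
assert (K2 : (k + Cconj k = 2 * Re k)%C) by (apply C_ext; unfold Re, Im; simpl; ring).
assert (W2 : (theta' * (1 - k ^ 2) - theta * (2 * k * kappa)
   = s * (theta * (1 - k ^ 2)) + 2 * theta * kappa * RtoC (-2 * Re k / e))%C).
{ transitivity (s * (theta * (1 - k ^ 2)) - theta * kappa * (2 * (k + Cconj k) / RtoC e))%C.
  - rewrite Et, <- Ee; field; apply one_plus_sqr_neq_0.
  - rewrite K2, RtoC_div, RtoC_mult by lra; field; assumption. }
assert (W3 : (theta' * k + theta * kappa
   = s * (theta * k) + theta * kappa * RtoC ((1 - Cmod k ^ 2) / e))%C).
{ rewrite Et, RtoC_div, RtoC_minus, <- Cmod_sqr_C, <- Ee by lra; field.
  apply one_plus_sqr_neq_0. }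
assert (En2 : n2 = 2 * (v ^ 2
   + Re s * (a1 * frame_re1 theta k + a2 * frame_re2 theta k + a3 * frame_re3 theta k)
   - Im s * (a1 * frame_im1 theta k + a2 * frame_im2 theta k + a3 * frame_im3 theta k)
   + r * ((a1 * (-2 * Im k) + a2 * (-2 * Re k) + a3 * (1 - Cmod k ^ 2)) / e))).
{ unfold n2; rewrite frame_norm; fold e; fold v; rewrite W1, W2, W3.
  unfold r, frame_re1, frame_re2, frame_re3, frame_im1, frame_im2, frame_im3.
  unfold Rdiv; generalize (/ e); intros ie; unfold Re, Im; simpl; ring. }
set (x := (a1 * frame_re1 theta k + a2 * frame_re2 theta k + a3 * frame_re3 theta k) / v).
set (y := (a1 * frame_im1 theta k + a2 * frame_im2 theta k + a3 * frame_im3 theta k) / v).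
set (z := (a1 * (-2 * Im k) + a2 * (-2 * Re k) + a3 * (1 - Cmod k ^ 2)) / e).
assert (En : x ^ 2 + y ^ 2 + z ^ 2 = n).
{ assert (P := frame_parseval theta k a1 a2 a3); fold e in P; fold v in P.
  apply Rmult_eq_reg_l with (v ^ 2); [|apply Rgt_not_eq, pow_lt; assumption].
  unfold n; rewrite P; unfold x, y, z.
  replace (Cmod theta) with (v / e) by (unfold v; field; lra).
  field; lra. }
assert (F := frame_inequality n v x y z (Re s) (Im s) r Hn Hv En).
assert (En1 : n1 = 2 * v * x) by (unfold n1, x; field; lra).
assert (En2' : n2 = 2 * (v ^ 2 + Re s * v * x - Im s * v * y + r * z)).
{ rewrite En2; unfold x, y; fold z; field; lra. }
rewrite En1, En2'.
(* The normal curvature in any direction is at most [sqrt |K|]: here this is [|Im| <= Cmod]. *)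
assert (R2 : r ^ 2 / (2 * v ^ 2) <= 2 * (Cmod kappa ^ 2 / e ^ 2)).
{ assert (Hr : r ^ 2 <= 4 * (Cmod theta ^ 2 * Cmod kappa ^ 2)).
  { rewrite <- Rpow_mult_distr, <- Cmod_mult, Cmod2_alt; unfold r.
    assert (P := pow2_ge_0 (Re (theta * kappa))); lra. }
  apply Rle_trans with (4 * (Cmod theta ^ 2 * Cmod kappa ^ 2) / (2 * v ^ 2)).
  - apply Rmult_le_compat_r; [|assumption].
    apply Rlt_le, Rinv_0_lt_compat, Rmult_lt_0_compat; [lra | now apply pow_lt].
  - right; unfold v; field; lra. }
lra.
Qed.

Lemma second_derivative_test (f f1 : R -> R) (t l d : R) :
  0 < d -> (forall s, Rabs (s - t) < d -> is_derive f s (f1 s)) ->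
  is_derive f1 t l -> (forall s, Rabs (s - t) < d -> f s <= f t) ->
  f1 t = 0 /\ l <= 0.
Proof.
intros Hd Hf Hf1 Hmax.
assert (Ht : Rabs (t - t) < d) by (replace (t - t) with 0 by ring; now rewrite Rabs_R0).
assert (Z : f1 t = 0).
{ assert (D := Hf t Ht); apply is_derive_Reals in D.
  apply (deriv_maximum f (t - d) (t + d) t (exist _ (f1 t) D)); try lra.
  intros x Hx1 Hx2; apply Hmax; apply Rabs_def1; lra. }
split; [assumption|].
destruct (Rle_or_lt l 0) as [|Hl]; [assumption|exfalso].
destruct (proj1 (is_derive_eps f1 t l) Hf1 (l / 2)) as (e & He & H); [lra|].
set (s := t + Rmin d e / 2).
assert (Hm : 0 < Rmin d e) by now apply Rmin_pos.
assert (Hm1 := Rmin_l d e); assert (Hm2 := Rmin_r d e).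
destruct (MVT_cor2 f f1 t s) as (c & E & Hc); [unfold s; lra | |].
{ intros x Hx; apply is_derive_Reals, Hf, Rabs_def1; unfold s in Hx; lra. }
assert (M : f s <= f t) by (apply Hmax, Rabs_def1; unfold s; lra).
assert (K : Rabs (c - t) < e) by (apply Rabs_def1; unfold s in Hc; lra).
specialize (H c K); rewrite Z, Rminus_0_r, (Rabs_pos_eq (c - t)) in H by lra.
apply Rabs_le_between in H.
assert (0 < l / 2 * (c - t)) by (apply Rmult_lt_0_compat; lra).
assert (0 < f1 c) by lra.
assert (0 < f1 c * (s - t)) by (apply Rmult_lt_0_compat; unfold s; lra).
lra.
Qed.

Section Comparison.
Variables (h g q : C -> C) (z0 : C) (phi phi1 p : R -> C) (L delta : R).
Hypothesis HL : liftable_harmonic_map h g q.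
Hypothesis Hz0 : in_disk z0.
Hypothesis Hphi : forall s, in_disk (phi s) /\ cderiv phi s (phi1 s) /\
  cderiv phi1 s (phi1 s * p s)%C.
Hypothesis Hphi1 : forall s, phi1 s <> 0%C.
(* [p = phi'' / phi'], so this says that [phi] has Schwarzian derivative [- 2], as [tanh] has. *)
Hypothesis Hp : forall s, cderiv p s (p s ^ 2 / 2 - 2).
Hypothesis HLpos : 0 < L.
Hypothesis Hdelta : 0 <= delta.
Hypothesis Hbound : forall s, 0 <= s <= L ->
  (Cmod (schwarzian h g (phi s))
   + exp (2 * Defs.sigma h g (phi s)) * Rabs (gauss_curvature h g (phi s)))
  * Cmod (phi1 s) ^ 2 <= 2 * (1 + delta ^ 2).

Let X1 (s : R) : R := fst (fst (lift h g q z0 (phi s))).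
Let X2 (s : R) : R := snd (fst (lift h g q z0 (phi s))).
Let X3 (s : R) : R := snd (lift h g q z0 (phi s)).
Let N0 (s : R) : R := (X1 s - X1 0) ^ 2 + (X2 s - X2 0) ^ 2 + (X3 s - X3 0) ^ 2.

Section Local.
Variables (t r : R) (swap : bool) (eta eta1 eta2 k k1 k2 : C -> C).
Hypothesis Hr : 0 < r.
Hypothesis Rep : local_rep h g q (phi t) r swap eta eta1 eta2 k k1 k2.

Let theta (s : R) : C := (eta (phi s) * phi1 s)%C.
Let kk (s : R) : C := k (phi s).
Let kappa (s : R) : C := (k1 (phi s) * phi1 s)%C.
(** The real part is the logarithmic derivative of the speed of the lifted curve, the imaginary part
    carries its curvature inside the surface. *)
Let vs (s : R) : C := (2 * (sigma1 eta eta1 k k1 (phi s) * phi1 s) + p s)%C.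
Let theta1 (s : R) : C :=
  (theta s * (vs s - 2 * kappa s * Cconj (kk s) / (1 + kk s * Cconj (kk s))))%C.
(* Exchanging [h] and [g] reflects the surface in the second coordinate. *)
Let sg : R := if swap then -1 else 1.

Let near (s : R) : Prop := Cmod (phi s - phi t) < r.

Lemma near_self : near t.
Proof. unfold near; now rewrite Cmod_self. Qed.

Lemma near_open : exists d, 0 < d /\ forall s, Rabs (s - t) < d -> near s.
Proof.
destruct (Hphi t) as (_ & D & _).
destruct (gderiv_cont RtoC phi t _ D r Hr) as (d & Hd & H).
exists d; split; [assumption|]; intros s Hs; apply H.
now rewrite <- RtoC_minus, Cmod_R.
Qed.

Lemma cderiv_theta (s : R) : near s -> cderiv theta s (theta1 s).
Proof.
intros Hs; destruct (Hphi s) as (_ & D & D1), Rep as (He & _ & H).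
destruct (H _ Hs) as (_ & N & _).
eapply gderiv_eq; [|apply gderiv_mult; [apply (gderiv_comp RtoC eta phi); [apply He, Hs|exact D] | exact D1]].
unfold theta1, theta, vs, kappa, kk, sigma1.
field; split; [apply one_plus_sqr_neq_0 | exact N].
Qed.

Lemma cderiv_kk (s : R) : near s -> cderiv kk s (kappa s).
Proof.
intros Hs; destruct (Hphi s) as (_ & D & _), Rep as (_ & Hk & _).
apply (gderiv_comp RtoC k phi); [apply Hk, Hs | exact D].
Qed.

Lemma theta_neq_0 (s : R) : near s -> theta s <> 0%C.
Proof. intros Hs; apply Cmult_neq_0; [apply Rep, Hs | apply Hphi1]. Qed.

Lemma is_derive_X1 (s : R) : near s -> is_derive X1 s (frame_re1 (theta s) (kk s)).
Proof.
intros Hs; destruct Rep as (_ & _ & H); destruct (H _ Hs) as (_ & _ & E1 & E2 & _).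
evar_last; [exact (is_derive_lift_1 h g q z0 phi phi1 (fun u => phi1 u * p u)%C HL Hphi s)|].
unfold frame_re1, theta, kk; f_equal; destruct swap; rewrite E1, E2; ring.
Qed.

Lemma is_derive_X2 (s : R) : near s -> is_derive X2 s (sg * frame_re2 (theta s) (kk s)).
Proof.
intros Hs; destruct Rep as (_ & _ & H); destruct (H _ Hs) as (_ & _ & E1 & E2 & _).
evar_last; [exact (is_derive_lift_2 h g q z0 phi phi1 (fun u => phi1 u * p u)%C HL Hphi s)|].
unfold frame_re2, theta, kk, sg; destruct swap; rewrite E1, E2; unfold Im; simpl; ring.
Qed.

Lemma is_derive_X3 (s : R) : near s -> is_derive X3 s (frame_re3 (theta s) (kk s)).
Proof.
intros Hs; destruct Rep as (_ & _ & H); destruct (H _ Hs) as (_ & _ & _ & _ & E3).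
evar_last; [exact (is_derive_lift_3 h g q z0 phi phi1 (fun u => phi1 u * p u)%C HL Hz0 Hphi s)|].
unfold frame_re3, theta, kk; rewrite E3; do 2 f_equal; ring.
Qed.

Lemma is_derive_sigma_phi (s : R) : near s ->
  is_derive (fun u => Defs.sigma h g (phi u)) s
    (2 * Re (sigma1 eta eta1 k k1 (phi s) * phi1 s)).
Proof.
intros Hs; destruct (Hphi s) as (_ & D & _).
destruct (ball_nested (phi t) r (phi s) Hs) as (e & He & Hin).
destruct (gderiv_cont RtoC phi s _ D e He) as (d & Hd & Hc).
eapply is_derive_ext_loc; [|exact (is_derive_sigma _ _ _ _ _ _ _ _ _ _ _ _ Rep phi s _ Hs D)].
exists (mkposreal d Hd); intros u Hu; symmetry.
apply (sigma_local _ _ _ _ _ _ _ _ _ _ _ _ Rep), Hin, Hc.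
rewrite <- RtoC_minus, Cmod_R; exact Hu.
Qed.

Let n1 (s : R) : R :=
  2 * ((X1 s - X1 0) * frame_re1 (theta s) (kk s)
       + sg * (X2 s - X2 0) * frame_re2 (theta s) (kk s)
       + (X3 s - X3 0) * frame_re3 (theta s) (kk s)).

Let n2 (s : R) : R := 2 * (frame_re1 (theta s) (kk s) ^ 2 + frame_re2 (theta s) (kk s) ^ 2
    + frame_re3 (theta s) (kk s) ^ 2
    + (X1 s - X1 0) * Re (theta1 s * (1 + kk s ^ 2) + theta s * (2 * kk s * kappa s))
    + sg * (X2 s - X2 0) * Im (theta1 s * (1 - kk s ^ 2) - theta s * (2 * kk s * kappa s))
    + (X3 s - X3 0) * (2 * Im (theta1 s * kk s + theta s * kappa s))).

Lemma sg_sqr : sg * sg = 1.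
Proof. unfold sg; destruct swap; ring. Qed.

Lemma is_derive_sub_const (f : R -> R) (s l c : R) :
  is_derive f s l -> is_derive (fun u => f u - c) s l.
Proof.
intros H; evar_last; [apply @is_derive_minus; [exact H | apply @is_derive_const]|].
unfold minus, plus, opp, zero; simpl; ring.
Qed.

Lemma is_derive_mult_R (f1 f2 : R -> R) (s l1 l2 : R) :
  is_derive f1 s l1 -> is_derive f2 s l2 ->
  is_derive (fun u => f1 u * f2 u) s (l1 * f2 s + f1 s * l2).
Proof.
intros H1 H2; apply (is_derive_mult f1 f2 s l1 l2 H1 H2).
intros; apply Rmult_comm.
Qed.

Lemma is_derive_N0 (s : R) : near s -> is_derive N0 s (n1 s).
Proof.
intros Hs.
assert (D1 := is_derive_sub_const _ _ _ (X1 0) (is_derive_X1 s Hs)).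
assert (D2 := is_derive_sub_const _ _ _ (X2 0) (is_derive_X2 s Hs)).
assert (D3 := is_derive_sub_const _ _ _ (X3 0) (is_derive_X3 s Hs)).
apply is_derive_ext with (fun u => (X1 u - X1 0) * (X1 u - X1 0)
  + (X2 u - X2 0) * (X2 u - X2 0) + (X3 u - X3 0) * (X3 u - X3 0)).
{ intros u; unfold N0; match goal with |- ?a = ?b => change (@eq R a b) end; ring. }
evar_last.
{ apply @is_derive_plus; [apply @is_derive_plus|]; apply is_derive_mult_R; eassumption. }
unfold n1, plus; simpl; ring.
Qed.

Lemma is_derive_n1 (s : R) : near s -> is_derive n1 s (n2 s).
Proof.
intros Hs.
assert (D1 := is_derive_sub_const _ _ _ (X1 0) (is_derive_X1 s Hs)).
assert (D2 := is_derive_sub_const _ _ _ (X2 0) (is_derive_X2 s Hs)).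
assert (D3 := is_derive_sub_const _ _ _ (X3 0) (is_derive_X3 s Hs)).
assert (Dt := cderiv_theta s Hs); assert (Dk := cderiv_kk s Hs).
assert (Dk2 := gderiv_mult RtoC _ _ _ _ _ Dk Dk).
assert (F1 : is_derive (fun u => frame_re1 (theta u) (kk u)) s
  (Re (theta1 s * (1 + kk s ^ 2) + theta s * (2 * kk s * kappa s)))).
{ apply (cderiv_re (fun u => theta u * (1 + kk u ^ 2))%C).
  eapply gderiv_ext with (fun u => theta u * (1 + kk u * kk u))%C; [intros; ring|].
  eapply gderiv_eq; [|apply gderiv_mult; [exact Dt | apply gderiv_plus; [apply gderiv_const | exact Dk2]]].
  cbv beta; ring. }
assert (F2 : is_derive (fun u => frame_re2 (theta u) (kk u)) s
  (Im (theta1 s * (1 - kk s ^ 2) - theta s * (2 * kk s * kappa s)))).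
{ apply (cderiv_im (fun u => theta u * (1 - kk u ^ 2))%C).
  eapply gderiv_ext with (fun u => theta u * (1 - kk u * kk u))%C; [intros; ring|].
  eapply gderiv_eq; [|apply gderiv_mult; [exact Dt | apply gderiv_minus; [apply gderiv_const | exact Dk2]]].
  cbv beta; ring. }
assert (F3 : is_derive (fun u => frame_re3 (theta u) (kk u)) s
  (2 * (Im (theta1 s * kk s + theta s * kappa s)))).
{ apply is_derive_scal, (cderiv_im (fun u => theta u * kk u)%C).
  now apply gderiv_mult. }
evar_last.
{ apply is_derive_scal, @is_derive_plus; [apply @is_derive_plus|].
  - apply is_derive_mult_R; [exact D1 | exact F1].
  - apply is_derive_mult_R; [apply is_derive_scal, D2 | exact F2].
  - apply is_derive_mult_R; [exact D3 | exact F3]. }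
unfold n2; assert (S := sg_sqr).
change plus with Rplus; cbv beta.
generalize (Re (theta1 s * (1 + kk s ^ 2) + theta s * (2 * kk s * kappa s)))
  (Im (theta1 s * (1 - kk s ^ 2) - theta s * (2 * kk s * kappa s)))
  (Im (theta1 s * kk s + theta s * kappa s)).
set (f1 := frame_re1 (theta s) (kk s)); set (f2 := frame_re2 (theta s) (kk s)).
set (f3 := frame_re3 (theta s) (kk s)); intros b1 b2 b3.
replace (f2 ^ 2) with (sg * sg * f2 ^ 2) by (rewrite S; ring).
ring.
Qed.

Lemma speed_pos (s : R) : near s ->
  0 < frame_re1 (theta s) (kk s) ^ 2 + frame_re2 (theta s) (kk s) ^ 2
      + frame_re3 (theta s) (kk s) ^ 2.
Proof.
intros Hs; rewrite frame_norm; apply pow_lt, Rmult_lt_0_compat.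
- now apply Cmod_gt_0, theta_neq_0.
- assert (P := pow2_ge_0 (Cmod (kk s))); lra.
Qed.

(** Riccati form of the composition rule for the Schwarzian. The term [- 2] is the Schwarzian of
    [phi]; the [sigma11] term appears because [sigma_z] is not holomorphic. *)
Lemma cderiv_vs : cderiv vs t
  (vs t ^ 2 / 2 + schwarzian h g (phi t) * phi1 t ^ 2
   + RtoC (2 * (sigma11 k k1 (phi t) * Cmod (phi1 t) ^ 2) - 2)).
Proof.
destruct (Hphi t) as (_ & D & D1).
eapply gderiv_eq.
2: { apply gderiv_plus; [|apply Hp]; apply gderiv_scal, gderiv_mult; [|exact D1].
     exact (cderiv_sigma1 _ _ _ _ _ _ _ _ _ _ _ _ Rep phi t _ near_self D). }
rewrite (schwarzian_local _ _ _ _ _ _ _ _ _ _ _ _ Hr Rep).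
rewrite RtoC_minus, !RtoC_mult, <- Cmod_sqr_C; unfold vs; field.
Qed.

Variable d' : R.
Hypothesis Ht : 0 < t < L.
Hypothesis HN : 0 < N0 t.
Hypothesis Hd' : delta < d'.
Hypothesis Hd'L : d' * L < PI.

Let y (s : R) : R := cos (d' * (s - L / 2)).

Lemma y_pos (s : R) : 0 <= s <= L -> 0 < y s.
Proof.
intros Hs; assert (0 < d') by lra.
apply cos_gt_0; unfold y; nra.
Qed.

(** The speed is [e^sigma |phi1|], so this is the logarithm of [|F o phi - P|^2 / (speed * y^2)] for
    [P] the starting point of the curve. *)
Let psi (s : R) : R :=
  ln (N0 s) - Defs.sigma h g (phi s) - / 2 * ln (Cmod (phi1 s) ^ 2) - 2 * ln (y s).

Let psi1 (s : R) : R :=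
  n1 s / N0 s - Re (vs s) + 2 * d' * (sin (d' * (s - L / 2)) / y s).

Lemma is_derive_psi (s : R) : near s -> 0 < N0 s -> 0 <= s <= L -> is_derive psi s (psi1 s).
Proof.
intros Hs HNs HsL; assert (Y := y_pos s HsL).
destruct (Hphi s) as (_ & D & D1).
assert (A1 := is_derive_ln_comp _ _ _ HNs (is_derive_N0 s Hs)).
assert (A2 := is_derive_sigma_phi s Hs).
assert (A3 := is_derive_ln_Cmod _ _ _ (Hphi1 s) D1).
assert (A4 : is_derive y s (- (d' * sin (d' * (s - L / 2))))).
{ unfold y; auto_derive; [trivial |]; unfold Rminus; ring. }
assert (A5 := is_derive_ln_comp y s _ Y A4).
evar_last.
{ unfold psi; apply @is_derive_minus; [apply @is_derive_minus; [apply @is_derive_minus|]|].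
  - exact A1.
  - exact A2.
  - apply is_derive_scal, A3.
  - apply is_derive_scal, A5. }
unfold psi1, vs.
replace (phi1 s * p s / phi1 s)%C with (p s) by (field; apply Hphi1).
generalize (sigma1 eta eta1 k k1 (phi s) * phi1 s)%C; intros w.
replace (Re (2 * w + p s)) with (2 * Re w + Re (p s)) by (unfold Re; simpl; ring).
unfold minus, plus, opp; simpl; field; split; lra.
Qed.

(** At a critical point the vector estimate, the Riccati equation for [vs] and the curvature bound
    give [psi'' >= 2 (d'^2 - delta^2) > 0]. Only points with [0 < N0 s] compete, since elsewhere
    [ln] returns a default value. *)
Lemma no_local_maximum (d : R) : 0 < d ->
  ~ (forall s, Rabs (s - t) < d -> 0 < N0 s -> psi s <= psi t).
Proof.
intros Hd Hmax.
destruct near_open as (e & He & Hnear).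
assert (Y := y_pos t ltac:(lra)).
assert (HN' : exists e', 0 < e' /\ forall s, Rabs (s - t) < e' -> 0 < N0 s).
{ destruct (proj1 (is_derive_eps _ _ _) (is_derive_N0 t near_self) 1 Rlt_0_1) as (e1 & He1 & H1).
  set (K := 1 + Rabs (n1 t)).
  assert (HK : 0 < K) by (unfold K; assert (P := Rabs_pos (n1 t)); lra).
  exists (Rmin e1 (N0 t / K)); split.
  { apply Rmin_pos; [assumption | now apply Rdiv_lt_0_compat]. }
  intros s Hs; specialize (H1 s (Rlt_le_trans _ _ _ Hs (Rmin_l _ _))).
  assert (H2 := Rlt_le_trans _ _ _ Hs (Rmin_r _ _)).
  assert (H3 : Rabs (s - t) * K < N0 t / K * K) by (apply Rmult_lt_compat_r; assumption).
  replace (N0 t / K * K) with (N0 t) in H3 by (field; lra).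
  apply Rabs_le_between in H1.
  assert (H4 : Rabs (n1 t * (s - t)) = Rabs (n1 t) * Rabs (s - t)) by apply Rabs_mult.
  assert (H5 := Rle_abs (- (n1 t * (s - t)))); rewrite Rabs_Ropp, H4 in H5.
  unfold K in H3; lra. }
destruct HN' as (e' & He' & HN').
set (dd := Rmin (Rmin d e) (Rmin e' (Rmin t (L - t)))).
assert (Hdd : 0 < dd) by (unfold dd; repeat apply Rmin_pos; lra).
assert (Sm : forall s, Rabs (s - t) < dd ->
  Rabs (s - t) < d /\ Rabs (s - t) < e /\ Rabs (s - t) < e' /\ 0 <= s <= L).
{ intros s Hs.
  assert (B1 := Rmin_l (Rmin d e) (Rmin e' (Rmin t (L - t)))).
  assert (B2 := Rmin_r (Rmin d e) (Rmin e' (Rmin t (L - t)))).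
  assert (B3 := Rmin_l d e); assert (B4 := Rmin_r d e).
  assert (B5 := Rmin_l e' (Rmin t (L - t))); assert (B6 := Rmin_r e' (Rmin t (L - t))).
  assert (B7 := Rmin_l t (L - t)); assert (B8 := Rmin_r t (L - t)).
  fold dd in B1, B2.
  assert (Hs' : Rabs (s - t) < t) by lra; assert (Hs2 : Rabs (s - t) < L - t) by lra.
  apply Rabs_def2 in Hs'; apply Rabs_def2 in Hs2.
  repeat split; lra. }
set (T := sin (d' * (t - L / 2)) / y t).
assert (D1 : is_derive psi1 t
  (n2 t / N0 t - n1 t ^ 2 / N0 t ^ 2
   - Re (vs t ^ 2 / 2 + schwarzian h g (phi t) * phi1 t ^ 2
         + RtoC (2 * (sigma11 k k1 (phi t) * Cmod (phi1 t) ^ 2) - 2))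
   + 2 * d' * (d' * (1 + T ^ 2)))).
{ unfold psi1; apply @is_derive_plus; [apply @is_derive_minus|].
  - evar_last.
    { apply is_derive_div; [apply is_derive_n1, near_self | apply is_derive_N0, near_self | lra]. }
    simpl; field; lra.
  - exact (cderiv_re _ _ _ cderiv_vs).
  - apply is_derive_scal; unfold T.
    unfold y in *; auto_derive; [unfold Rminus in Y; lra|].
    fold (Rminus t (L / 2)); field; lra. }
destruct (second_derivative_test psi psi1 t _ dd Hdd
  (fun s Hs => is_derive_psi s (Hnear s (proj1 (proj2 (Sm s Hs))))
     (HN' s (proj1 (proj2 (proj2 (Sm s Hs))))) (proj2 (proj2 (proj2 (Sm s Hs)))))
  D1 (fun s Hs => Hmax s (proj1 (Sm s Hs)) (HN' s (proj1 (proj2 (proj2 (Sm s Hs))))))) as [Z Hl].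
assert (A := second_derivative_inequality (X1 t - X1 0) (sg * (X2 t - X2 0)) (X3 t - X3 0)
  (theta t) (kk t) (kappa t) (vs t) (theta1 t) (theta_neq_0 t near_self)).
assert (EN : (X1 t - X1 0) ^ 2 + (sg * (X2 t - X2 0)) ^ 2 + (X3 t - X3 0) ^ 2 = N0 t).
{ unfold N0; rewrite Rpow_mult_distr; replace (sg ^ 2) with 1; [ring|].
  rewrite <- sg_sqr; ring. }
rewrite EN in A; specialize (A HN eq_refl); cbv zeta in A.
fold (n1 t) in A.
match type of A with ?a / _ - _ + _ >= _ => replace a with (n2 t) in A by reflexivity end.
assert (B := Hbound t ltac:(lra)).
rewrite (curvature_local _ _ _ _ _ _ _ _ _ _ _ _ Hr Rep) in B.
assert (ZT : 2 * d' * T = Re (vs t) - n1 t / N0 t) by (unfold psi1 in Z; fold T in Z; lra).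
(* The condition [psi' = 0] turns the square coming from [y] into exactly the square on the left of
   [second_derivative_inequality]. *)
assert (ZT2 : 2 * d' * (d' * T ^ 2) = / 2 * (n1 t / N0 t - Re (vs t)) ^ 2).
{ replace (2 * d' * (d' * T ^ 2)) with (/ 2 * (2 * d' * T) ^ 2) by field.
  rewrite ZT; ring. }
assert (E1 : Re (vs t ^ 2 / 2 + schwarzian h g (phi t) * phi1 t ^ 2
         + RtoC (2 * (sigma11 k k1 (phi t) * Cmod (phi1 t) ^ 2) - 2))
  = / 2 * Re (vs t) ^ 2 - / 2 * Im (vs t) ^ 2 + Re (schwarzian h g (phi t) * phi1 t ^ 2)
    + (2 * (sigma11 k k1 (phi t) * Cmod (phi1 t) ^ 2) - 2)).
{ replace (vs t ^ 2 / 2)%C with (RtoC (/ 2) * vs t ^ 2)%C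
    by (rewrite RtoC_inv by lra; field; intros E; apply RtoC_inj in E; lra).
  generalize (vs t) (schwarzian h g (phi t)) (phi1 t); intros u v w.
  unfold Re, Im; simpl; ring. }
rewrite E1 in Hl.
assert (E2 : Cmod (kappa t) ^ 2 / (1 + Cmod (kk t) ^ 2) ^ 2
  = sigma11 k k1 (phi t) * Cmod (phi1 t) ^ 2).
{ unfold kappa, kk, sigma11; rewrite Cmod_mult; field.
  assert (P := pow2_ge_0 (Cmod (k (phi t)))); lra. }
rewrite E2 in A.
assert (E3 : Re (schwarzian h g (phi t) * phi1 t ^ 2)
  <= Cmod (schwarzian h g (phi t)) * Cmod (phi1 t) ^ 2).
{ eapply Rle_trans; [apply Rle_abs|]; eapply Rle_trans; [apply re_le_Cmod|].
  rewrite Cmod_mult, Cmod_pow; lra. }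
assert (delta ^ 2 < d' ^ 2).
{ simpl; rewrite !Rmult_1_r; apply Rmult_le_0_lt_compat; lra. }
nra.
Qed.
End Local.

(* Were [delta * L < PI], the quotient of [|F (phi s) - F (phi 0)|^2 / |d/ds F (phi s)|] by the
   square of a positive solution of [y'' + d'^2 y = 0], [d' > delta], would have an interior
   maximum. *)
Lemma no_return : lift h g q z0 (phi 0) = lift h g q z0 (phi L) -> PI <= delta * L.
Proof.
intros Hret; destruct (Rle_or_lt PI (delta * L)) as [|Hlt]; [assumption|exfalso].
(* Above [delta] for a strict second-order inequality, below [PI / L] so that the cosine centred at
   [L / 2] is positive up to both ends. *)
set (d' := (delta + PI / L) / 2).
assert (HPL : delta < PI / L) by (apply Rlt_div_r; assumption).
assert (Hd' : delta < d') by (unfold d'; lra).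
assert (Hd'L : d' * L < PI).
{ apply Rlt_div_r; [assumption | unfold d'; lra]. }
set (y := fun s : R => cos (d' * (s - L / 2))).
(* [G] is the exponential of [psi]; unlike [psi] it is continuous on the closed interval, including
   the ends where [N0] vanishes. *)
set (G := fun s => N0 s * / (exp (Defs.sigma h g (phi s)) * Cmod (phi1 s) * (y s * y s))).
assert (Yp : forall s, 0 <= s <= L -> 0 < y s) by (intros; now apply y_pos).
assert (Vp : forall s, 0 <= s <= L ->
  0 < exp (Defs.sigma h g (phi s)) * Cmod (phi1 s) * (y s * y s)).
{ intros s Hs; specialize (Yp s Hs).
  repeat apply Rmult_lt_0_compat; try assumption; [apply exp_pos | apply Cmod_gt_0, Hphi1]. }
assert (Loc := fun s => local_rep_exists h g q (phi s) HL (proj1 (Hphi s))).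
assert (Cont : forall s, 0 <= s <= L -> continuity_pt G s).
{ intros s Hs; destruct (Loc s) as (r & sw & eta & eta1 & eta2 & k & k1 & k2 & Hr & Rep).
  assert (C1 : continuity_pt N0 s).
  { apply continuity_pt_filterlim, (ex_derive_continuous N0).
    eexists; apply (is_derive_N0 s r sw eta eta1 eta2 k k1 k2 Rep), near_self, Hr. }
  assert (C2 : continuity_pt (fun u => Defs.sigma h g (phi u)) s).
  { apply continuity_pt_filterlim, (ex_derive_continuous (fun u => Defs.sigma h g (phi u))).
    eexists; apply (is_derive_sigma_phi s r sw eta eta1 eta2 k k1 k2 Rep), near_self, Hr. }
  assert (C3 : continuity_pt (fun u => Cmod (phi1 u)) s).
  { apply continuity_pt_filterlim.
    apply continuous_ext with (fun u => sqrt (Cmod (phi1 u) ^ 2)).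
    { intros u; apply sqrt_pow2, Cmod_ge_0. }
    apply (continuous_comp (fun u => Cmod (phi1 u) ^ 2) sqrt); [|apply continuous_sqrt].
    apply (ex_derive_continuous (fun u => Cmod (phi1 u) ^ 2)); eexists.
    apply is_derive_Cmod_sqr, Hphi. }
  assert (C4 : continuity_pt y s).
  { apply continuity_pt_filterlim, (ex_derive_continuous y); unfold y; auto_derive; trivial. }
  apply continuity_pt_mult; [assumption|].
  apply continuity_pt_inv; [|apply Rgt_not_eq, Vp, Hs].
  repeat apply continuity_pt_mult; try assumption.
  apply (continuity_pt_comp (fun u => Defs.sigma h g (phi u)) exp); [assumption|].
  apply derivable_continuous_pt, derivable_pt_exp. }
destruct (continuity_ab_maj G 0 L (Rlt_le _ _ HLpos) Cont) as (t & Hmax & Ht).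
assert (N0ge : forall s, 0 <= N0 s).
{ intros s; unfold N0; assert (P1 := pow2_ge_0 (X1 s - X1 0)).
  assert (P2 := pow2_ge_0 (X2 s - X2 0)); assert (P3 := pow2_ge_0 (X3 s - X3 0)); lra. }
(* A maximum equal to 0 would make the lifted curve constant, against its positive speed at
   [L / 2]. *)
assert (HNt : 0 < N0 t).
{ destruct (Rle_or_lt (N0 t) 0) as [Z|]; [exfalso | assumption].
  assert (Z' : N0 t = 0) by (apply Rle_antisym; [assumption | apply N0ge]).
  assert (A : forall s, 0 <= s <= L -> N0 s = 0).
  { intros s Hs; specialize (Hmax s Hs); unfold G in Hmax; rewrite Z', Rmult_0_l in Hmax.
    destruct (Rle_lt_or_eq_dec _ _ (N0ge s)) as [P|]; [exfalso | now symmetry].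
    assert (0 < N0 s * / (exp (Defs.sigma h g (phi s)) * Cmod (phi1 s) * (y s * y s)))
      by (apply Rmult_lt_0_compat; [assumption | apply Rinv_0_lt_compat, Vp, Hs]); lra. }
  destruct (Loc (L / 2)) as (r & sw & eta & eta1 & eta2 & k & k1 & k2 & Hr & Rep).
  assert (U : forall X : R -> R, (forall s, 0 <= s <= L -> X s = X 0) ->
    forall l, is_derive X (L / 2) l -> l = 0).
  { intros X HX l D; rewrite <- (is_derive_unique _ _ _ D).
    rewrite (Derive_ext_loc X (fun _ => X 0)); [apply Derive_const|].
    assert (HL2 : 0 < L / 2) by lra.
    exists (mkposreal _ HL2); intros s Hs; apply HX.
    apply Rabs_def2 in Hs; simpl in Hs; unfold minus, plus, opp in Hs; simpl in Hs; lra. }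
  assert (nr := near_self (L / 2) r Hr).
  assert (S := speed_pos _ _ _ _ _ _ _ _ _ Rep _ nr).
  assert (Q : forall s, 0 <= s <= L -> X1 s = X1 0 /\ X2 s = X2 0 /\ X3 s = X3 0).
  { intros s Hs; specialize (A s Hs); unfold N0 in A.
    assert (P1 := pow2_ge_0 (X1 s - X1 0)).
    assert (P2 := pow2_ge_0 (X2 s - X2 0)); assert (P3 := pow2_ge_0 (X3 s - X3 0)).
    split; [|split]; apply Rminus_diag_uniq, Rsqr_0_uniq; unfold Rsqr; lra. }
  assert (V1 := U X1 (fun s Hs => proj1 (Q s Hs)) _
                  (is_derive_X1 _ _ _ _ _ _ _ _ _ Rep _ nr)).
  assert (V2 := U X2 (fun s Hs => proj1 (proj2 (Q s Hs))) _
                  (is_derive_X2 _ _ _ _ _ _ _ _ _ Rep _ nr)).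
  assert (V3 := U X3 (fun s Hs => proj2 (proj2 (Q s Hs))) _
                  (is_derive_X3 _ _ _ _ _ _ _ _ _ Rep _ nr)).
  cbv zeta beta in S, V1, V2, V3; rewrite V1, V3 in S.
  destruct sw; cbv iota in V2; nra. }
assert (Ht' : 0 < t < L).
{ assert (Z0 : N0 0 = 0) by (unfold N0; ring).
  assert (ZL : N0 L = 0) by (unfold N0, X1, X2, X3; rewrite <- Hret; ring).
  split; (apply Rnot_le_lt; intros Hle).
  - assert (t = 0) by lra; subst t; lra.
  - assert (t = L) by lra; subst t; lra. }
destruct (Loc t) as (r & sw & eta & eta1 & eta2 & k & k1 & k2 & Hr & Rep).
apply (no_local_maximum t r sw eta eta1 eta2 k k1 k2 Hr Rep d' Ht' HNt Hd' Hd'L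
         (Rmin t (L - t))); [apply Rmin_pos; lra|].
intros s Hs P.
assert (HsL : 0 <= s <= L).
{ assert (B7 := Rmin_l t (L - t)); assert (B8 := Rmin_r t (L - t)).
  assert (Hs' : Rabs (s - t) < t) by lra; assert (Hs2 : Rabs (s - t) < L - t) by lra.
  apply Rabs_def2 in Hs'; apply Rabs_def2 in Hs2; lra. }
assert (Elog : forall u, 0 <= u <= L -> 0 < N0 u ->
  ln (N0 u) - Defs.sigma h g (phi u) - / 2 * ln (Cmod (phi1 u) ^ 2) - 2 * ln (y u) = ln (G u)).
{ intros u Hu HNu; specialize (Yp u Hu); specialize (Vp u Hu).
  assert (Cp : 0 < Cmod (phi1 u)) by apply Cmod_gt_0, Hphi1.
  unfold G; rewrite ln_mult, ln_Rinv by (try apply Rinv_0_lt_compat; assumption).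
  rewrite !ln_mult, ln_exp, ln_pow
    by (repeat apply Rmult_lt_0_compat; try assumption; apply exp_pos).
  simpl INR; lra. }
fold (y s) (y t); rewrite (Elog t) by (assumption || lra).
rewrite (Elog s) by assumption.
apply ln_le; [|now apply Hmax].
apply Rmult_lt_0_compat; [assumption | apply Rinv_0_lt_compat, Vp, HsL].
Qed.
End Comparison.

(** * Hyperbolic geodesics *)

Lemma cosh_sqr_minus_sinh_sqr (t : R) : cosh t ^ 2 - sinh t ^ 2 = 1.
Proof.
unfold cosh, sinh; rewrite exp_Ropp; field; apply Rgt_not_eq, exp_pos.
Qed.

Lemma cosh_pos (t : R) : 0 < cosh t.
Proof. unfold cosh; assert (H := exp_pos t); assert (H' := exp_pos (- t)); lra. Qed.

Lemma sinh_ge_0 (t : R) : 0 <= t -> 0 <= sinh t.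
Proof.
intros Ht; unfold sinh; destruct (Req_dec t 0) as [->|Hn].
- rewrite Ropp_0; lra.
- assert (exp (- t) < exp t) by (apply exp_increasing; lra); lra.
Qed.

Lemma sinh_minus_le_0 (t L : R) : t <= L -> sinh t * cosh L - cosh t * sinh L <= 0.
Proof.
intros H.
replace (sinh t * cosh L - cosh t * sinh L) with (- sinh (L - t)).
- assert (P := sinh_ge_0 (L - t)); lra.
- unfold sinh, cosh, Rminus; rewrite !exp_Ropp, exp_plus, exp_Ropp.
  assert (exp t <> 0) by apply Rgt_not_eq, exp_pos.
  assert (exp L <> 0) by apply Rgt_not_eq, exp_pos.
  field; split; assumption.
Qed.

Lemma cosh_minus_pos (t L : R) : 0 < cosh t * cosh L - sinh t * sinh L.
Proof.
replace (cosh t * cosh L - sinh t * sinh L) with (cosh (L - t)); [apply cosh_pos|].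
unfold sinh, cosh, Rminus; rewrite !exp_Ropp, exp_plus, exp_Ropp.
assert (exp t <> 0) by apply Rgt_not_eq, exp_pos.
assert (exp L <> 0) by apply Rgt_not_eq, exp_pos.
field; split; assumption.
Qed.

Lemma cderiv_sinh (t : R) : cderiv (fun s => RtoC (sinh s)) t (RtoC (cosh t)).
Proof. apply cderiv_RtoC, is_derive_Reals, derivable_pt_lim_sinh. Qed.

Lemma cderiv_cosh (t : R) : cderiv (fun s => RtoC (cosh s)) t (RtoC (sinh t)).
Proof. apply cderiv_RtoC, is_derive_Reals, derivable_pt_lim_cosh. Qed.

Section Geodesic.
Variables (a e : C).
Hypothesis Ha : in_disk a.
Hypothesis He : Cmod e = 1.

Definition geo_num (t : R) : C := (e * sinh t + a * cosh t)%C.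
Definition geo_den (t : R) : C := (cosh t + Cconj a * e * sinh t)%C.
(* [geodesic t] is [(a + e * tanh t) / (1 + conj a * e * tanh t)]. *)
Definition geodesic (t : R) : C := (geo_num t / geo_den t)%C.
Definition geodesic1 (t : R) : C := (e * RtoC (1 - Cmod a ^ 2) / geo_den t ^ 2)%C.
Definition geodesic_ratio (t : R) : C :=
  (-2 * (sinh t + Cconj a * e * cosh t) / geo_den t)%C.

Lemma e_sqr : Re e ^ 2 + Im e ^ 2 = 1.
Proof. rewrite <- Cmod2_alt, He; ring. Qed.

Lemma geo_norms (t : R) : Cmod (geo_den t) ^ 2 - Cmod (geo_num t) ^ 2 = 1 - Cmod a ^ 2.
Proof.
assert (E := e_sqr); assert (H := cosh_sqr_minus_sinh_sqr t).
rewrite !Cmod2_alt.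
transitivity ((1 - (Re a ^ 2 + Im a ^ 2)) * (cosh t ^ 2 - (Re e ^ 2 + Im e ^ 2) * sinh t ^ 2)
  + 0 * (Re e ^ 2 + Im e ^ 2)).
- unfold geo_den, geo_num; unfold Re, Im; simpl; ring_simplify.
  ring.
- rewrite E; replace (cosh t ^ 2 - 1 * sinh t ^ 2) with 1 by lra; ring.
Qed.

Lemma one_minus_sqr_pos : 0 < 1 - Cmod a ^ 2.
Proof. unfold in_disk in Ha; assert (H := Cmod_ge_0 a); nra. Qed.

Lemma geo_den_neq_0 (t : R) : geo_den t <> 0%C.
Proof.
intros E; assert (H := geo_norms t); rewrite E, Cmod_0 in H.
assert (P := pow2_ge_0 (Cmod (geo_num t))); assert (Q := one_minus_sqr_pos); lra.
Qed.

Lemma geo_den_pos (t : R) : 0 < Cmod (geo_den t).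
Proof. apply Cmod_gt_0, geo_den_neq_0. Qed.

Lemma geodesic_norm (t : R) :
  1 - Cmod (geodesic t) ^ 2 = (1 - Cmod a ^ 2) / Cmod (geo_den t) ^ 2.
Proof.
assert (P := geo_den_pos t); unfold geodesic.
rewrite Cmod_div by apply geo_den_neq_0; rewrite <- (geo_norms t); field; lra.
Qed.

Lemma geodesic_in_disk (t : R) : in_disk (geodesic t).
Proof.
assert (P : 0 < 1 - Cmod (geodesic t) ^ 2).
{ rewrite geodesic_norm; apply Rdiv_lt_0_compat; [apply one_minus_sqr_pos|].
  apply pow_lt, geo_den_pos. }
unfold in_disk; assert (H := Cmod_ge_0 (geodesic t)); nra.
Qed.

(** Unit speed for the metric [|dz| / (1 - |z|^2)]: this is how [|phi1|^2] becomes the weight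
    [(1 - |z|^2)^2]. *)
Lemma geodesic1_norm (t : R) : Cmod (geodesic1 t) = 1 - Cmod (geodesic t) ^ 2.
Proof.
rewrite geodesic_norm; unfold geodesic1.
rewrite Cmod_div by apply Cpow_nz, geo_den_neq_0.
rewrite Cmod_mult, He, Cmod_pow, Cmod_R, Rabs_pos_eq, Rmult_1_l;
  [reflexivity | apply Rlt_le, one_minus_sqr_pos].
Qed.

Lemma geodesic1_neq_0 (t : R) : geodesic1 t <> 0%C.
Proof.
apply Cmod_gt_0; rewrite geodesic1_norm, geodesic_norm.
apply Rdiv_lt_0_compat; [apply one_minus_sqr_pos | apply pow_lt, geo_den_pos].
Qed.

Lemma cderiv_geo_num (t : R) : cderiv geo_num t (e * cosh t + a * sinh t).
Proof.
apply gderiv_plus; apply gderiv_scal; [apply cderiv_sinh | apply cderiv_cosh].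
Qed.

Lemma cderiv_geo_den (t : R) : cderiv geo_den t (sinh t + Cconj a * e * cosh t).
Proof. apply gderiv_plus; [apply cderiv_cosh | apply gderiv_scal, cderiv_sinh]. Qed.

Lemma cosh_sinh_C (t : R) : (RtoC (cosh t) ^ 2 = 1 + RtoC (sinh t) ^ 2)%C.
Proof.
rewrite <- !RtoC_pow, <- RtoC_plus; f_equal; assert (H := cosh_sqr_minus_sinh_sqr t); lra.
Qed.

Lemma cderiv_geodesic (t : R) : cderiv geodesic t (geodesic1 t).
Proof.
eapply gderiv_eq; [|apply gderiv_div; [apply geo_den_neq_0 | apply cderiv_geo_num | apply cderiv_geo_den]].
unfold geodesic1; assert (H := geo_den_neq_0 t).
assert (E : ((e * cosh t + a * sinh t) * geo_den t
   - geo_num t * (sinh t + Cconj a * e * cosh t))%C = (e * RtoC (1 - Cmod a ^ 2))%C).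
{ rewrite RtoC_minus, <- Cmod_sqr_C; unfold geo_den, geo_num.
  transitivity (e * (1 - a * Cconj a) * (RtoC (cosh t) ^ 2 - RtoC (sinh t) ^ 2))%C; [ring|].
  rewrite cosh_sinh_C; ring. }
rewrite E; field; assumption.
Qed.

Lemma cderiv_geodesic1 (t : R) : cderiv geodesic1 t (geodesic1 t * geodesic_ratio t).
Proof.
assert (H := geo_den_neq_0 t).
eapply gderiv_eq; [|apply gderiv_div; [now apply Cpow_nz | apply gderiv_const |
  apply gderiv_pow, cderiv_geo_den]].
unfold geodesic1, geodesic_ratio; cbv beta; simpl INR; simpl pred; rewrite Cpow_1_r, RtoC_plus.
field; assumption.
Qed.

(** The ratio is [- 2 den' / den] with [den'' = den], since [cosh] and [sinh] solve that
    equation. *)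
Lemma cderiv_geodesic_ratio (t : R) :
  cderiv geodesic_ratio t (geodesic_ratio t ^ 2 / 2 - 2).
Proof.
assert (H := geo_den_neq_0 t).
eapply gderiv_eq; [|apply gderiv_div; [exact H | | apply cderiv_geo_den]].
2: { apply gderiv_scal, gderiv_plus; [apply cderiv_sinh | apply gderiv_scal, cderiv_cosh]. }
unfold geodesic_ratio; fold (geo_den t); field; assumption.
Qed.

Lemma geodesic_0 : geodesic 0 = a.
Proof.
unfold geodesic, geo_num, geo_den; rewrite sinh_0, cosh_0; field.
Qed.

(* The numerator is a quadratic form in [cosh t] and [sinh t] because [1 + |z|^2 - 2 Re (z conj w)]
   over [1 - |z|^2] is a linear function on the hyperboloid model. *)
Lemma half_plane_along_geodesic (w : C) (t : R) :
  Cmod (geo_den t) ^ 2 * (1 + Cmod (geodesic t) ^ 2 - 2 * Re (geodesic t * Cconj w))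
  = (1 + Cmod a ^ 2 - 2 * Re (a * Cconj w)) * (cosh t ^ 2 + sinh t ^ 2)
    + 2 * (2 * Re (Cconj a * e) - Re (Cconj w * (e + a ^ 2 * Cconj e))) * (sinh t * cosh t).
Proof.
assert (P := geo_den_pos t); assert (E := e_sqr).
assert (E1 : (geodesic t * Cconj w
  = RtoC (/ Cmod (geo_den t) ^ 2) * (geo_num t * Cconj (geo_den t) * Cconj w))%C).
{ rewrite RtoC_inv, <- Cmod_sqr_C by (apply pow_nonzero; lra); unfold geodesic.
  field; split; [|apply geo_den_neq_0].
  intros Z; apply (Rgt_not_eq _ _ P); rewrite <- Cmod_conj, Z; apply Cmod_0. }
rewrite E1, re_scal_l; unfold geodesic; rewrite Cmod_div by apply geo_den_neq_0.
transitivity (Cmod (geo_den t) ^ 2 + Cmod (geo_num t) ^ 2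
  - 2 * Re (geo_num t * Cconj (geo_den t) * Cconj w)); [field; lra|].
rewrite !Cmod2_alt; unfold geo_num, geo_den.
transitivity ((1 + (Re a ^ 2 + Im a ^ 2) - 2 * Re (a * Cconj w))
    * (cosh t ^ 2 + (Re e ^ 2 + Im e ^ 2) * sinh t ^ 2)
    + 2 * (2 * Re (Cconj a * e) - Re (Cconj w * (e + a ^ 2 * Cconj e))) * (sinh t * cosh t)).
- unfold Re, Im; simpl; ring.
- rewrite E; ring.
Qed.

(** For [|w| > 1] the inequality defines the disk of centre [w] orthogonal to the unit circle, a
    hyperbolic half-plane. Along the geodesic it reads [X cosh (2 t) + Y sinh (2 t) < 0]. Here
    [X < 0] settles the case [Y <= 0]; for [Y > 0], dividing by [cosh (2 t)] leaves an increasing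
    function of [t], negative at [L]. *)
Lemma half_plane_convex (w : C) (t L : R) : 0 <= t <= L ->
  1 + Cmod a ^ 2 - 2 * Re (a * Cconj w) < 0 ->
  1 + Cmod (geodesic L) ^ 2 - 2 * Re (geodesic L * Cconj w) < 0 ->
  1 + Cmod (geodesic t) ^ 2 - 2 * Re (geodesic t * Cconj w) < 0.
Proof.
intros Ht H0 HL.
assert (Et := half_plane_along_geodesic w t); assert (EL := half_plane_along_geodesic w L).
assert (Pt := pow_lt _ 2 (geo_den_pos t)); assert (PL := pow_lt _ 2 (geo_den_pos L)).
set (X := 1 + Cmod a ^ 2 - 2 * Re (a * Cconj w)) in *.
set (Y := 2 * Re (Cconj a * e) - Re (Cconj w * (e + a ^ 2 * Cconj e))) in *.
set (Ht' := 1 + Cmod (geodesic t) ^ 2 - 2 * Re (geodesic t * Cconj w)) in *.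
set (HL' := 1 + Cmod (geodesic L) ^ 2 - 2 * Re (geodesic L * Cconj w)) in *.
set (m := Cmod (geo_den t) ^ 2) in *; set (mL := Cmod (geo_den L) ^ 2) in *.
assert (A1 := sinh_minus_le_0 t L ltac:(lra)); assert (A2 := cosh_minus_pos t L).
assert (S1 := sinh_ge_0 t ltac:(lra)); assert (S2 := sinh_ge_0 L ltac:(lra)).
assert (C1 := cosh_pos t); assert (C2 := cosh_pos L).
set (s := sinh t) in *; set (c := cosh t) in *.
set (sL := sinh L) in *; set (cL := cosh L) in *.
assert (B : 0 < c ^ 2 + s ^ 2).
{ assert (P := pow2_ge_0 s); assert (P' := pow_lt c 2 C1); lra. }
assert (BL : 0 < cL ^ 2 + sL ^ 2).
{ assert (P := pow2_ge_0 sL); assert (P' := pow_lt cL 2 C2); lra. }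
assert (V : m * Ht' < 0).
{ rewrite Et; destruct (Rle_or_lt Y 0) as [HY|HY].
  - assert (X * (c ^ 2 + s ^ 2) < 0) by nra.
    assert (0 <= s * c) by nra; nra.
  - assert (VL : X * (cL ^ 2 + sL ^ 2) + 2 * Y * (sL * cL) < 0) by (rewrite <- EL; nra).
    (* Monotonicity of [tanh (2 t)] with denominators cleared. *)
    assert (M : s * c * (cL ^ 2 + sL ^ 2) - sL * cL * (c ^ 2 + s ^ 2) <= 0).
    { replace (s * c * (cL ^ 2 + sL ^ 2) - sL * cL * (c ^ 2 + s ^ 2))
        with ((s * cL - c * sL) * (c * cL - s * sL)) by ring; nra. }
    apply Rmult_lt_reg_r with (cL ^ 2 + sL ^ 2); [assumption|]; rewrite Rmult_0_l.
    apply Rle_lt_trans with ((X * (cL ^ 2 + sL ^ 2) + 2 * Y * (sL * cL)) * (c ^ 2 + s ^ 2)).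
    + assert (2 * Y * (s * c * (cL ^ 2 + sL ^ 2) - sL * cL * (c ^ 2 + s ^ 2)) <= 0) by nra.
      lra.
    + nra. }
nra.
Qed.
End Geodesic.

Section Endpoints.
Variables (a b : C).
Hypothesis Ha : in_disk a.
Hypothesis Hb : in_disk b.

Lemma one_minus_conj_neq_0 : (1 - Cconj a * b)%C <> 0%C.
Proof.
intros E; unfold in_disk in *.
assert (E' : Cmod (Cconj a * b) = 1).
{ replace (Cconj a * b)%C with (1 - (1 - Cconj a * b))%C by ring; rewrite E.
  replace (1 - 0)%C with (RtoC 1) by ring; apply Cmod_1. }
rewrite Cmod_mult, Cmod_conj in E'.
assert (H1 := Cmod_ge_0 a); assert (H2 := Cmod_ge_0 b); nra.
Qed.

Lemma pseudo_hyperbolic_lt_1 : pseudo_hyperbolic a b < 1.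
Proof.
assert (N := one_minus_conj_neq_0); unfold pseudo_hyperbolic.
rewrite Cmod_div by assumption.
assert (P : 0 < Cmod (1 - Cconj a * b)) by now apply Cmod_gt_0.
apply Rlt_div_l; [assumption|]; rewrite Rmult_1_l.
assert (E : Cmod (1 - Cconj a * b) ^ 2 - Cmod (a - b) ^ 2 = (1 - Cmod a ^ 2) * (1 - Cmod b ^ 2)).
{ rewrite !Cmod2_alt; unfold Re, Im; simpl; ring. }
assert (0 < (1 - Cmod a ^ 2) * (1 - Cmod b ^ 2))
  by (apply Rmult_lt_0_compat; apply one_minus_sqr_pos; assumption).
assert (Q := Cmod_ge_0 (a - b)); nra.
Qed.

Hypothesis Hab : a <> b.

Lemma pseudo_hyperbolic_pos : 0 < pseudo_hyperbolic a b.
Proof.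
apply Cmod_gt_0; intros E.
assert (N := one_minus_conj_neq_0); apply (Cminus_neq_0 a b Hab).
replace (a - b)%C with ((a - b) / (1 - Cconj a * b) * (1 - Cconj a * b))%C by (field; assumption).
rewrite E; ring.
Qed.

Lemma hyperbolic_dist_pos : 0 < hyperbolic_dist a b.
Proof.
assert (H := pseudo_hyperbolic_pos); assert (H1 := pseudo_hyperbolic_lt_1).
unfold hyperbolic_dist; apply Rmult_lt_0_compat; [lra|].
rewrite <- ln_1; apply ln_increasing; [lra|].
apply Rlt_div_r; lra.
Qed.

(** The distance is the inverse hyperbolic tangent of [pseudo_hyperbolic a b]. *)
Lemma sinh_hyperbolic_dist :
  sinh (hyperbolic_dist a b) = pseudo_hyperbolic a b * cosh (hyperbolic_dist a b).
Proof.
assert (H := pseudo_hyperbolic_pos); assert (H1 := pseudo_hyperbolic_lt_1).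
set (L := hyperbolic_dist a b); set (r := pseudo_hyperbolic a b) in *.
assert (E : exp L * exp L = (1 + r) / (1 - r)).
{ rewrite <- exp_plus; unfold L, hyperbolic_dist; fold r.
  replace (/ 2 * ln ((1 + r) / (1 - r)) + / 2 * ln ((1 + r) / (1 - r)))
    with (ln ((1 + r) / (1 - r))) by field.
  apply exp_ln, Rdiv_lt_0_compat; lra. }
unfold sinh, cosh; rewrite exp_Ropp; assert (P := exp_pos L).
apply Rmult_eq_reg_r with (2 * exp L); [|lra].
transitivity (exp L * exp L - 1); [field; lra|].
transitivity (r * (exp L * exp L + 1)); [|field; lra].
rewrite E; field; lra.
Qed.

(** The direction [e] is the image of [b] under the disk automorphism that sends [a] to 0, scaled to
    modulus 1. *)
Lemma geodesic_exists : exists e, Cmod e = 1 /\ geodesic a e (hyperbolic_dist a b) = b.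
Proof.
assert (N := one_minus_conj_neq_0); assert (P := pseudo_hyperbolic_pos).
set (r := pseudo_hyperbolic a b) in *.
assert (Nr : RtoC r <> 0%C) by (intros E; apply RtoC_inj in E; lra).
exists ((b - a) / ((1 - Cconj a * b) * r))%C; split.
- rewrite Cmod_div, Cmod_mult, Cmod_R, (Rabs_pos_eq r) by (lra || now apply Cmult_neq_0).
  unfold r, pseudo_hyperbolic; rewrite Cmod_div, (Cmod_sym b a) by assumption.
  assert (0 < Cmod (a - b)) by (apply Cmod_gt_0; now apply Cminus_neq_0).
  assert (0 < Cmod (1 - Cconj a * b)) by now apply Cmod_gt_0.
  field; split; lra.
- unfold geodesic, geo_num, geo_den; rewrite sinh_hyperbolic_dist; fold r.
  assert (C1 : RtoC (cosh (hyperbolic_dist a b)) <> 0%C).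
  { intros E; apply RtoC_inj in E; assert (Q := cosh_pos (hyperbolic_dist a b)); lra. }
  rewrite RtoC_mult.
  assert (Na : (1 - Cconj a * a)%C <> 0%C).
  { replace (Cconj a * a)%C with (a * Cconj a)%C by ring.
    rewrite Cmod_sqr_C, <- RtoC_minus; intros E; apply RtoC_inj in E.
    assert (Q := one_minus_sqr_pos a Ha); lra. }
  field; split; [assumption|]; split; [assumption|].
  replace (cosh (hyperbolic_dist a b) * (1 - Cconj a * b)
           + Cconj a * (b - a) * cosh (hyperbolic_dist a b))%C
    with (cosh (hyperbolic_dist a b) * (1 - Cconj a * a))%C by ring.
  now apply Cmult_neq_0.
Qed.
End Endpoints.

(** The bound is asked only on the arc from [a] to [b], not on the whole disk: in the valence
    estimate it is known only near the unit circle. *)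
Lemma lift_return_distance (h g q : C -> C) (z0 a b : C) (delta : R) :
  liftable_harmonic_map h g q -> in_disk z0 -> in_disk a -> in_disk b -> a <> b ->
  lift h g q z0 a = lift h g q z0 b -> 0 <= delta ->
  (forall e t, Cmod e = 1 -> geodesic a e (hyperbolic_dist a b) = b ->
     0 <= t <= hyperbolic_dist a b ->
     (Cmod (schwarzian h g (geodesic a e t))
      + exp (2 * Defs.sigma h g (geodesic a e t)) * Rabs (gauss_curvature h g (geodesic a e t)))
     * (1 - Cmod (geodesic a e t) ^ 2) ^ 2 <= 2 * (1 + delta ^ 2)) ->
  PI <= delta * hyperbolic_dist a b.
Proof.
intros HL Hz0 Ha Hb Hab Hret Hd Hbound.
destruct (geodesic_exists a b Ha Hb Hab) as (e & He & Heb).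
apply (no_return h g q z0 (geodesic a e) (geodesic1 a e) (geodesic_ratio a e)); try assumption.
- intros s; split; [now apply geodesic_in_disk|].
  split; [now apply cderiv_geodesic | now apply cderiv_geodesic1].
- intros s; now apply geodesic1_neq_0.
- intros s; now apply cderiv_geodesic_ratio.
- now apply hyperbolic_dist_pos.
- intros s Hs; rewrite geodesic1_norm by assumption; now apply Hbound.
- now rewrite geodesic_0, Heb.
Qed.

(** * Separation of the preimages of a point *)

Lemma schwarzian_bound_weighted (h g : C -> C) (c : R) (p : R -> R) (z : C) :
  schwarzian_bound h g c p -> in_disk z ->
  (Cmod (schwarzian h g z) + exp (2 * Defs.sigma h g z) * Rabs (gauss_curvature h g z))
  * (1 - Cmod z ^ 2) ^ 2 <= c * ((1 - Cmod z ^ 2) ^ 2 * p (Cmod z)).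
Proof.
intros H Hz; specialize (H z Hz); assert (P := pow2_ge_0 (1 - Cmod z ^ 2)).
replace (c * ((1 - Cmod z ^ 2) ^ 2 * p (Cmod z)))
  with (c * p (Cmod z) * (1 - Cmod z ^ 2) ^ 2) by ring.
now apply Rmult_le_compat_r.
Qed.

Section Separation.
Variables (p : R -> R) (c : R).
Hypothesis Hp : nehari_function p.
Hypothesis Hc : 0 < c.

Let admissible (h g q : C -> C) (z0 : C) : Prop :=
  liftable_harmonic_map h g q /\ in_disk z0 /\ schwarzian_bound h g c p.

(** Any [d] with [c * p 0 <= 2 (1 + d^2)] may serve as the comparison constant; [d = c * p 0 + 1]
    does and needs no square root. *)
Definition hyperbolic_gap : R := PI / (c * p 0 + 1).

Lemma p0_pos : 0 < c * p 0.
Proof. apply Rmult_lt_0_compat; [assumption | apply Hp; lra]. Qed.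

Lemma hyperbolic_gap_pos : 0 < hyperbolic_gap.
Proof. assert (H := p0_pos); apply Rdiv_lt_0_compat; [apply PI_RGT_0 | lra]. Qed.

Lemma hyperbolic_separation (h g q : C -> C) (z0 a b : C) :
  admissible h g q z0 -> in_disk a -> in_disk b -> a <> b ->
  lift h g q z0 a = lift h g q z0 b -> hyperbolic_gap <= hyperbolic_dist a b.
Proof.
intros (HL & Hz0 & HS) Ha Hb Hab Hret; assert (P := p0_pos).
apply Rle_div_l; [lra|]; rewrite Rmult_comm.
apply (lift_return_distance h g q z0); try assumption; [lra|].
intros e t He _ _; assert (Hin := geodesic_in_disk a e Ha He t).
eapply Rle_trans; [now apply (schwarzian_bound_weighted _ _ c p)|].
destruct Hp as (_ & _ & _ & Hmono & _).
specialize (Hmono 0 (Cmod (geodesic a e t)) (Rle_refl 0) (Cmod_ge_0 _) Hin).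
replace ((1 - 0 ^ 2) ^ 2) with 1 in Hmono by ring; rewrite Rmult_1_l in Hmono.
apply Rle_trans with (c * p 0); [apply Rmult_le_compat_l; lra | nra].
Qed.

Lemma ln_le_minus_1 (x : R) : 0 < x -> ln x <= x - 1.
Proof.
intros Hx; assert (H := exp_ineq1_le (ln x)); rewrite exp_ln in H by assumption; lra.
Qed.

Lemma hyperbolic_dist_le (a b : C) : 0 <= pseudo_hyperbolic a b <= / 2 ->
  hyperbolic_dist a b <= 2 * pseudo_hyperbolic a b.
Proof.
unfold hyperbolic_dist; set (r := pseudo_hyperbolic a b); intros Hr.
assert (H : ln ((1 + r) / (1 - r)) <= (1 + r) / (1 - r) - 1)
  by (apply ln_le_minus_1, Rdiv_lt_0_compat; lra).
assert (E : (1 + r) / (1 - r) - 1 <= 4 * r).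
{ replace ((1 + r) / (1 - r) - 1) with ((2 * r) / (1 - r)) by (field; lra).
  apply Rle_div_l; [lra|]; nra. }
lra.
Qed.

(** The hyperbolic gap alone allows preimages to crowd at the unit circle. If [a] is far out and [b]
    is close to it, both lie in a half-plane disjoint from [|z| <= r0]; so does the geodesic arc, on
    which the bound holds with [delta = 0]. All constants depend on [p] and [c] only. *)
Lemma euclidean_separation (mu : R) : c * mu < 2 ->
  filterlim (fun x : R => (1 - x ^ 2) ^ 2 * p x) (at_left 1) (locally mu) ->
  exists eta, 0 < eta /\ forall (h g q : C -> C) (z0 a b : C),
    admissible h g q z0 -> in_disk a -> in_disk b -> a <> b ->
    lift h g q z0 a = lift h g q z0 b -> eta <= Cmod (b - a).
Proof.
intros Hmu Hlim.
assert (Hr0 : exists r0, 0 < r0 < 1 /\ forall r, r0 < r < 1 -> c * ((1 - r ^ 2) ^ 2 * p r) <= 2).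
{ assert (He : 0 < 2 / c - mu) by (apply Rlt_Rminus, Rlt_div_r; lra).
  destruct (proj1 (filterlim_locally _ _) Hlim (mkposreal _ He)) as [d Hd].
  assert (D := cond_pos d).
  (* The lower bound [/ 2] keeps [r0] positive, as the division by [r0] in [P] requires. *)
  exists (Rmax (/ 2) (1 - d / 2)).
  assert (M1 := Rmax_l (/ 2) (1 - d / 2)); assert (M2 := Rmax_r (/ 2) (1 - d / 2)).
  split; [split; [lra | apply Rmax_lub_lt; lra]|].
  intros r Hr.
  assert (B : ball mu (mkposreal _ He) ((1 - r ^ 2) ^ 2 * p r)).
  { apply Hd; [|lra]; apply Rabs_def1; unfold minus, plus, opp; simpl; lra. }
  apply Rabs_def2 in B; unfold minus, plus, opp in B; simpl in B.
  replace 2 with (c * (2 / c)) by (field; lra).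
  apply Rmult_le_compat_l; lra. }
destruct Hr0 as (r0 & Hr0 & Hm).
(* The half-plane of a centre [w] with [|w| = P] touches the circle [|z| = r0]: [r0] is a root of
   [1 + r^2 - 2 P r], the other root being [/ r0]. *)
set (P := (1 + r0 ^ 2) / (2 * r0)).
assert (EP : 2 * P * r0 = 1 + r0 ^ 2) by (unfold P; field; lra).
assert (HP : 0 < P) by (apply Rdiv_lt_0_compat; [assert (Q := pow2_ge_0 r0)|]; lra).
set (r1 := (1 + r0) / 2); assert (Hr1 : r0 < r1 < 1) by (unfold r1; lra).
(* How far below 0 the half-plane function of a centre on the ray through [a] lies at [a], whenever
   [r1 <= |a| < 1]. *)
set (kap := (r1 - r0) * (/ r0 - 1)).
assert (Hir : 1 < / r0) by (rewrite <- Rinv_1; apply Rinv_lt_contravar; lra).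
assert (Hkap : 0 < kap) by (apply Rmult_lt_0_compat; lra).
assert (Gap := hyperbolic_gap_pos).
(* The first entry makes [hyperbolic_dist a b] smaller than the gap when [|a| <= r1], as
   [|1 - conj a * b| >= 1 - r1]. The second keeps [b] in the half-plane of [a], whose defining
   function increases by at most [(2 + 2 P) |b - a|]. *)
set (eta := Rmin ((1 - r1) * Rmin (/ 2) (hyperbolic_gap / 2)) (kap / (2 + 2 * P))).
exists eta; split.
{ apply Rmin_pos; [apply Rmult_lt_0_compat; [lra | apply Rmin_pos; lra]|].
  apply Rdiv_lt_0_compat; lra. }
intros h g q z0 a b Hadm Ha Hb Hab Hret.
destruct (Rle_or_lt eta (Cmod (b - a))) as [|Hlt]; [assumption|exfalso].
assert (H1 := Rlt_le_trans _ _ _ Hlt (Rmin_l _ _)).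
assert (H2 := Rlt_le_trans _ _ _ Hlt (Rmin_r _ _)).
assert (Ca := Cmod_ge_0 a); assert (Cb := Cmod_ge_0 b); assert (Ha' := Ha); assert (Hb' := Hb).
unfold in_disk in Ha', Hb'.
destruct (Rle_or_lt (Cmod a) r1) as [Hle|Hgt].
- assert (N := one_minus_conj_neq_0 a b Ha Hb).
  assert (D : 1 - r1 <= Cmod (1 - Cconj a * b)).
  { assert (T := Cmod_triangle (1 - Cconj a * b) (Cconj a * b)).
    replace (1 - Cconj a * b + Cconj a * b)%C with (RtoC 1) in T by ring.
    rewrite Cmod_1, Cmod_mult, Cmod_conj in T; nra. }
  assert (R : pseudo_hyperbolic a b < Rmin (/ 2) (hyperbolic_gap / 2)).
  { unfold pseudo_hyperbolic; rewrite Cmod_div, (Cmod_sym a b) by assumption.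
    apply Rlt_div_l; [lra|]; eapply Rlt_le_trans; [exact H1|].
    rewrite Rmult_comm; apply Rmult_le_compat_l; [apply Rlt_le, Rmin_pos; lra | assumption]. }
  assert (R1 := Rlt_le_trans _ _ _ R (Rmin_l _ _)).
  assert (R2 := Rlt_le_trans _ _ _ R (Rmin_r _ _)).
  assert (R0 : 0 <= pseudo_hyperbolic a b) by apply Cmod_ge_0.
  assert (S := hyperbolic_separation h g q z0 a b Hadm Ha Hb Hab Hret).
  assert (S' := hyperbolic_dist_le a b ltac:(lra)); lra.
- assert (Na : RtoC (Cmod a) <> 0%C) by (intros E; apply RtoC_inj in E; lra).
  set (w := (RtoC (P / Cmod a) * a)%C).
  assert (Ew : Cmod w = P).
  { unfold w; rewrite Cmod_mult, Cmod_R, Rabs_pos_eq; [field; lra|].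
    apply Rlt_le, Rdiv_lt_0_compat; lra. }
  assert (Ewa : Re (a * Cconj w) = P * Cmod a).
  { unfold w; rewrite Cmult_conj.
    replace (Cconj (RtoC (P / Cmod a))) with (RtoC (P / Cmod a))
      by (apply C_ext; unfold Re, Im; simpl; ring).
    replace (a * (RtoC (P / Cmod a) * Cconj a))%C with (RtoC (P / Cmod a) * (a * Cconj a))%C by ring.
    rewrite Cmod_sqr_C, <- RtoC_mult; simpl; field; lra. }
  assert (HA : 1 + Cmod a ^ 2 - 2 * Re (a * Cconj w) <= - kap).
  { rewrite Ewa.
    replace (1 + Cmod a ^ 2 - 2 * (P * Cmod a)) with (- ((Cmod a - r0) * (/ r0 - Cmod a)))
      by (unfold P; field; lra).
    apply Ropp_le_contravar, Rmult_le_compat; lra. }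
  assert (HB : 1 + Cmod b ^ 2 - 2 * Re (b * Cconj w) < 0).
  { assert (E : Re (b * Cconj w) = Re (a * Cconj w) + Re ((b - a) * Cconj w))
      by (unfold Re; simpl; ring).
    assert (B1 : - Re ((b - a) * Cconj w) <= Cmod (b - a) * P).
    { rewrite <- Ew, <- (Cmod_conj w), <- Cmod_mult.
      eapply Rle_trans; [|apply re_le_Cmod]; rewrite <- Rabs_Ropp; apply Rle_abs. }
    assert (B2 : Cmod b ^ 2 - Cmod a ^ 2 <= 2 * Cmod (b - a)).
    { assert (T := Cmod_triangle a (b - a)); replace (a + (b - a))%C with b in T by ring.
      assert (Q := Cmod_ge_0 (b - a)); nra. }
    assert (B3 : Cmod (b - a) * (2 + 2 * P) < kap) by (apply Rlt_div_r; lra).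
    lra. }
  destruct Hadm as (HL & Hz0 & HS).
  assert (Z := lift_return_distance h g q z0 a b 0 HL Hz0 Ha Hb Hab Hret (Rle_refl 0)).
  rewrite Rmult_0_l in Z; assert (PI <= 0); [apply Z | assert (Q := PI_RGT_0); lra].
  intros e t He Heb Ht; assert (Hin := geodesic_in_disk a e Ha He t).
  eapply Rle_trans; [now apply (schwarzian_bound_weighted _ _ c p)|].
  replace (2 * (1 + 0 ^ 2)) with 2 by ring; apply Hm.
  split; [|exact Hin].
  assert (K : 1 + Cmod (geodesic a e t) ^ 2 - 2 * Re (geodesic a e t * Cconj w) < 0).
  { apply (half_plane_convex a e Ha He w t (hyperbolic_dist a b)); [assumption | lra|].
    now rewrite Heb. }
  set (r := Cmod (geodesic a e t)) in *.
  assert (K2 : Re (geodesic a e t * Cconj w) <= r * P).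
  { unfold r; rewrite <- Ew, <- (Cmod_conj w), <- Cmod_mult.
    eapply Rle_trans; [apply Rle_abs | apply re_le_Cmod]. }
  assert (Hr : 0 <= r < 1) by (split; [apply Cmod_ge_0 | exact Hin]).
  (* Within the half-plane [1 + r^2 < 2 P r]; multiplied by [r0] this factors and leaves
     [r > r0]. *)
  assert (K3 : (r0 - r) * (1 - r0 * r) < 0).
  { replace ((r0 - r) * (1 - r0 * r)) with (r0 * (1 + r ^ 2) - r * (1 + r0 ^ 2)) by ring.
    rewrite <- EP; nra. }
  destruct (Rlt_or_le r0 r) as [|Hrr]; [assumption|exfalso].
  assert (0 <= 1 - r0 * r) by nra; nra.
Qed.
End Separation.

(** * Counting separated points of the disk *)

Definition grid_cell (s : R) (z : C) : nat * nat :=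
  (Z.to_nat (Int_part ((Re z + 1) / s)), Z.to_nat (Int_part ((Im z + 1) / s))).

(** The signs matter because [Z.to_nat] sends every negative integer to 0; this is why [grid_cell]
    shifts coordinates by 1. *)
Lemma Int_part_close (x y : R) : 0 <= x -> 0 <= y ->
  Z.to_nat (Int_part x) = Z.to_nat (Int_part y) -> Rabs (y - x) < 1.
Proof.
intros Hx Hy E.
assert (Bx := base_Int_part x); assert (By := base_Int_part y).
assert (Zx : (-1 < Int_part x)%Z) by (apply lt_IZR; lra).
assert (Zy : (-1 < Int_part y)%Z) by (apply lt_IZR; lra).
assert (E' : Int_part x = Int_part y) by lia.
rewrite E' in Bx; apply Rabs_def1; lra.
Qed.

Lemma Int_part_bound (x : R) (M : nat) : x < INR M -> (0 < M)%nat ->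
  (Z.to_nat (Int_part x) < M)%nat.
Proof.
intros Hx HM; assert (B := base_Int_part x).
assert (H : (Int_part x < Z.of_nat M)%Z) by (apply lt_IZR; rewrite <- INR_IZR_INZ; lra).
lia.
Qed.

(** Pigeonhole on a grid of side [eta / 2]: two points of one cell differ by less than [eta / 2] in
    each coordinate, hence by less than [eta]. *)
Lemma separated_list_length (eta : R) : 0 < eta -> exists N : nat, forall l : list C,
  NoDup l -> (forall z, In z l -> in_disk z) ->
  (forall a b, In a l -> In b l -> a <> b -> eta <= Cmod (b - a)) -> (length l <= N)%nat.
Proof.
intros He; set (s := eta / 2); assert (Hs : 0 < s) by (unfold s; lra).
destruct (nfloor_ex (2 / s)) as [n Hn]; [apply Rlt_le, Rdiv_lt_0_compat; lra|].
set (M := S n).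
assert (HM : 2 / s < INR M) by (unfold M; rewrite S_INR; lra).
exists (length (list_prod (seq 0 M) (seq 0 M))); intros l Hl Hin Hsep.
assert (Coord : forall z, In z l -> 0 <= (Re z + 1) / s < INR M /\ 0 <= (Im z + 1) / s < INR M).
{ intros z Hz; specialize (Hin z Hz); unfold in_disk in Hin.
  assert (Q1 := re_le_Cmod z); assert (Q2 := im_le_Cmod z).
  assert (Q1' : Rabs (Re z) < 1) by lra; assert (Q2' : Rabs (Im z) < 1) by lra.
  apply Rabs_def2 in Q1'; apply Rabs_def2 in Q2'.
  assert (Q3 : forall x, -1 < x < 1 -> 0 <= (x + 1) / s < INR M).
  { intros x Hx; split; [apply Rlt_le, Rdiv_lt_0_compat; lra|].
    apply Rlt_trans with (2 / s); [|assumption].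
    apply Rmult_lt_compat_r; [now apply Rinv_0_lt_compat | lra]. }
  split; apply Q3; lra. }
rewrite <- (length_map (grid_cell s) l).
apply NoDup_incl_length.
- apply NoDup_map_NoDup_ForallPairs; [|assumption].
  intros a b Ha Hb E; destruct (classic (a = b)) as [|Hab]; [assumption|exfalso].
  specialize (Hsep a b Ha Hb Hab).
  destruct (Coord a Ha) as [[A1 _] [A2 _]], (Coord b Hb) as [[B1 _] [B2 _]].
  injection E; intros E2 E1.
  assert (D1 := Int_part_close _ _ A1 B1 E1); assert (D2 := Int_part_close _ _ A2 B2 E2).
  assert (Sc : forall x y, Rabs ((y + 1) / s - (x + 1) / s) < 1 -> Rabs (y - x) < s).
  { intros x y D; replace (y - x) with (s * ((y + 1) / s - (x + 1) / s)) by (field; lra).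
    rewrite Rabs_mult, (Rabs_pos_eq s) by lra; nra. }
  apply Sc in D1; apply Sc in D2.
  assert (T := Cmod_le_re_im (b - a)).
  replace (Re (b - a)) with (Re b - Re a) in T by (unfold Re; simpl; ring).
  replace (Im (b - a)) with (Im b - Im a) in T by (unfold Im; simpl; ring).
  unfold s in *; lra.
- intros [i j] Hij; apply in_map_iff in Hij; destruct Hij as (z & E & Hz).
  destruct (Coord z Hz) as [[_ C1] [_ C2]]; injection E; intros <- <-.
  assert (0 < M)%nat by (unfold M; lia).
  apply in_prod; apply in_seq; split; try lia; simpl; now apply Int_part_bound.
Qed.

Lemma valence_le (F : C -> R * R * R) (N : nat) :
  (forall (P : R * R * R) (l : list C), NoDup l -> (forall z, In z l -> in_disk z /\ F z = P) ->
     (length l <= N)%nat) -> Rbar_le (valence F) (INR N).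
Proof.
intros H; unfold valence.
apply (proj2 (Lub_Rbar_correct _)); intros x (P & l & Hl & Hz & ->).
apply le_INR; now apply (H P l).
Qed.

(** * Linear second-order equations and extremal Nehari functions *)

Lemma derivative_le_0 (f f1 : R -> R) (a b : R) : a <= b ->
  (forall x, a <= x <= b -> is_derive f x (f1 x)) -> (forall x, a <= x <= b -> f1 x <= 0) ->
  f b <= f a.
Proof.
intros Hab Hd Hf; destruct (Req_dec a b) as [->|Hn]; [lra|].
destruct (MVT_cor2 f f1 a b) as (c & E & Hc); [lra | |].
- intros c Hc; now apply is_derive_Reals, Hd.
- assert (f1 c <= 0) by (apply Hf; lra); nra.
Qed.

Section Picard.
Variable p : R -> R.
Hypothesis Hp : forall x, -1 < x < 1 -> continuous p x.

Lemma is_derive_RInt_0 (f : R -> R) (x : R) : (forall y, -1 < y < 1 -> continuous f y) ->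
  -1 < x < 1 -> is_derive (fun y => RInt f 0 y) x (f x).
Proof.
intros Hf Hx; apply (is_derive_RInt f (fun y => RInt f 0 y) 0 x); [|now apply Hf].
assert (Hd : 0 < 1 - Rabs x) by (apply Rlt_Rminus, Rabs_def1; lra).
exists (mkposreal _ Hd); intros y Hy; change R in (type of y).
apply (@RInt_correct R_CompleteNormedModule), (@ex_RInt_continuous R_CompleteNormedModule).
intros z Hz; apply Hf.
assert (Hy' : -1 < y < 1).
{ assert (A : Rabs (y - x) < 1 - Rabs x) by exact Hy.
  assert (B := Rabs_triang (y - x) x).
  replace (Rplus (Rminus y x) x) with (y : R) in B by (simpl; unfold Rminus; lra).
  assert (C : Rabs y < 1) by lra; apply Rabs_def2 in C; lra. }
unfold Rmin, Rmax in Hz; destruct (Rle_dec 0 y); lra.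
Qed.

Definition picard_accel (f : R -> R) (x : R) : R := - RInt (fun s => p s * f s) 0 x.

(** Iterates for the integral form of [u'' + p u = 0] with [u 0 = 1] and [u' 0 = 0]. [picard1] and
    [picard2] are their first two derivatives. *)
Fixpoint picard (n : nat) (x : R) : R :=
  match n with
  | O => 1
  | S n => 1 + RInt (picard_accel (picard n)) 0 x
  end.

Definition picard1 (n : nat) : R -> R :=
  match n with O => fun _ => 0 | S n => picard_accel (picard n) end.

Definition picard2 (n : nat) (x : R) : R :=
  match n with O => 0 | S n => - (p x * picard n x) end.

Lemma picard_derivatives (n : nat) : forall x, -1 < x < 1 ->
  is_derive (picard n) x (picard1 n x) /\ is_derive (picard1 n) x (picard2 n x).
Proof.
induction n as [|n IH]; intros x Hx; split.
- apply @is_derive_const.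
- apply @is_derive_const.
- evar_last; [apply @is_derive_plus; [apply @is_derive_const | apply is_derive_RInt_0]|].
  + intros y Hy; apply (ex_derive_continuous (picard_accel (picard n))).
    eexists; apply @is_derive_opp, is_derive_RInt_0; [|exact Hy].
    intros z Hz; apply (continuous_mult p (picard n)); [now apply Hp|].
    apply (ex_derive_continuous (picard n)); exists (picard1 n z); exact (proj1 (IH z Hz)).
  + exact Hx.
  + apply plus_zero_l.
- apply (is_derive_opp (fun x => RInt (fun s => p s * picard n s) 0 x)).
  apply (is_derive_RInt_0 (fun s => p s * picard n s)); [|exact Hx].
  intros z Hz; apply (continuous_mult p (picard n)); [now apply Hp|].
  apply (ex_derive_continuous (picard n)); exists (picard1 n z); exact (proj1 (IH z Hz)).
Qed.

Lemma picard_0 (n : nat) : picard n 0 = 1 /\ picard1 n 0 = 0.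
Proof.
destruct n as [|n]; simpl; [split; reflexivity|].
unfold picard_accel; rewrite !RInt_point; unfold zero; simpl; split; ring.
Qed.

(** Both [f - c exp (k x)] and [- f - c exp (k x)] are nonincreasing. In the norm weighted by
    [exp (- k |x|)], integration thus gains a factor [1 / k]. *)
Lemma exponential_bound_pos (f f1 : R -> R) (b k c : R) :
  (forall x, 0 <= x < b -> is_derive f x (f1 x)) ->
  (forall x, 0 <= x < b -> Rabs (f1 x) <= k * (c * exp (k * x))) ->
  Rabs (f 0) <= c -> forall x, 0 <= x < b -> Rabs (f x) <= c * exp (k * x).
Proof.
intros Hd Hb H0 x Hx.
assert (He : forall y, is_derive (fun z => c * exp (k * z)) y (k * (c * exp (k * y)))).
{ intros y; auto_derive; [trivial | ring]. }
assert (E0 : c * exp (k * 0) = c) by (rewrite Rmult_0_r, exp_0; ring).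
apply Rabs_le_between in H0; apply Rabs_le_between; split.
- assert (D := derivative_le_0 (fun y => - f y - c * exp (k * y))
    (fun y => - f1 y - k * (c * exp (k * y))) 0 x ltac:(lra)).
  cbv beta in D; rewrite E0 in D.
  assert (- f x - c * exp (k * x) <= - f 0 - c); [apply D | lra].
  + intros y Hy; apply @is_derive_minus; [apply @is_derive_opp, Hd; lra | apply He].
  + intros y Hy; specialize (Hb y ltac:(lra)); apply Rabs_le_between in Hb; lra.
- assert (D := derivative_le_0 (fun y => f y - c * exp (k * y))
    (fun y => f1 y - k * (c * exp (k * y))) 0 x ltac:(lra)).
  cbv beta in D; rewrite E0 in D.
  assert (f x - c * exp (k * x) <= f 0 - c); [apply D | lra].
  + intros y Hy; apply @is_derive_minus; [apply Hd; lra | apply He].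
  + intros y Hy; specialize (Hb y ltac:(lra)); apply Rabs_le_between in Hb; lra.
Qed.

Lemma is_derive_reflect (f : R -> R) (x l : R) :
  is_derive f (- x) l -> is_derive (fun y => f (- y)) x (- l).
Proof.
intros H; evar_last; [apply (is_derive_comp f Ropp); [exact H | apply @is_derive_opp, @is_derive_id]|].
unfold scal, opp, one; simpl; unfold mult; simpl; ring.
Qed.

Lemma exponential_bound (f f1 : R -> R) (b k c : R) :
  (forall x, - b < x < b -> is_derive f x (f1 x)) ->
  (forall x, - b < x < b -> Rabs (f1 x) <= k * (c * exp (k * Rabs x))) ->
  Rabs (f 0) <= c -> forall x, - b < x < b -> Rabs (f x) <= c * exp (k * Rabs x).
Proof.
intros Hd Hb H0 x Hx; destruct (Rle_or_lt 0 x) as [Hp0|Hn].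
- rewrite (Rabs_pos_eq x) by assumption.
  apply (exponential_bound_pos f f1 b); try lra.
  + intros y Hy; apply Hd; lra.
  + intros y Hy; specialize (Hb y); rewrite (Rabs_pos_eq y) in Hb by lra; apply Hb; lra.
- rewrite (Rabs_left x) by assumption; replace x with (- - x) at 1 by ring.
  apply (exponential_bound_pos (fun y => f (- y)) (fun y => - f1 (- y)) b).
  + intros y Hy; apply is_derive_reflect, Hd; lra.
  + intros y Hy; specialize (Hb (- y)); rewrite !Rabs_Ropp, (Rabs_pos_eq y) in Hb by lra.
    rewrite Rabs_Ropp; apply Hb; lra.
  + now rewrite Ropp_0.
  + lra.
Qed.

Lemma coefficient_bounded (b : R) : 0 < b < 1 ->
  exists M, forall x, - b <= x <= b -> Rabs (p x) <= M.
Proof.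
intros Hb.
destruct (continuity_ab_maj (fun x => Rabs (p x)) (- b) b) as (x & Hx & _); [lra | |].
- intros x Hx; apply (continuity_pt_comp p Rabs); [|apply Rcontinuity_abs].
  apply continuity_pt_filterlim, Hp; lra.
- now exists (Rabs (p x)).
Qed.

(** With [|p| <= M] on the interval and [k = 1 + 2 M], one iteration contracts the weighted norm by
    [M / k <= / 2], while [k >= 1] carries the bound from derivatives to functions. [p] may be
    unbounded near the ends, hence [b < 1]. *)
Lemma picard_contraction (b : R) : 0 < b < 1 -> exists k, forall n x, - b < x < b ->
  Rabs (picard (S n) x - picard n x) <= (/ 2) ^ n * exp (k * Rabs x) /\
  Rabs (picard1 (S n) x - picard1 n x) <= (/ 2) ^ n * exp (k * Rabs x).
Proof.
intros Hb.
destruct (coefficient_bounded b Hb) as [M HM].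
assert (HM0 : 0 <= M).
{ specialize (HM 0 ltac:(lra)); assert (P := Rabs_pos (p 0)); lra. }
exists (1 + 2 * M); set (k := 1 + 2 * M).
assert (Hsub : forall n x, - b < x < b ->
  is_derive (fun y => picard (S n) y - picard n y) x (picard1 (S n) x - picard1 n x)).
{ intros n x Hx; assert (Hx1 : -1 < x < 1) by lra.
  apply @is_derive_minus; [exact (proj1 (picard_derivatives (S n) x Hx1))|].
  exact (proj1 (picard_derivatives n x Hx1)). }
assert (Hsub1 : forall n x, - b < x < b ->
  is_derive (fun y => picard1 (S n) y - picard1 n y) x (picard2 (S n) x - picard2 n x)).
{ intros n x Hx; assert (Hx1 : -1 < x < 1) by lra.
  apply @is_derive_minus; [exact (proj2 (picard_derivatives (S n) x Hx1))|].
  exact (proj2 (picard_derivatives n x Hx1)). }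
assert (Step : forall n c, 0 <= c ->
  (forall x, - b < x < b -> Rabs (picard2 (S n) x - picard2 n x)
      <= k * (c * exp (k * Rabs x))) ->
  forall x, - b < x < b ->
  Rabs (picard (S n) x - picard n x) <= c * exp (k * Rabs x) /\
  Rabs (picard1 (S n) x - picard1 n x) <= c * exp (k * Rabs x)).
{ intros n c Hc H2.
  assert (H1 : forall x, - b < x < b ->
    Rabs (picard1 (S n) x - picard1 n x) <= c * exp (k * Rabs x)).
  { apply (exponential_bound _ _ b k c (Hsub1 n) H2).
    rewrite (proj2 (picard_0 (S n))), (proj2 (picard_0 n)), Rminus_0_r, Rabs_R0; assumption. }
  intros x Hx; split; [|now apply H1].
  revert x Hx; apply (exponential_bound _ _ b k c (Hsub n)).
  - intros x Hx; eapply Rle_trans; [now apply H1|].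
    assert (P : 0 <= c * exp (k * Rabs x)) by (apply Rmult_le_pos; [assumption | apply Rlt_le, exp_pos]).
    unfold k at 2; nra.
  - rewrite (proj1 (picard_0 (S n))), (proj1 (picard_0 n)), Rminus_diag, Rabs_R0; assumption. }
assert (Ek : forall x, 1 <= exp (k * Rabs x)).
{ intros x; rewrite <- exp_0; 
  assert (Q : 0 <= k * Rabs x) by (apply Rmult_le_pos; [unfold k; lra | apply Rabs_pos]).
  destruct Q as [Q|Q]; [left; now apply exp_increasing | rewrite <- Q; lra]. }
induction n as [|n IH].
- apply Step; [simpl; lra|]; intros x Hx; simpl.
  rewrite Rminus_0_r, Rmult_1_r, Rmult_1_l, Rabs_Ropp.
  specialize (HM x ltac:(lra)); specialize (Ek x); unfold k at 1; nra.
- apply Step; [apply pow_le; lra|]; intros x Hx.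
  assert (E : Rabs (- (p x * picard (S n) x) - picard2 (S n) x)
    = Rabs (p x) * Rabs (picard (S n) x - picard n x)).
  { rewrite <- Rabs_mult, <- Rabs_Ropp; f_equal; simpl; ring. }
  change (picard2 (S (S n)) x) with (- (p x * picard (S n) x)); rewrite E.
  specialize (HM x ltac:(lra)); destruct (IH x Hx) as [H1 _].
  apply Rle_trans with (M * ((/ 2) ^ n * exp (k * Rabs x))).
  { apply Rmult_le_compat; try apply Rabs_pos; assumption. }
  replace (k * ((/ 2) ^ S n * exp (k * Rabs x)))
    with (k / 2 * ((/ 2) ^ n * exp (k * Rabs x))) by (simpl; field).
  apply Rmult_le_compat_r; [|unfold k; lra].
  apply Rmult_le_pos; [apply pow_le; lra | apply Rlt_le, exp_pos].
Qed.

Lemma geometric_CVU (f : nat -> R -> R) (D : R -> Prop) (E : R) :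
  (forall n x, D x -> Rabs (f (S n) x - f n x) <= (/ 2) ^ n * E) -> CVU_dom f D.
Proof.
intros H; apply CVU_dom_cauchy; intros eps.
assert (T : forall k n x, D x -> Rabs (f (n + k)%nat x - f n x) <= 2 * (/ 2) ^ n * Rabs E).
(* The telescoped difference of powers is the form that survives the induction on [k]. *)
{ assert (T' : forall k n x, D x ->
    Rabs (f (n + k)%nat x - f n x) <= 2 * ((/ 2) ^ n - (/ 2) ^ (n + k)) * Rabs E).
  { induction k as [|k IH]; intros n x Hx.
    - rewrite Nat.add_0_r, !Rminus_diag, Rabs_R0; lra.
    - specialize (IH n x Hx); specialize (H (n + k)%nat x Hx).
      rewrite Nat.add_succ_r.
      replace (f (S (n + k)) x - f n x)
        with ((f (S (n + k)) x - f (n + k)%nat x) + (f (n + k)%nat x - f n x)) by ring.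
      eapply Rle_trans; [apply Rabs_triang|].
      assert (A : (/ 2) ^ (n + k) * E <= (/ 2) ^ (n + k) * Rabs E).
      { apply Rmult_le_compat_l; [apply pow_le; lra | apply Rle_abs]. }
      replace ((/ 2) ^ S (n + k)) with ((/ 2) ^ (n + k) / 2) by (simpl; field).
      lra. }
  intros k n x Hx; eapply Rle_trans; [now apply T'|].
  apply Rmult_le_compat_r; [apply Rabs_pos|].
  assert (P : 0 <= (/ 2) ^ (n + k)) by (apply pow_le; lra); lra. }
destruct (pow_lt_1_zero (/ 2) ltac:(rewrite Rabs_pos_eq; lra)
  (eps / (4 * (1 + Rabs E)))) as [N HN].
{ apply Rdiv_lt_0_compat; [apply cond_pos | assert (P := Rabs_pos E); lra]. }
exists N; intros n m x Hx Hn Hm.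
assert (B : forall i, (N <= i)%nat -> Rabs (f i x - f N x) < eps / 2).
{ intros i Hi; replace i with (N + (i - N))%nat by lia.
  eapply Rle_lt_trans; [now apply T|].
  specialize (HN N (le_n N)); rewrite Rabs_pos_eq in HN by (apply pow_le; lra).
  assert (P := Rabs_pos E).
  apply Rle_lt_trans with (2 * (/ 2) ^ N * (1 + Rabs E)).
  { apply Rmult_le_compat_l; [|lra]; apply Rmult_le_pos; [lra | apply pow_le; lra]. }
  apply Rlt_le_trans with (2 * (eps / (4 * (1 + Rabs E))) * (1 + Rabs E)).
  { apply Rmult_lt_compat_r; lra. }
  right; field; lra. }
replace (f n x - f m x) with ((f n x - f N x) + - (f m x - f N x)) by ring.
eapply Rle_lt_trans; [apply Rabs_triang|]; rewrite Rabs_Ropp.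
assert (B1 := B n Hn); assert (B2 := B m Hm); lra.
Qed.

Definition ode_solution (x : R) : R := Lim_seq (fun n => picard n x).
Definition ode_solution1 (x : R) : R := Lim_seq (fun n => picard1 n x).

Lemma open_interval (b : R) : open (fun x => - b < x < b).
Proof. apply open_and; [apply open_gt | apply open_lt]. Qed.

Lemma CVU_ext (f g : nat -> R -> R) (D : R -> Prop) :
  (forall n x, D x -> f n x = g n x) -> CVU_dom f D -> CVU_dom g D.
Proof.
intros E H eps; destruct (H eps) as [N HN]; exists N; intros n Hn x Hx.
rewrite <- (E n x Hx), <- (Lim_seq_ext (fun m => f m x)); [now apply HN|].
intros m; now apply E.
Qed.

(** Uniform convergence of the iterates and of their first two derivatives on an interval around [x]
    allows differentiating the limit twice. *)
Lemma ode_solution_derivatives (x : R) : -1 < x < 1 ->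
  is_derive ode_solution x (ode_solution1 x) /\
  is_derive ode_solution1 x (- (p x * ode_solution x)).
Proof.
intros Hx; set (b := (1 + Rabs x) / 2).
assert (Hxb : Rabs x < b < 1).
{ assert (Rabs x < 1) by (apply Rabs_def1; lra); unfold b; lra. }
assert (HD : - b < x < b) by (destruct Hxb as [H _]; apply Rabs_def2 in H; lra).
assert (Hb : 0 < b < 1) by (assert (P := Rabs_pos x); lra).
destruct (picard_contraction b Hb) as [k Hk].
set (D := fun y => - b < y < b).
assert (Hexp : forall y, D y -> exp (k * Rabs y) <= exp (Rabs k * b)).
{ intros y Hy; assert (Q : k * Rabs y <= Rabs k * b).
  { apply Rle_trans with (Rabs k * Rabs y).
    - apply Rmult_le_compat_r; [apply Rabs_pos | apply Rle_abs].
    - apply Rmult_le_compat_l; [apply Rabs_pos|]; apply Rlt_le, Rabs_def1; apply Hy. }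
  destruct Q as [Q|Q]; [left; now apply exp_increasing | rewrite Q; lra]. }
assert (Hpow : forall n, 0 <= (/ 2) ^ n) by (intros; apply pow_le; lra).
assert (CV : CVU_dom picard D).
{ apply (geometric_CVU _ _ (exp (Rabs k * b))); intros n y Hy.
  eapply Rle_trans; [exact (proj1 (Hk n y Hy))|]; apply Rmult_le_compat_l; auto. }
assert (CV1 : CVU_dom picard1 D).
{ apply (geometric_CVU _ _ (exp (Rabs k * b))); intros n y Hy.
  eapply Rle_trans; [exact (proj2 (Hk n y Hy))|]; apply Rmult_le_compat_l; auto. }
assert (HD1 : forall y, D y -> -1 < y < 1) by (unfold D; intros; lra).
assert (Dn : forall n y, D y -> Derive (picard n) y = picard1 n y).
{ intros n y Hy; exact (is_derive_unique _ _ _ (proj1 (picard_derivatives n y (HD1 y Hy)))). }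
assert (Dn1 : forall n y, D y -> Derive (picard1 n) y = picard2 n y).
{ intros n y Hy; exact (is_derive_unique _ _ _ (proj2 (picard_derivatives n y (HD1 y Hy)))). }
assert (Conn : is_connected D).
{ intros y z w Hy Hz Hw; unfold D in *; lra. }
assert (Cp : forall y, D y -> continuity_pt p y).
{ intros y Hy; apply continuity_pt_filterlim, Hp; now apply HD1. }
assert (Cn : forall n y, D y -> continuity_pt (picard n) y).
{ intros n y Hy; apply continuity_pt_filterlim, (ex_derive_continuous (picard n)).
  exists (picard1 n y); exact (proj1 (picard_derivatives n y (HD1 y Hy))). }
assert (Cext : forall f g : R -> R, (forall y, D y -> f y = g y) ->
  forall y, D y -> continuity_pt f y -> continuity_pt g y).
{ intros f g E y Hy C; apply continuity_pt_filterlim.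
  apply continuous_ext_loc with f; [|now apply continuity_pt_filterlim].
  generalize (open_interval b y Hy); apply filter_imp; intros z Hz; now apply E. }
split.
- evar_last.
  { apply (CVU_Derive picard D (open_interval b) Conn CV).
    - intros n y Hy; exists (picard1 n y); exact (proj1 (picard_derivatives n y (HD1 y Hy))).
    - intros n y Hy; apply (Cext (picard1 n)); try assumption.
      + intros; symmetry; now apply Dn.
      + apply continuity_pt_filterlim, (ex_derive_continuous (picard1 n)).
        exists (picard2 n y); exact (proj2 (picard_derivatives n y (HD1 y Hy))).
    - apply CVU_ext with picard1; [|assumption]; intros; symmetry; now apply Dn.
    - exact HD. }
  unfold ode_solution1; f_equal; apply Lim_seq_ext; intros n; now apply Dn.
- evar_last.
  { apply (CVU_Derive picard1 D (open_interval b) Conn CV1).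
    - intros n y Hy; exists (picard2 n y); exact (proj2 (picard_derivatives n y (HD1 y Hy))).
    - intros n y Hy; apply (Cext (picard2 n)); try assumption.
      + intros; symmetry; now apply Dn1.
      + destruct n as [|n]; simpl.
        * apply continuity_pt_const; intros ? ?; reflexivity.
        * apply continuity_pt_opp, continuity_pt_mult; auto.
    - apply CVU_ext with picard2; [intros; symmetry; now apply Dn1|].
      destruct (coefficient_bounded b Hb) as [M HM].
      (* The factor 2 pays for the index shift: [picard2 (S n)] involves [picard n]. *)
      apply (geometric_CVU _ _ (2 * (M * exp (Rabs k * b)))); intros n y Hy.
      assert (HMy := HM y ltac:(unfold D in Hy; lra)); assert (P := Rabs_pos (p y)).
      assert (Ey : 1 <= exp (Rabs k * b)).
      { assert (Q := exp_ineq1_le (Rabs k * b)).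
        assert (0 <= Rabs k * b) by (apply Rmult_le_pos; [apply Rabs_pos | lra]); lra. }
      destruct n as [|n].
      + simpl; rewrite Rminus_0_r, Rmult_1_r, Rmult_1_l, Rabs_Ropp; nra.
      + replace (picard2 (S (S n)) y - picard2 (S n) y)
          with (- p y * (picard (S n) y - picard n y)) by (simpl; ring).
        rewrite Rabs_mult, Rabs_Ropp.
        replace ((/ 2) ^ S n * (2 * (M * exp (Rabs k * b))))
          with (M * ((/ 2) ^ n * exp (Rabs k * b))) by (simpl; field).
        apply Rmult_le_compat; try apply Rabs_pos; [assumption|].
        eapply Rle_trans; [exact (proj1 (Hk n y Hy))|]; apply Rmult_le_compat_l; auto.
    - exact HD. }
  rewrite (Lim_seq_ext _ (fun n => picard2 n x)) by (intros n; now apply Dn1).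
  rewrite <- Lim_seq_incr_1; simpl.
  assert (L := Lim_seq_correct' _ (CVU_CVS_dom picard D CV x HD)).
  apply (is_lim_seq_scal_l _ (- p x)) in L.
  rewrite (is_lim_seq_unique _ (- p x * ode_solution x)); [simpl; ring|].
  eapply is_lim_seq_ext; [|exact L]; intros n; simpl; ring.
Qed.

Lemma ode_solution_0 : ode_solution 0 = 1 /\ ode_solution1 0 = 0.
Proof.
unfold ode_solution, ode_solution1; split.
- rewrite (Lim_seq_ext _ (fun _ => 1) (fun n => proj1 (picard_0 n))); now rewrite Lim_seq_const.
- rewrite (Lim_seq_ext _ (fun _ => 0) (fun n => proj2 (picard_0 n))); now rewrite Lim_seq_const.
Qed.

Lemma ode_solution_solves : solves_ode p ode_solution.
Proof.
intros x Hx; destruct (ode_solution_derivatives x Hx) as [D1 D2].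
assert (E : locally x (fun y => ode_solution1 y = Derive ode_solution y)).
{ assert (O : open (fun y : R => -1 < y < 1)) by (apply open_and; [apply open_gt | apply open_lt]).
  generalize (O x Hx); apply filter_imp; intros y Hy.
  symmetry; exact (is_derive_unique _ _ _ (proj1 (ode_solution_derivatives y Hy))). }
assert (D3 := is_derive_ext_loc _ _ _ _ E D2).
split; [now exists (ode_solution1 x)|]; split; [eexists; exact D3|].
rewrite (is_derive_unique _ _ _ D3); ring.
Qed.
End Picard.

(* With [r = (1 - x^2) u'/u + x] the equation becomes
   [(1 - x^2) r' = 1 - (1 - x^2)^2 p - r^2], so [r] blows up before [x = 1]. *)
Lemma ode_zero_exists (p u v : R -> R) :
  (forall x, 0 <= x < 1 -> is_derive u x (v x)) ->
  (forall x, 0 <= x < 1 -> is_derive v x (- (p x * u x))) ->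
  u 0 = 1 -> v 0 = 0 ->
  (forall x, 0 <= x < 1 -> 1 <= (1 - x ^ 2) ^ 2 * p x) -> 1 < p 0 ->
  exists x, 0 < x < 1 /\ u x = 0.
Proof.
intros Hu Hv Hu0 Hv0 Hm Hm0.
destruct (classic (exists x, 0 < x < 1 /\ u x = 0)) as [|N]; [assumption|exfalso].
assert (Up : forall x, 0 <= x < 1 -> 0 < u x).
{ intros x Hx; destruct (Rlt_or_le 0 (u x)) as [|Hle]; [assumption|exfalso].
  assert (Hx0 : 0 < x) by (destruct (Req_dec x 0) as [->|]; lra).
  destruct Hle as [Hlt|E]; [|apply N; exists x; split; [lra | assumption]].
  destruct (Ranalysis5.IVT_interv (fun y => - u y) 0 x) as (y & Hy & Ey); try lra.
  - intros y Hy; apply continuity_pt_opp, continuity_pt_filterlim, (ex_derive_continuous u).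
    exists (v y); apply Hu; lra.
  - apply N; exists y; split; [|lra].
    destruct (Req_dec y 0) as [->|]; lra. }
set (r := fun x => v x / u x * (1 - x ^ 2) + x).
set (r1 := fun x => (1 - (1 - x ^ 2) ^ 2 * p x - r x ^ 2) / (1 - x ^ 2)).
assert (Xp : forall x, 0 <= x < 1 -> 0 < 1 - x ^ 2) by (intros; nra).
assert (Dr : forall x, 0 <= x < 1 -> is_derive r x (r1 x)).
{ intros x Hx; assert (P := Up x Hx); assert (Q := Xp x Hx).
  assert (D1 := is_derive_div v u x _ _ (Hv x Hx) (Hu x Hx) ltac:(lra)).
  assert (D2 : is_derive (fun y : R => 1 - y ^ 2) x (- (2 * x))) by (auto_derive; [trivial | ring]).
  evar_last; [apply @is_derive_plus; [apply (is_derive_mult_R _ _ _ _ _ D1 D2) | apply @is_derive_id]|].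
  unfold r1, r, plus, one; simpl; field; split; simpl in *; lra. }
assert (R0 : r 0 = 0) by (unfold r; rewrite Hu0, Hv0; field).
assert (Rle : forall x, 0 <= x < 1 -> r1 x <= - (r x ^ 2 / (1 - x ^ 2))).
{ intros x Hx; assert (Q := Xp x Hx); specialize (Hm x Hx); unfold r1.
  replace (- (r x ^ 2 / (1 - x ^ 2))) with ((- r x ^ 2) / (1 - x ^ 2)) by (field; lra).
  apply Rmult_le_compat_r; [apply Rlt_le; now apply Rinv_0_lt_compat | lra]. }
assert (Rle0 : forall x, 0 <= x < 1 -> r1 x <= 0).
{ intros x Hx; eapply Rle_trans; [now apply Rle|]; assert (Q := Xp x Hx).
  assert (0 <= r x ^ 2 / (1 - x ^ 2)); [|lra].
  apply Rdiv_le_0_compat; [apply pow2_ge_0 | assumption]. }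
(* [r 0 = 0] and [r' 0 = 1 - p 0 < 0]: the strict inequality at 0 starts the descent. *)
assert (Hx1 : exists x1, 0 < x1 < 1 /\ r x1 < 0).
{ assert (D := Dr 0 ltac:(lra)).
  assert (E : r1 0 = 1 - p 0) by (unfold r1; rewrite R0; field).
  rewrite E in D.
  destruct (proj1 (is_derive_eps _ _ _) D ((p 0 - 1) / 2)) as (d & Hd & H); [lra|].
  set (x1 := Rmin d 1 / 2).
  assert (M1 := Rmin_l d 1); assert (M2 := Rmin_r d 1).
  assert (M3 : 0 < Rmin d 1) by (apply Rmin_pos; lra).
  assert (Hx1 : 0 < x1 < 1) by (unfold x1; lra).
  exists x1; split; [assumption|].
  specialize (H x1); rewrite Rminus_0_r, R0, Rminus_0_r, (Rabs_pos_eq x1) in H by lra.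
  specialize (H ltac:(unfold x1; lra)); apply Rabs_le_between in H; nra. }
destruct Hx1 as (x1 & Hx1 & Hr1).
assert (Rneg : forall x, x1 <= x < 1 -> r x < 0).
{ intros x Hx; eapply Rle_lt_trans; [|exact Hr1].
  apply (derivative_le_0 r r1); [lra | |]; intros y Hy; [apply Dr | apply Rle0]; lra. }
(* The inequality [r' <= - r^2 / (1 - x^2)] integrates to the monotonicity of the inverse hyperbolic
   tangent minus [1 / r]. As [- / r] is positive, that tangent would stay bounded up to [x = 1]. *)
set (F := fun x => - / r x + / 2 * (ln (1 + x) - ln (1 - x))).
assert (FF : forall x, x1 <= x < 1 -> F x <= F x1).
{ intros x Hx.
  apply (derivative_le_0 F (fun y => r1 y / r y ^ 2 + / (1 - y ^ 2))); [lra | |].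
  - intros y Hy; assert (Q := Xp y ltac:(lra)); assert (Ny := Rneg y ltac:(lra)).
    apply @is_derive_plus.
    + evar_last; [apply @is_derive_opp, is_derive_inv; [apply Dr; lra | lra]|].
      unfold opp; simpl; field; lra.
    + auto_derive; [lra|]; field; repeat split; simpl in *; lra.
  - intros y Hy; assert (Q := Xp y ltac:(lra)); assert (Ny := Rneg y ltac:(lra)).
    assert (P : 0 < r y ^ 2) by nra.
    specialize (Rle y ltac:(lra)).
    apply Rmult_le_reg_r with (r y ^ 2); [assumption|].
    replace ((r1 y / r y ^ 2 + / (1 - y ^ 2)) * r y ^ 2)
      with (r1 y + r y ^ 2 / (1 - y ^ 2)) by (field; lra).
    lra. }
(* At the point with [- / 2 * ln (1 - x) = K] the function [F] exceeds [F x1]; the second entry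
   ensures [x1 <= x]. *)
set (K := Rmax (F x1) (- / 2 * ln (1 - x1))).
set (x := 1 - exp (- 2 * K)).
assert (M1 := Rmax_l (F x1) (- / 2 * ln (1 - x1))).
assert (M2 := Rmax_r (F x1) (- / 2 * ln (1 - x1))).
fold K in M1, M2.
assert (Hx : x1 <= x < 1).
{ unfold x; assert (P := exp_pos (- 2 * K)); split; [|lra].
  assert (exp (- 2 * K) <= 1 - x1); [|lra].
  rewrite <- (exp_ln (1 - x1)) by lra.
  destruct (Req_dec (- 2 * K) (ln (1 - x1))) as [->|]; [lra|].
  left; apply exp_increasing; lra. }
specialize (FF x Hx); specialize (Rneg x Hx).
assert (L1 : ln (1 - x) = - 2 * K).
{ unfold x; replace (1 - (1 - exp (- 2 * K))) with (exp (- 2 * K)) by ring; apply ln_exp. }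
assert (L2 : 0 <= ln (1 + x)) by (rewrite <- ln_1; apply ln_le; lra).
assert (L3 : / r x < 0) by now apply Rinv_lt_0_compat.
unfold F in FF at 1; rewrite L1 in FF; lra.
Qed.

(** Monotonicity squeezes [(1 - x^2)^2 p x] between its limit 1 and its value [p 0] at the origin,
    so only [p 0 > 1] has to be excluded. *)
Lemma nehari_extremal (p : R -> R) : nehari_function p ->
  filterlim (fun x : R => (1 - x ^ 2) ^ 2 * p x) (at_left 1) (locally 1) ->
  forall x : R, -1 < x < 1 -> p x = / (1 - x ^ 2) ^ 2.
Proof.
intros (Hpos & Hcont & Heven & Hmono & Hdis) Hlim.
assert (Hm : forall x, 0 <= x < 1 -> 1 <= (1 - x ^ 2) ^ 2 * p x).
{ intros x Hx; destruct (Rle_or_lt 1 ((1 - x ^ 2) ^ 2 * p x)) as [|Hlt]; [assumption|exfalso].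
  assert (He : 0 < 1 - (1 - x ^ 2) ^ 2 * p x) by lra.
  destruct (proj1 (filterlim_locally _ _) Hlim (mkposreal _ He)) as [d Hd].
  assert (D := cond_pos d).
  set (y := Rmax x (1 - d / 2)).
  assert (M1 := Rmax_l x (1 - d / 2)); assert (M2 := Rmax_r x (1 - d / 2)).
  assert (My : y < 1) by (apply Rmax_lub_lt; lra).
  fold y in M1, M2.
  assert (B : ball 1 (mkposreal _ He) ((1 - y ^ 2) ^ 2 * p y)).
  { apply Hd; [|lra]; apply Rabs_def1; unfold minus, plus, opp; simpl; lra. }
  apply Rabs_def2 in B; unfold minus, plus, opp in B; simpl in B.
  specialize (Hmono x y ltac:(lra) M1 My); simpl in Hmono, He; lra. }
assert (H0 : p 0 <= 1).
{ destruct (Rle_or_lt (p 0) 1) as [|Hgt]; [assumption|exfalso].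
  set (u := ode_solution p); set (v := ode_solution1 p).
  destruct (ode_solution_0 p) as [U0 V0]; fold u in U0; fold v in V0.
  assert (Du : forall x, -1 < x < 1 -> is_derive u x (v x) /\ is_derive v x (- (p x * u x)))
    by (intros; now apply ode_solution_derivatives).
  destruct (ode_zero_exists p u v) as (x & Hx & Ex); try assumption.
  { intros x Hx; apply Du; lra. }
  { intros x Hx; apply Du; lra. }
  (* Since [p] is even, the reflected solution satisfies the same equation; its zero gives a second
     zero of [u], on the negative side. *)
  destruct (ode_zero_exists p (fun y => u (- y)) (fun y => - v (- y))) as (y & Hy & Ey);
    try assumption.
  { intros y Hy; apply is_derive_reflect, Du; lra. }
  { intros y Hy; rewrite <- (Heven y) by lra.
    assert (D := is_derive_reflect v y _ (proj2 (Du (- y) ltac:(lra)))).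
    evar_last; [apply @is_derive_opp; exact D | unfold opp; simpl; ring]. }
  { now rewrite Ropp_0. }
  { rewrite Ropp_0, V0; ring. }
  assert (x = - y); [|lra].
  apply (Hdis u); try lra; try assumption.
  - now apply ode_solution_solves.
  - exists 0; split; [lra | rewrite U0; lra]. }
assert (Hpos' : forall x, 0 <= x < 1 -> p x = / (1 - x ^ 2) ^ 2).
{ intros x Hx; assert (A := Hm x Hx); assert (B := Hmono 0 x ltac:(lra) ltac:(lra) ltac:(lra)).
  replace ((1 - 0 ^ 2) ^ 2) with 1 in B by ring.
  assert (Q : 0 < (1 - x ^ 2) ^ 2) by (apply pow_lt; nra).
  apply Rmult_eq_reg_l with ((1 - x ^ 2) ^ 2); [|lra].
  rewrite Rinv_r by lra; lra. }
intros x Hx; destruct (Rle_or_lt 0 x) as [|Hn]; [apply Hpos'; lra|].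
rewrite <- (Heven x) by assumption; rewrite Hpos' by lra; do 3 f_equal; ring.
Qed.

(** * Univalence, the distance [PI / delta], and the valence bound *)

Theorem theorem2 (p : R -> R) (c delta mu : R)
  (Hp : nehari_function p)
  (Hdelta : 0 < delta)
  (Hc : c = 2 * (1 + delta ^ 2))
  (Hmu : filterlim (fun x : R => (1 - x ^ 2) ^ 2 * p x) (at_left 1) (locally mu)) :
  (forall (h g q : C -> C) (z0 : C),
     liftable_harmonic_map h g q -> in_disk z0 -> schwarzian_bound h g c p ->
     uniformly_locally_univalent (lift h g q z0))
  /\
  (mu = 1 ->
     (forall x : R, -1 < x < 1 -> p x = / (1 - x ^ 2) ^ 2) /\
     (forall (h g q : C -> C) (z0 : C),
        liftable_harmonic_map h g q -> in_disk z0 -> schwarzian_bound h g c p ->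
        forall a b : C, in_disk a -> in_disk b -> a <> b ->
          lift h g q z0 a = lift h g q z0 b ->
          PI / delta <= hyperbolic_dist a b))
  /\
  (c * mu < 2 ->
     exists N : nat,
       forall (h g q : C -> C) (z0 : C),
         liftable_harmonic_map h g q -> in_disk z0 -> schwarzian_bound h g c p ->
         Rbar_le (valence (lift h g q z0)) (INR N)).
Proof.
assert (Hcpos : 0 < c) by (rewrite Hc; assert (P := pow2_ge_0 delta); lra).
split; [|split].
- intros h g q z0 HL Hz0 HS; exists (hyperbolic_gap p c); split.
  + now apply hyperbolic_gap_pos.
  + intros a b Ha Hb Hab Hret; now apply (hyperbolic_separation p c Hp Hcpos h g q z0).
- intros ->; assert (Ep := nehari_extremal p Hp Hmu); split; [exact Ep|].
  intros h g q z0 HL Hz0 HS a b Ha Hb Hab Hret.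
  apply Rle_div_l; [assumption|]; rewrite Rmult_comm.
  apply (lift_return_distance h g q z0); try assumption; [lra|].
  intros e t He _ _; assert (Hin := geodesic_in_disk a e Ha He t).
  eapply Rle_trans; [now apply (schwarzian_bound_weighted _ _ c p)|].
  assert (Hr : 0 <= Cmod (geodesic a e t) < 1) by (split; [apply Cmod_ge_0 | exact Hin]).
  (* For the extremal [p] the weighted coefficient is identically 1, so the weighted bound is
     exactly [2 (1 + delta^2)]. *)
  rewrite Ep by lra; rewrite Rinv_r, <- Hc; [lra|].
  apply pow_nonzero; nra.
- intros Hlt; destruct (euclidean_separation p c Hp Hcpos mu Hlt Hmu) as (eta & Heta & Hsep).
  destruct (separated_list_length eta Heta) as [N HN]; exists N.
  intros h g q z0 HL Hz0 HS; apply valence_le; intros P l Hl Hz.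
  apply HN; [assumption | intros z Hin; now apply Hz |].
  intros a b Ha Hb Hab; destruct (Hz a Ha) as [Da Ea], (Hz b Hb) as [Db Eb].
  apply (Hsep h g q z0); try assumption; [now split | now rewrite Ea, Eb].
Qed.
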